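(* Let $S=\mathbb{C}[[X,Y,Z]]$ and let $G$ be a finite subgroup of $\operatorname{GL}_3(\mathbb{C})$ without pseudo-reflections, acting on $S$. Suppose that $R=S^G$ is an isolated singularity. Then there is an equivalence of categories $$\frac{\operatorname{CM}(R)}{[S]}\simeq\operatorname{mod}\left(\frac{S*G}{(e)}\right)^{\operatorname{op}},$$ where $S*G$ is the skew-group algebra and $e\in S*G$ is the idempotent corresponding to the trivial representation of $G$.
   Context: $G$ acts on $S$ by linear substitution of the variables, and $S^G$ is the ring of invariants. $\operatorname{CM}(R)$ is the category of (maximal) Cohen-Macaulay $R$-modules. $\operatorname{CM}(R)/[S]$ is the category with the same objects and morphisms $\operatorname{Hom}_R(M,N)/[S](M,N)$, where $[S](M,N)$ is the set of morphisms factoring through a finite direct sum of direct summands of the $R$-module $S$. The skew-group algebra $S*G$ is the free left $S$-module with basis $G$ and multiplication $(sg)(s'g')=s\,g(s')\,gg'$. The idempotent is $e=\frac{1}{\#G}\sum_{g\in G}g$, and $(e)$ is the two-sided ideal it generates. $\operatorname{mod}$ of a ring denotes its category of finitely presented modules. *)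

(* Defs.v *)
From HB Require Import structures.
From mathcomp Require Import all_boot all_order all_algebra.
From mathcomp Require Import generic_quotient ring_quotient.
From mathcomp Require Import finmap boolp reals complex mpoly ring.

Set Implicit Arguments.
Unset Strict Implicit.
Unset Printing Implicit Defensive.

Import GRing.Theory.
Local Open Scope ring_scope.

(* Formal power series in n variables: a series is its family of coefficients. *)
Definition mfps (n : nat) (F : comNzRingType) : Type := 'X_{1..n} -> F.

Section PowerSeries.
Context {n : nat} {F : comNzRingType}.
Local Notation S := (mfps n F).
Implicit Types (f g h : S) (m : 'X_{1..n}).

HB.instance Definition _ := gen_eqMixin S.
HB.instance Definition _ := gen_choiceMixin S.

Definition mfps_zero : S := fun=> 0.
Definition mfps_opp f : S := fun m => - f m.
Definition mfps_add f g : S := fun m => f m + g m.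

Lemma mfps_addA : associative mfps_add.
Proof. by move=> f g h; apply: funext => m; apply: addrA. Qed.
Lemma mfps_addC : commutative mfps_add.
Proof. by move=> f g; apply: funext => m; apply: addrC. Qed.
Lemma mfps_add0 : left_id mfps_zero mfps_add.
Proof. by move=> f; apply: funext => m; apply: add0r. Qed.
Lemma mfps_addN : left_inverse mfps_zero mfps_opp mfps_add.
Proof. by move=> f; apply: funext => m; apply: addNr. Qed.

HB.instance Definition _ :=
  GRing.isZmodule.Build S mfps_addA mfps_addC mfps_add0 mfps_addN.

Definition mfps_const (c : F) : S := fun m => c *+ (m == 0%MM).

Definition mfps_mul f g : S := fun m =>
  \sum_(k : 'X_{1..n < (mdeg m).+1, (mdeg m).+1} | m == (k.1 + k.2)%MM)
    f k.1 * g k.2.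

(* p and f have the same coefficients in degrees < N; this reduces the ring
   axioms to those of polynomials. *)
Definition mfps_approx (N : nat) (p : {mpoly F[n]}) f :=
  forall m, (mdeg m < N)%N -> p@_m = f m.

Definition mfps_trunc (N : nat) f : {mpoly F[n]} :=
  \sum_(k : 'X_{1..n < N}) f k *: 'X_[k].

Lemma mfps_truncP N f : mfps_approx N (mfps_trunc N f) f.
Proof. by move=> m /(mcoeff_mpoly f) mE; rewrite -mE. Qed.

Lemma mfps_approxC N c : mfps_approx N c%:MP (mfps_const c).
Proof. by move=> m _; rewrite mcoeffC mulr_natr. Qed.

Lemma mfps_approxD N p q f g :
  mfps_approx N p f -> mfps_approx N q g -> mfps_approx N (p + q) (f + g).
Proof. by move=> pf qg m lt_mN; rewrite mcoeffD pf ?qg. Qed.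

Lemma mfps_approxM N p q f g : mfps_approx N p f -> mfps_approx N q g ->
  mfps_approx N (p * q) (mfps_mul f g).
Proof.
move=> pf qg m lt_mN; rewrite mcoeffM; apply: eq_bigr => k _.
by rewrite pf ?qg // (leq_trans _ lt_mN) // bmdeg.
Qed.

Lemma mfps_approx_inj f g :
  (forall N, exists2 p, mfps_approx N p f & mfps_approx N p g) -> f = g.
Proof.
move=> fg; apply: funext => m.
by have [p pf pg] := fg (mdeg m).+1; rewrite -pf ?pg.
Qed.

Lemma mfps_mulA : associative mfps_mul.
Proof.
move=> f g h; apply: mfps_approx_inj => N.
have [[af ag] ah] := (@mfps_truncP N f, @mfps_truncP N g, @mfps_truncP N h).
exists (mfps_trunc N f * (mfps_trunc N g * mfps_trunc N h)).
  by do 2?apply: mfps_approxM.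
by rewrite mulrA; do 2?apply: mfps_approxM.
Qed.

Lemma mfps_mulC : commutative mfps_mul.
Proof.
move=> f g; apply: mfps_approx_inj => N.
have [af ag] := (@mfps_truncP N f, @mfps_truncP N g).
exists (mfps_trunc N f * mfps_trunc N g); first exact: mfps_approxM.
by rewrite mulrC; apply: mfps_approxM.
Qed.

Lemma mfps_mul1 : left_id (mfps_const 1) mfps_mul.
Proof.
move=> f; apply: mfps_approx_inj => N; have af := @mfps_truncP N f.
exists (mfps_trunc N f) => //; rewrite -[mfps_trunc N f]mul1r.
by apply: mfps_approxM => //; apply: mfps_approxC.
Qed.

Lemma mfps_mulDl : left_distributive mfps_mul +%R.
Proof.
move=> f g h; apply: mfps_approx_inj => N.
have [[af ag] ah] := (@mfps_truncP N f, @mfps_truncP N g, @mfps_truncP N h).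
exists ((mfps_trunc N f + mfps_trunc N g) * mfps_trunc N h).
  by apply: mfps_approxM => //; apply: mfps_approxD.
by rewrite mulrDl; apply: mfps_approxD; apply: mfps_approxM.
Qed.

Lemma mfps_1neq0 : mfps_const 1 != 0 :> S.
Proof.
apply/eqP => /(congr1 (fun f : S => f 0%MM)) /eqP.
by rewrite /mfps_const eqxx mulr1n oner_eq0.
Qed.

HB.instance Definition _ := GRing.Zmodule_isComNzRing.Build S
  mfps_mulA mfps_mulC mfps_mul1 mfps_mulDl mfps_1neq0.

End PowerSeries.

(* Linear substitution: 'X_j is sent to \sum_i A i j *: 'X_i, the j-th column of
   A, so that (A *m B) acts as A after B. As 'X_[k] is sent to a form of degree
   mdeg k, the coefficient of m only involves the k with mdeg k = mdeg m. *)
Section LinearSubstitution.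
Context {n : nat} {F : comNzRingType}.
Local Notation S := (mfps n F).
Implicit Types (A B : 'M[F]_n) (f g : S) (m : 'X_{1..n}).

Definition linear_forms A : n.-tuple {mpoly F[n]} :=
  [tuple \sum_(i < n) A i j *: 'X_i | j < n].

Definition mfps_subst A f : S := fun m =>
  \sum_(k : 'X_{1..n < (mdeg m).+1}) f k * ('X_[k] \mPo linear_forms A)@_m.

Lemma linear_forms_homog A k :
  ('X_[k] \mPo linear_forms A) \is (mdeg k).-homog.
Proof.
rewrite comp_mpolyX mdegE.
apply: (big_ind2 (fun (p : {mpoly F[n]}) (d : nat) => p \is d.-homog)).
- exact: dhomog1.
- by move=> p d q e; apply: dhomogM.
- move=> j _; 
  suff /(dhomogMn (k j)) : tnth (linear_forms A) j \is 1.-homog by rewrite mul1n.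
  rewrite tnth_mktuple; apply: rpred_sum => i _.
  by apply: rpredZ; rewrite dhomogX; apply/eqP; apply: mdeg1.
Qed.

Lemma mfps_approx_subst N A p f : mfps_approx N p f ->
  mfps_approx N (p \mPo linear_forms A) (mfps_subst A f).
Proof.
move=> pf m lt_mN; rewrite /mfps_subst.
pose q := mfps_trunc (mdeg m).+1 f.
transitivity ((q \mPo linear_forms A)@_m); last first.
  rewrite /q /mfps_trunc (raddf_sum (comp_mpoly _)) (raddf_sum (mcoeff m)).
  apply: eq_bigr => k _ /=.
  by rewrite comp_mpolyZ mcoeffZ.
apply/eqP; rewrite -subr_eq0 -mcoeffB -comp_mpolyB.
rewrite comp_mpolyEX raddf_sum /=; apply/eqP/big1 => k _; rewrite mcoeffZ.
have [eq_km|ne_km] := eqVneq (mdeg m) (mdeg k).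
  by rewrite mcoeffB pf -?eq_km // mfps_truncP -?eq_km // subrr mul0r.
by rewrite (dhomog_nemf_coeff (linear_forms_homog A k)) ?mulr0.
Qed.

Lemma mfps_substB A : zmod_morphism (mfps_subst A).
Proof.
move=> f g; apply: funext => m.
rewrite /mfps_subst -[RHS]sumrB.
by apply: eq_bigr => k _; rewrite -mulrBl.
Qed.

Lemma mfps_substM A : monoid_morphism (mfps_subst A).
Proof.
split=> [|f g]; apply: mfps_approx_inj => N.
  exists 1; last by move=> m lt_mN; rewrite -mpolyC1 (mfps_approxC _ lt_mN).
  rewrite -(comp_mpoly1 (linear_forms A)).
  by apply: mfps_approx_subst => m lt_mN; rewrite -mpolyC1 (mfps_approxC _ lt_mN).
have [af ag] := (@mfps_truncP _ _ N f, @mfps_truncP _ _ N g).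
exists ((mfps_trunc N f * mfps_trunc N g) \mPo linear_forms A).
  by apply: mfps_approx_subst; apply: mfps_approxM.
by rewrite rmorphM; apply: mfps_approxM; apply: mfps_approx_subst.
Qed.

HB.instance Definition _ A :=
  GRing.isZmodMorphism.Build S S (mfps_subst A) (mfps_substB A).
HB.instance Definition _ A :=
  GRing.isMonoidMorphism.Build S S (mfps_subst A) (mfps_substM A).

Lemma mfps_subst1 f : mfps_subst 1%:M f = f.
Proof.
apply: mfps_approx_inj => N; exists (mfps_trunc N f); last exact: mfps_truncP.
rewrite -[mfps_trunc N f]comp_mpoly_id.
suff <- : linear_forms 1%:M = [tuple 'X_i | i < n].
  by apply: mfps_approx_subst; apply: mfps_truncP.
apply: eq_from_tnth => j; rewrite !tnth_mktuple (bigD1 j) //= mxE eqxx scale1r.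
by rewrite big1 ?addr0 // => i /negPf ne_ij; rewrite mxE ne_ij scale0r.
Qed.

Lemma mfps_subst_comp A B f :
  mfps_subst (A *m B) f = mfps_subst A (mfps_subst B f).
Proof.
apply: mfps_approx_inj => N; have af := @mfps_truncP _ _ N f.
exists ((mfps_trunc N f \mPo linear_forms B) \mPo linear_forms A); last first.
  by do 2!apply: mfps_approx_subst.
suff -> p : (p \mPo linear_forms B) \mPo linear_forms A
          = p \mPo linear_forms (A *m B) by apply: mfps_approx_subst.
rewrite [p in LHS]mpolyE [p in RHS]mpolyE.
rewrite (raddf_sum (comp_mpoly (linear_forms B))) !(raddf_sum (comp_mpoly _)) /=.
apply: eq_bigr => k _; rewrite !comp_mpolyZ; congr (_ *: _).
rewrite !comp_mpolyX rmorph_prod /=; apply: eq_bigr => j _.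
rewrite rmorphXn /= !tnth_mktuple (raddf_sum (comp_mpoly _)) /=; congr (_ ^+ _).
under eq_bigr => i _ do
  rewrite comp_mpolyZ comp_mpolyXU -tnth_nth tnth_mktuple scaler_sumr.
rewrite exchange_big /=; apply: eq_bigr => i _.
rewrite mxE scaler_suml; apply: eq_bigr => l _.
by rewrite scalerA mulrC.
Qed.

End LinearSubstitution.

(* The two-sided ideal generated by x and the corresponding quotient; the latter
   may be the zero ring. *)
Section TwoSidedQuotient.
Context {A : pzRingType} (x : A).

Definition two_sided_ideal : {pred A} := fun y =>
  `[< exists s : seq (A * A), y = \sum_(p <- s) p.1 * x * p.2 >].

Lemma two_sided_ideal_zmod : zmod_closed two_sided_ideal.
Proof.
split=> [|_ _ /asboolP[s ->] /asboolP[t ->]]; apply/asboolP.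
  by exists [::]; rewrite big_nil.
exists (s ++ [seq (- p.1, p.2) | p <- t]); rewrite big_cat big_map /=.
by congr (_ + _); rewrite -sumrN; apply: eq_bigr => p _; rewrite !mulNr.
Qed.

HB.instance Definition _ :=
  GRing.isZmodClosed.Build A two_sided_ideal two_sided_ideal_zmod.

Lemma two_sided_idealMl a y :
  y \in two_sided_ideal -> a * y \in two_sided_ideal.
Proof.
move=> /asboolP[s ->]; apply/asboolP; exists [seq (a * p.1, p.2) | p <- s].
by rewrite big_map mulr_sumr; apply: eq_bigr => p _; rewrite !mulrA.
Qed.

Lemma two_sided_idealMr a y :
  y \in two_sided_ideal -> y * a \in two_sided_ideal.
Proof.
move=> /asboolP[s ->]; apply/asboolP; exists [seq (p.1, p.2 * a) | p <- s].
by rewrite big_map mulr_suml; apply: eq_bigr => p _; rewrite !mulrA.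
Qed.

Local Open Scope quotient_scope.

Definition quot_by : Type := Quotient.quot two_sided_ideal.
Local Notation Q := quot_by.
HB.instance Definition _ := GRing.Zmodule.on Q.
HB.instance Definition _ := Quotient.on Q.
HB.instance Definition _ := EqQuotient.on Q.

Definition quot_one : Q := \pi_Q 1.
Definition quot_mul := lift_op2 Q *%R.

Lemma quot_piD : {morph \pi_Q : a b / a + b}.
Proof. by move=> a b; rewrite [LHS]Quotient.pi_add. Qed.

Lemma quot_piM : {morph \pi_Q : a b / a * b >-> quot_mul a b}.
Proof.
have piE a b : (\pi_Q a == \pi_Q b) = (a - b \in two_sided_ideal).
  by rewrite piE.
move=> a b; unlock quot_mul; apply/eqP; rewrite piE.
set a' := repr _; set b' := repr _.
have aa' : a - a' \in two_sided_ideal by rewrite -piE reprK.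
have bb' : b - b' \in two_sided_ideal by rewrite -piE reprK.
have -> : a * b - a' * b' = (a - a') * b + a' * (b - b').
  by rewrite mulrBl mulrBr addrA subrK.
by apply: rpredD; [apply: two_sided_idealMr | apply: two_sided_idealMl].
Qed.

Lemma quot_mulA : associative quot_mul.
Proof.
by elim/quotW=> a; elim/quotW=> b; elim/quotW=> c; rewrite -!quot_piM mulrA.
Qed.
Lemma quot_mul1r : left_id quot_one quot_mul.
Proof. by elim/quotW=> a; rewrite -quot_piM mul1r. Qed.
Lemma quot_mulr1 : right_id quot_one quot_mul.
Proof. by elim/quotW=> a; rewrite -quot_piM mulr1. Qed.
Lemma quot_mulDl : left_distributive quot_mul +%R.
Proof.
elim/quotW=> a; elim/quotW=> b; elim/quotW=> c.
by rewrite -quot_piD -!quot_piM mulrDl quot_piD.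
Qed.
Lemma quot_mulDr : right_distributive quot_mul +%R.
Proof.
elim/quotW=> a; elim/quotW=> b; elim/quotW=> c.
by rewrite -quot_piD -!quot_piM mulrDr quot_piD.
Qed.

HB.instance Definition _ := GRing.Zmodule_isPzRing.Build Q
  quot_mulA quot_mul1r quot_mulr1 quot_mulDl quot_mulDr.

End TwoSidedQuotient.

Record finGLsubgroup (n : nat) (F : fieldType) := FinGLsubgroup {
  gl_elements :> {fset 'M[F]_n};
  gl_unitmx : forall g, g \in gl_elements -> g \in unitmx;
  gl_one_closed : 1%:M \in gl_elements;
  gl_mul_closed : forall g h,
    g \in gl_elements -> h \in gl_elements -> g *m h \in gl_elements;
  gl_inv_closed : forall g, g \in gl_elements -> invmx g \in gl_elements
}.

(* The power series ring, to be viewed as a module over its subring of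
   G-invariants. *)
Definition mfps_module (n : nat) (F : fieldType) (G : finGLsubgroup n F) : Type :=
  mfps n F.

Section GroupAction.
Context {n : nat} {F : fieldType} (G : finGLsubgroup n F).
Local Notation S := (mfps n F).

(* The elements of G have finite order, so g is a pseudo-reflection exactly when
   its fixed space has codimension 1. *)
Definition no_pseudo_reflection : Prop :=
  forall g, g \in gl_elements G -> \rank (g - 1%:M) != 1%N.

Definition gl_one : G := FSetSub (gl_one_closed G).
Definition gl_mul (g h : G) : G := 
  FSetSub (gl_mul_closed (fsvalP g) (fsvalP h)).

Lemma gl_mulA : associative gl_mul.
Proof. by move=> g h k; apply: val_inj; apply: mulmxA. Qed.
Lemma gl_mul1g : left_id gl_one gl_mul.
Proof. by move=> g; apply: val_inj; apply: mul1mx. Qed.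
Lemma gl_mulg1 : right_id gl_one gl_mul.
Proof. by move=> g; apply: val_inj; apply: mulmx1. Qed.

Definition gl_act (g : G) : S -> S := mfps_subst (val g).
HB.instance Definition _ g := GRing.RMorphism.on (gl_act g).

Lemma gl_act1 s : gl_act gl_one s = s.
Proof. exact: mfps_subst1. Qed.
Lemma gl_actM g h s : gl_act (gl_mul g h) s = gl_act g (gl_act h s).
Proof. exact: mfps_subst_comp. Qed.

Definition invariant : {pred S} := fun f => `[< forall g, gl_act g f = f >].

Lemma invariant_subring : subring_closed invariant.
Proof.
split=> [|f h /asboolP fP /asboolP hP|f h /asboolP fP /asboolP hP];
  apply/asboolP => g.
- exact: rmorph1.
- by rewrite rmorphB /= fP hP.
- by rewrite rmorphM /= fP hP.
Qed.

HB.instance Definition _ :=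
  GRing.isSubringClosed.Build S invariant invariant_subring.

Record invariant_ring :=
  InvariantRing { invariant_val : S; _ : invariant_val \in invariant }.
HB.instance Definition _ := [isSub for invariant_val].
HB.instance Definition _ := [Choice of invariant_ring by <:].
HB.instance Definition _ := [SubChoice_isSubComNzRing of invariant_ring by <:].

Local Notation SR := (mfps_module G).
HB.instance Definition _ := GRing.Zmodule.on SR.

Definition inv_scale (r : invariant_ring) (s : SR) : SR :=
  invariant_val r * s :> S.

Lemma inv_scaleA a b v : inv_scale a (inv_scale b v) = inv_scale (a * b) v.
Proof. exact: mulrA. Qed.
Lemma inv_scale1 : left_id 1 inv_scale.
Proof. exact: mul1r. Qed.
Lemma inv_scaleDr : right_distributive inv_scale +%R.
Proof. by move=> a u v; apply: mulrDr. Qed.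
Lemma inv_scaleDl v : {morph inv_scale^~ v : a b / a + b}.
Proof. by move=> a b; apply: mulrDl. Qed.

HB.instance Definition _ := GRing.Zmodule_isLmodule.Build invariant_ring
  SR inv_scaleA inv_scale1 inv_scaleDr inv_scaleDl.

(* a : skew_group_algebra stands for the formal sum \sum_g (a g) g. *)
Definition skew_group_algebra : Type := {ffun G -> S}.
Local Notation SG := skew_group_algebra.
HB.instance Definition _ := GRing.Zmodule.on SG.

Definition skew_term (s : S) (g : G) : SG := [ffun h => s *+ (h == g)].
Definition skew_mul (a b : SG) : SG := [ffun k =>
  \sum_(gh : G * G | gl_mul gh.1 gh.2 == k) a gh.1 * gl_act gh.1 (b gh.2)].

Lemma skew_mulDl : left_distributive skew_mul +%R.
Proof.
move=> a b c; apply/ffunP => k; rewrite !ffunE -big_split /=.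
by apply: eq_bigr => gh _; rewrite ffunE mulrDl.
Qed.

Lemma skew_mulDr : right_distributive skew_mul +%R.
Proof.
move=> a b c; apply/ffunP => k; rewrite !ffunE -big_split /=.
by apply: eq_bigr => gh _; rewrite ffunE raddfD mulrDr.
Qed.

Lemma skew_mul1r : left_id (skew_term 1 gl_one) skew_mul.
Proof.
move=> a; apply/ffunP => k; rewrite ffunE (bigD1 (gl_one, k)) /=; last first.
  by rewrite gl_mul1g.
rewrite ffunE eqxx mul1r gl_act1 big1 ?addr0 // => -[g h] /= /andP[/eqP <-].
rewrite ffunE; have [->|] := eqVneq g gl_one; last by rewrite mul0r.
by rewrite gl_mul1g eqxx.
Qed.

Lemma skew_mulr1 : right_id (skew_term 1 gl_one) skew_mul.
Proof.
move=> a; apply/ffunP => k; rewrite ffunE (bigD1 (k, gl_one)) /=; last first.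
  by rewrite gl_mulg1.
rewrite ffunE eqxx rmorph1 mulr1 big1 ?addr0 // => -[g h] /= /andP[/eqP <-].
rewrite ffunE; have [->|] := eqVneq h gl_one; last by rewrite raddf0 mulr0.
by rewrite gl_mulg1 eqxx.
Qed.

Lemma skew_mulA : associative skew_mul.
Proof.
move=> a b c; apply/ffunP => k; rewrite !ffunE.
pose X g p q := a g * gl_act g (b p) * gl_act (gl_mul g p) (c q).
transitivity (\sum_g \sum_p \sum_(q | gl_mul g (gl_mul p q) == k) X g p q).
  rewrite -(pair_big_dep xpredT (fun g h => gl_mul g h == k)
    (fun g h => a g * gl_act g (skew_mul b c h))) /=.
  apply: eq_bigr => g _.
  rewrite pair_big_dep /=.
  rewrite (partition_big (fun pq : G * G => gl_mul pq.1 pq.2)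
             (fun h => gl_mul g h == k)) //=.
  apply: eq_bigr => h /eqP gh; rewrite ffunE raddf_sum mulr_sumr /=.
  apply: eq_big => [pq|pq _].
    by case: eqP => [->|]; rewrite ?gh ?eqxx ?andbF.
  by rewrite /X rmorphM gl_actM mulrA.
symmetry.
rewrite -(pair_big_dep xpredT (fun h q => gl_mul h q == k)
  (fun h q => skew_mul a b h * gl_act h (c q))) /=.
rewrite pair_bigA /= (partition_big (fun gp : G * G => gl_mul gp.1 gp.2) xpredT) //=.
apply: eq_bigr => h _.
under eq_bigr => q _ do rewrite ffunE mulr_suml.
rewrite exchange_big /=; apply: eq_bigr => gp /eqP <-.
by apply: eq_big => [q|q _]; rewrite ?gl_mulA.
Qed.

HB.instance Definition _ := GRing.Zmodule_isPzRing.Build SG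
  skew_mulA skew_mul1r skew_mulr1 skew_mulDl skew_mulDr.

Definition skew_idempotent : SG :=
  \sum_g skew_term (mfps_const (#|` G|%:R^-1)) g.

End GroupAction.

(* The localization of A at a prime ideal P: classes of fractions x.1 / x.2. *)
Section Localization.
Context {A : comNzRingType} (P : prime_idealr A).
Local Open Scope quotient_scope.

Definition loc_fraction : Type := A * {s : A | s \notin (P : pred A)}.
HB.instance Definition _ := Choice.on loc_fraction.
Implicit Types x y z : loc_fraction.
Local Notation num x := (x.1 : A).
Local Notation den x := (sval x.2 : A).

Lemma loc_denM (s t : {s : A | s \notin (P : pred A)}) :
  sval s * sval t \notin (P : pred A).
Proof. by rewrite prime_idealrM negb_or (valP s) (valP t). Qed.

Lemma loc_den1 : 1 \notin (P : pred A).
Proof. by rewrite idealr1. Qed.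

Definition loc_frac (a s : A) (hs : s \notin (P : pred A)) : loc_fraction :=
  (a, exist _ s hs).

Definition loc_equiv x y :=
  `[< exists2 u, u \notin (P : pred A) &
        u * (num x * den y) = u * (num y * den x) >].

Lemma loc_equiv_refl : reflexive loc_equiv.
Proof. by move=> x; apply/asboolP; exists 1; rewrite ?loc_den1. Qed.

Lemma loc_equiv_sym : ssrbool.symmetric loc_equiv.
Proof.
by move=> x y; apply/asboolP/asboolP => -[u uP ux]; exists u.
Qed.

Lemma loc_equiv_trans : transitive loc_equiv.
Proof.
move=> y x z /asboolP[u uP ux] /asboolP[v vP vy]; apply/asboolP.
exists (u * v * den y).
  by rewrite !prime_idealrM !negb_or uP vP (valP y.2).
transitivity (v * den z * (u * (num x * den y))); first by ring.
transitivity (u * den x * (v * (num y * den z))); first by rewrite ux; ring.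
by rewrite vy; ring.
Qed.

Canonical loc_equiv_equiv :=
  EquivRel loc_equiv loc_equiv_refl loc_equiv_sym loc_equiv_trans.

Definition localization : Type := {eq_quot loc_equiv}.
Local Notation L := localization.
HB.instance Definition _ : EqQuotient _ loc_equiv L := EqQuotient.on L.
HB.instance Definition _ := Choice.on L.

Lemma loc_piP x y : loc_equiv x y -> \pi_L x = \pi_L y.
Proof. by move=> xy; apply/eqmodP. Qed.

Lemma loc_reprP x : loc_equiv (repr (\pi_L x)) x.
Proof. by have /eqmodP := reprK (\pi_L x). Qed.

Definition loc_add_frac x y : loc_fraction :=
  loc_frac (num x * den y + num y * den x) (loc_denM x.2 y.2).
Definition loc_opp_frac x : loc_fraction := (- num x, x.2).
Definition loc_mul_frac x y : loc_fraction :=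
  loc_frac (num x * num y) (loc_denM x.2 y.2).

Definition loc_zero : L := \pi_L (loc_frac 0 loc_den1).
Definition loc_one : L := \pi_L (loc_frac 1 loc_den1).
Definition loc_add := lift_op2 L loc_add_frac.
Definition loc_opp := lift_op1 L loc_opp_frac.
Definition loc_mul := lift_op2 L loc_mul_frac.

Lemma loc_piD : {morph \pi_L : x y / loc_add_frac x y >-> loc_add x y}.
Proof.
move=> x y; unlock loc_add; apply/loc_piP.
have /asboolP[u uP ux] := loc_reprP x; have /asboolP[v vP vy] := loc_reprP y.
move: (repr (\pi_L x)) (repr (\pi_L y)) ux vy => x' y' ux vy.
apply/asboolP; exists (u * v); first by rewrite prime_idealrM negb_or uP vP.
rewrite /= !mulrDl !mulrDr; congr (_ + _).
  transitivity (v * den y * den y' * (u * (num x * den x'))); first by ring.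
  by rewrite -ux; ring.
transitivity (u * den x * den x' * (v * (num y * den y'))); first by ring.
by rewrite -vy; ring.
Qed.

Lemma loc_piN : {morph \pi_L : x / loc_opp_frac x >-> loc_opp x}.
Proof.
move=> x; unlock loc_opp; apply/loc_piP.
have /asboolP[u uP ux] := loc_reprP x; move: (repr _) ux => x' ux.
by apply/asboolP; exists u => //=; rewrite !mulNr !mulrN ux.
Qed.

Lemma loc_piM : {morph \pi_L : x y / loc_mul_frac x y >-> loc_mul x y}.
Proof.
move=> x y; unlock loc_mul; apply/loc_piP.
have /asboolP[u uP ux] := loc_reprP x; have /asboolP[v vP vy] := loc_reprP y.
move: (repr (\pi_L x)) (repr (\pi_L y)) ux vy => x' y' ux vy.
apply/asboolP; exists (u * v); first by rewrite prime_idealrM negb_or uP vP.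
rewrite /=.
transitivity ((u * (num x * den x')) * (v * (num y * den y'))); first by ring.
by rewrite -ux -vy; ring.
Qed.

Lemma loc_eqP x y : num x * den y = num y * den x -> \pi_L x = \pi_L y.
Proof.
move=> xy; apply/loc_piP/asboolP; exists 1; first exact: loc_den1.
by rewrite xy.
Qed.

Lemma loc_addA : associative loc_add.
Proof.
elim/quotW=> x; elim/quotW=> y; elim/quotW=> z; rewrite -!loc_piD.
by apply: loc_eqP => /=; ring.
Qed.
Lemma loc_addC : commutative loc_add.
Proof.
by elim/quotW=> x; elim/quotW=> y; rewrite -!loc_piD; apply: loc_eqP => /=; ring.
Qed.
Lemma loc_add0 : left_id loc_zero loc_add.
Proof. by elim/quotW=> x; rewrite -loc_piD; apply: loc_eqP => /=; ring. Qed.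
Lemma loc_addN : left_inverse loc_zero loc_opp loc_add.
Proof.
elim/quotW=> x; rewrite -loc_piN -loc_piD.
by apply: loc_eqP => /=; ring.
Qed.

HB.instance Definition _ :=
  GRing.isZmodule.Build L loc_addA loc_addC loc_add0 loc_addN.

Lemma loc_mulA : associative loc_mul.
Proof.
elim/quotW=> x; elim/quotW=> y; elim/quotW=> z; rewrite -!loc_piM.
by apply: loc_eqP => /=; ring.
Qed.
Lemma loc_mulC : commutative loc_mul.
Proof.
by elim/quotW=> x; elim/quotW=> y; rewrite -!loc_piM; apply: loc_eqP => /=; ring.
Qed.
Lemma loc_mul1 : left_id loc_one loc_mul.
Proof. by elim/quotW=> x; rewrite -loc_piM; apply: loc_eqP => /=; ring. Qed.
Lemma loc_mulDl : left_distributive loc_mul loc_add.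
Proof.
elim/quotW=> x; elim/quotW=> y; elim/quotW=> z.
rewrite -loc_piD -!loc_piM -loc_piD.
by apply: loc_eqP => /=; ring.
Qed.
Lemma loc_1neq0 : loc_one != loc_zero.
Proof.
apply/negP => /eqP/eqmodP/asboolP[u uP] /=.
by rewrite !mulr1 mulr0 => u0; move: uP; rewrite u0 idealr0.
Qed.

HB.instance Definition _ := GRing.Zmodule_isComNzRing.Build L
  loc_mulA loc_mulC loc_mul1 loc_mulDl loc_1neq0.

End Localization.

Section LocalAlgebra.
Context (A : comNzRingType).

Definition nonunit (a : A) : Prop := forall b, a * b != 1.

(* When the nonunits are closed under addition, they form the unique maximal
   ideal of A. *)
Definition local_ring : Prop :=
  forall a b, nonunit a -> nonunit b -> nonunit (a + b).

Definition ideal_span (s : seq A) (a : A) : Prop :=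
  exists c : A ^ size s, a = \sum_(i < size s) c i * s`_i.

Definition noetherian : Prop := forall I : idealr A,
  exists s : seq A, forall a, a \in (I : pred A) <-> ideal_span s a.

Definition prime_chain (d : nat) (P : 'I_d.+1 -> prime_idealr A) : Prop :=
  forall i j : 'I_d.+1, (i < j)%N ->
    {subset (P i : pred A) <= (P j : pred A)} /\
    exists2 a, a \in (P j : pred A) & a \notin (P i : pred A).

Definition krull_dim (d : nat) : Prop :=
  (exists P : 'I_d.+1 -> prime_idealr A, prime_chain P) /\
  (forall k (P : 'I_k.+1 -> prime_idealr A), prime_chain P -> (k <= d)%N).

Definition regular_local_ring : Prop :=
  [/\ noetherian, local_ring &
      exists d (s : seq A), [/\ krull_dim d, size s = d &
        forall a, nonunit a <-> ideal_span s a]].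

End LocalAlgebra.

(* A is meant to be local: every prime ideal other than the maximal ideal
   nonunit is required to give a regular localization. *)
Definition isolated_singularity (A : comNzRingType) : Prop :=
  forall P : prime_idealr A,
    ~ (forall a, a \in (P : pred A) <-> nonunit a) ->
    regular_local_ring (localization P).

Section Modules.
Context {A : pzRingType} (M : lmodType A).

Definition finitely_generated : Prop :=
  exists n (p : {linear 'rV[A]_n -> M}), forall x, exists v, p v = x.

Definition finitely_presented : Prop :=
  exists n m (p : {linear 'rV[A]_n -> M}) (q : {linear 'rV[A]_m -> 'rV[A]_n}),
    (forall x, exists v, p v = x) /\
    (forall v, p v = 0 <-> exists w, q w = v).

End Modules.

Section CohenMacaulay.
Context {A : comNzRingType} (M : lmodType A).

Definition span_mul (s : seq A) (x : M) : Prop :=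
  exists y : M ^ size s, x = \sum_(i < size s) s`_i *: y i.

(* A is meant to be local: the terms lie in its maximal ideal nonunit. *)
Definition regular_sequence (s : seq A) : Prop :=
  [/\ forall a, a \in s -> nonunit a,
      forall i x, (i < size s)%N ->
        span_mul (take i s) (s`_i *: x) -> span_mul (take i s) x &
      exists x, ~ span_mul s x].

Definition depth (d : nat) : Prop :=
  (exists2 s : seq A, size s = d & regular_sequence s) /\
  (forall s : seq A, regular_sequence s -> (size s <= d)%N).

(* The zero module, whose depth is infinite, is included by convention. *)
Definition maximal_CM : Prop :=
  finitely_generated M /\
  ((forall x : M, x = 0) \/ exists2 d, krull_dim A d & depth d).

End CohenMacaulay.

Section Additive.
Context {A : pzRingType}.
Implicit Types (M N P X : lmodType A).

Definition direct_summand P M : Prop :=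
  exists (Q : lmodType A) (f : {linear (P * Q)%type -> M}), bijective f.

Definition is_direct_sum X (I : finType) (P : I -> lmodType A) : Prop :=
  exists (inj : forall i, {linear P i -> X}) (proj : forall i, {linear X -> P i}),
    [/\ forall i x, proj i (inj i x) = x,
        forall i j x, i != j -> proj j (inj i x) = 0 &
        forall x, x = \sum_i inj i (proj i x)].

Definition add_closure M X : Prop :=
  exists (I : finType) (P : I -> lmodType A),
    (forall i, direct_summand (P i) M) /\ is_direct_sum X P.

Lemma add_closure0 M : add_closure M 'rV[A]_0.
Proof.
exists void, (fun=> M); split=> [[]|].
by exists (fun i : void => match i with end), (fun i : void => match i with end);
  split=> [[]|[]|x] //; rewrite big1 ?[x]flatmx0 ?thinmx0 // => -[].
Qed.

Lemma add_closureD M X Y :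
  add_closure M X -> add_closure M Y -> add_closure M (X * Y)%type.
Proof.
move=> [I [P [PM [iP [pP [P1 P0 PE]]]]]] [J [Q [QM [iQ [pQ [Q1 Q0 QE]]]]]].
pose PQ (k : I + J) : lmodType A :=
  match k with inl i => P i | inr j => Q j end.
have lin1 : linear (fun x : X => (x, 0) : X * Y).
  by move=> a x y; congr pair; rewrite /= scaler0 addr0.
have lin2 : linear (fun y : Y => (0, y) : X * Y).
  by move=> a x y; congr pair; rewrite /= scaler0 addr0.
pose in1 : {linear X -> (X * Y)%type} :=
  HB.pack (fun x : X => (x, 0) : X * Y) (GRing.isLinear.Build _ _ _ _ _ lin1).
pose in2 : {linear Y -> (X * Y)%type} :=
  HB.pack (fun y : Y => (0, y) : X * Y) (GRing.isLinear.Build _ _ _ _ _ lin2).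
pose inj (k : I + J) : {linear PQ k -> (X * Y)%type} :=
  match k with inl i => in1 \o iP i | inr j => in2 \o iQ j end.
pose proj (k : I + J) : {linear (X * Y)%type -> PQ k} :=
  match k with inl i => pP i \o fst | inr j => pQ j \o snd end.
exists (I + J)%type, PQ; split; first by case.
exists inj, proj; split.
- by move=> [i|j] x /=; rewrite ?P1 ?Q1.
- move=> [i|j] [i'|j'] x /= ne; rewrite ?linear0 //; first exact: P0.
  exact: Q0.
move=> [x y]; rewrite big_sumType /= [RHS]surjective_pairing /=.
rewrite !(raddf_sum fst) !(raddf_sum snd) /=; congr pair.
  by rewrite [X in _ + X]big1 // addr0; apply: PE.
by rewrite [X in X + _]big1 // add0r; apply: QE.
Qed.

Definition factors_through_add M N P (f : N -> P) : Prop :=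
  exists2 X : lmodType A, add_closure M X &
  exists (a : {linear N -> X}) (b : {linear X -> P}), f =1 b \o a.

End Additive.

Record category := Category {
  ob :> Type;
  hom : ob -> ob -> Type;
  cat_id : forall X, hom X X;
  cat_comp : forall X Y Z, hom Y Z -> hom X Y -> hom X Z;
  cat_compfid : forall X Y (f : hom X Y), cat_comp f (cat_id X) = f;
  cat_compidf : forall X Y (f : hom X Y), cat_comp (cat_id Y) f = f;
  cat_compA : forall X Y Z W (f : hom Z W) (g : hom Y Z) (h : hom X Y),
    cat_comp f (cat_comp g h) = cat_comp (cat_comp f g) h
}.
Arguments cat_id {c} X.
Arguments cat_comp {c X Y Z}.

Record functor (C D : category) := Functor {
  fobj :> C -> D;
  fmap : forall X Y, hom X Y -> hom (fobj X) (fobj Y);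
  fmap_id : forall X, fmap (cat_id X) = cat_id (fobj X);
  fmap_comp : forall X Y Z (f : hom Y Z) (g : hom X Y),
    fmap (cat_comp f g) = cat_comp (fmap f) (fmap g)
}.
Arguments fmap {C D} _ {X Y}.

Definition functor_id (C : category) : functor C C :=
  @Functor C C id (fun X Y f => f) (fun=> erefl) (fun X Y Z f g => erefl).

Lemma functor_comp_id C D E (G : functor D E) (F : functor C D) (X : C) :
  fmap G (fmap F (cat_id X)) = cat_id (G (F X)).
Proof. by rewrite !fmap_id. Qed.

Lemma functor_comp_comp C D E (G : functor D E) (F : functor C D) (X Y Z : C)
    (f : hom Y Z) (g : hom X Y) :
  fmap G (fmap F (cat_comp f g))
  = cat_comp (fmap G (fmap F f)) (fmap G (fmap F g)).
Proof. by rewrite !fmap_comp. Qed.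

Definition functor_comp C D E (G : functor D E) (F : functor C D) :
    functor C E :=
  @Functor C E (fun X => G (F X)) (fun X Y f => fmap G (fmap F f))
    (functor_comp_id G F) (fun X Y Z => @functor_comp_comp C D E G F X Y Z).

Definition is_iso (C : category) (X Y : C) (f : hom X Y) : Prop :=
  exists g : hom Y X, cat_comp g f = cat_id X /\ cat_comp f g = cat_id Y.

Definition naturally_isomorphic (C D : category) (F G : functor C D) : Prop :=
  exists2 t : forall X, hom (F X) (G X),
    forall X, is_iso (t X) &
    forall X Y (f : hom X Y),
      cat_comp (t Y) (fmap F f) = cat_comp (fmap G f) (t X).

Definition equivalent_categories (C D : category) : Prop :=
  exists (F : functor C D) (G : functor D C),
    naturally_isomorphic (functor_comp G F) (functor_id C) /\
    naturally_isomorphic (functor_comp F G) (functor_id D).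

Record congruence (C : category) := Congruence {
  cong_rel :> forall X Y : C, hom X Y -> hom X Y -> Prop;
  cong_refl : forall X Y (f : hom X Y), cong_rel f f;
  cong_sym : forall X Y (f g : hom X Y), cong_rel f g -> cong_rel g f;
  cong_trans : forall X Y (f g h : hom X Y),
    cong_rel f g -> cong_rel g h -> cong_rel f h;
  cong_comp : forall X Y Z (f f' : hom Y Z) (g g' : hom X Y),
    cong_rel f f' -> cong_rel g g' ->
    cong_rel (cat_comp f g) (cat_comp f' g')
}.

Section QuotientCategory.
Context (C : category) (E : congruence C).
Local Open Scope quotient_scope.

Section Hom.
Context (X Y : C).

Definition cong_relb (f g : {classic (hom X Y)}) : bool := `[< E X Y f g >].

Lemma cong_relb_refl : reflexive cong_relb.
Proof. by move=> f; apply/asboolP/cong_refl. Qed.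
Lemma cong_relb_sym : ssrbool.symmetric cong_relb.
Proof. by move=> f g; apply/asboolP/asboolP => /cong_sym. Qed.
Lemma cong_relb_trans : transitive cong_relb.
Proof.
by move=> g f h /asboolP fg /asboolP gh; apply/asboolP; apply: cong_trans gh.
Qed.

Canonical cong_equiv :=
  EquivRel cong_relb cong_relb_refl cong_relb_sym cong_relb_trans.

Definition quot_hom : Type := {eq_quot cong_relb}.
HB.instance Definition _ : EqQuotient _ cong_relb quot_hom :=
  EqQuotient.on quot_hom.

Definition quot_class (f : hom X Y) : quot_hom := \pi_quot_hom f.

Lemma quot_classP (f g : hom X Y) : quot_class f = quot_class g <-> E X Y f g.
Proof. by split=> [/eqmodP/asboolP|fg] //; apply/eqmodP/asboolP. Qed.

End Hom.

Definition quot_comp X Y Z (f : quot_hom Y Z) (g : quot_hom X Y) :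
  quot_hom X Z := quot_class (cat_comp (repr f : hom Y Z) (repr g : hom X Y)).

Lemma quot_reprP X Y (f : hom X Y) : E X Y (repr (quot_class f)) f.
Proof. by apply/quot_classP; apply: reprK. Qed.

Lemma quot_compE X Y Z (f : hom Y Z) (g : hom X Y) :
  quot_comp (quot_class f) (quot_class g) = quot_class (cat_comp f g).
Proof. by apply/quot_classP/cong_comp; apply: quot_reprP. Qed.

Lemma quot_ind X Y (P : quot_hom X Y -> Prop) :
  (forall f, P (quot_class f)) -> forall f, P f.
Proof. by move=> Pf f; rewrite -[f]reprK; apply: Pf. Qed.

Lemma quot_compfid X Y (f : quot_hom X Y) :
  quot_comp f (quot_class (cat_id X)) = f.
Proof. by elim/quot_ind: f => f; rewrite quot_compE cat_compfid. Qed.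

Lemma quot_compidf X Y (f : quot_hom X Y) :
  quot_comp (quot_class (cat_id Y)) f = f.
Proof. by elim/quot_ind: f => f; rewrite quot_compE cat_compidf. Qed.

Lemma quot_compA X Y Z W
    (f : quot_hom Z W) (g : quot_hom Y Z) (h : quot_hom X Y) :
  quot_comp f (quot_comp g h) = quot_comp (quot_comp f g) h.
Proof.
elim/quot_ind: f => f; elim/quot_ind: g => g; elim/quot_ind: h => h.
by rewrite !quot_compE cat_compA.
Qed.

Definition quotient_category : category :=
  Category quot_compfid quot_compidf quot_compA.

End QuotientCategory.

Section ModuleCategories.
Context {A : pzRingType}.

Lemma linear_eqP (M N : lmodType A) (f g : {linear M -> N}) : f =1 g -> f = g.
Proof.
case: f g => [f [[fD] [fZ]]] [g [[gD] [gZ]]] /= fg.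
have {}fg : f = g by apply: funext.
by subst g; rewrite (Prop_irrelevance fD gD) (Prop_irrelevance fZ gZ).
Qed.

Section FullSubcategory.
Context (P : lmodType A -> Prop).
Local Notation ob := {M : lmodType A | P M}.
Local Notation mor M N := {linear sval M -> sval N}.

Definition lin_comp (M N L : ob) (f : mor N L) (g : mor M N) : mor M L :=
  f \o g.

Lemma lin_compfid (M N : ob) (f : mor M N) : lin_comp f idfun = f.
Proof. exact: linear_eqP. Qed.
Lemma lin_compidf (M N : ob) (f : mor M N) : lin_comp idfun f = f.
Proof. exact: linear_eqP. Qed.
Lemma lin_compA (M N L K : ob) (f : mor L K) (g : mor N L) (h : mor M N) :
  lin_comp f (lin_comp g h) = lin_comp (lin_comp f g) h.
Proof. exact: linear_eqP. Qed.

Definition full_module_category : category :=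
  @Category ob (fun M N => mor M N) (fun M => idfun) lin_comp
    lin_compfid lin_compidf lin_compA.

Context (S : lmodType A).

(* Congruence modulo the subgroup [S](M, N) of Hom_A(M, N), formed by the
   morphisms factoring through a finite direct sum of direct summands of S. *)
Definition add_congruence_rel (M N : full_module_category) (f g : hom M N) :
  Prop := factors_through_add S (fun x : sval M => f x - g x).

Lemma add_cong_refl M N (f : hom M N) : add_congruence_rel f f.
Proof.
exists 'rV[A]_0; first exact: add_closure0.
by exists \0, \0 => x; rewrite subrr.
Qed.

Lemma add_cong_sym M N (f g : hom M N) :
  add_congruence_rel f g -> add_congruence_rel g f.
Proof.
move=> [X SX [a [b fgE]]]; exists X => //; exists a, (\- b) => x.
by rewrite /= -[RHS]/(- (b \o a) x) -fgE opprB.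
Qed.

Lemma add_cong_trans M N (f g h : hom M N) :
  add_congruence_rel f g -> add_congruence_rel g h -> add_congruence_rel f h.
Proof.
move=> [X SX [a [b fgE]]] [Y SY [c [d ghE]]].
exists (X * Y)%type; first exact: add_closureD.
have linac : linear (fun x => (a x, c x) : X * Y).
  by move=> k x y; congr pair; rewrite linearP.
pose ac : {linear sval M -> (X * Y)%type} :=
  HB.pack (fun x => (a x, c x) : X * Y) (GRing.isLinear.Build _ _ _ _ _ linac).
exists ac, ((b \o fst) \+ (d \o snd)) => x.
by rewrite /= -[b _]fgE -[d _]ghE addrA subrK.
Qed.

Lemma add_cong_comp M N L (f f' : hom N L) (g g' : hom M N) :
  add_congruence_rel f f' -> add_congruence_rel g g' ->
  add_congruence_rel (cat_comp f g) (cat_comp f' g').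
Proof.
move=> [X SX [a [b fE]]] [Y SY [c [d gE]]].
apply: (@add_cong_trans _ _ _ (cat_comp f g')).
  exists Y => //; exists c, (f \o d) => x.
  by rewrite /= -raddfB; congr (f _); apply: gE.
by exists X => //; exists (a \o g'), b => x; apply: fE.
Qed.

Definition add_congruence : congruence full_module_category :=
  Congruence add_cong_refl add_cong_sym add_cong_trans add_cong_comp.

End FullSubcategory.
End ModuleCategories.

Definition CM_quotient (A : comNzRingType) (S : lmodType A) : category :=
  quotient_category (add_congruence (@maximal_CM A) S).

(* Left modules; right A-modules are obtained from the converse ring A^c. *)
Definition mod_category (A : pzRingType) : category :=
  full_module_category (@finitely_presented A).

(* Main.v *)
(* A finite presentation N = coker(f : (S * G)^k -> (S * G)^l) of a right
   S * G-module is killed by (e) if and only if f is surjective on S^k, and then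
   M = ker(f : S^k -> S^l) is Cohen-Macaulay. By Auslander's theorem
   End_R(S) = S * G, a morphism of such presentations is an R-linear square. The
   square is determined by its restriction to M modulo [S], and every morphism
   M -> M' is such a restriction, because R is an isolated singularity:
   Ext^1_R(S, S) = 0, as it is killed by powers of a system of parameters and
   End_R(S) has depth three. Conversely, for a Cohen-Macaulay module M, the
   second syzygy of Hom_R(M, S) over S is free, which embeds M in some S^k with a
   cokernel E inside S^l that is cut out by a descent projection pi with image E;
   so M + E, which is M in CM(R)/[S], is the kernel of
   (x, v) |-> Psi x + v - pi v, a surjection S^(k+l) -> S^l. *)

From HB Require Import structures.
From mathcomp Require Import all_boot all_order all_algebra reals complex.
From mathcomp Require Import fingroup perm generic_quotient ring_quotient finmap boolp mpoly zify ring.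
Require Import Defs.

Set Implicit Arguments.
Unset Strict Implicit.
Unset Printing Implicit Defensive.

Import GRing.Theory.
Local Open Scope ring_scope.

(** * Commutative algebra of noetherian modules *)

Section Submodules.
Context {A : comNzRingType}.
Implicit Types (M N : lmodType A) (a r s t : A).

(** Surjectivity detects (e) because (S * G)e = S e is a copy of S: multiplying N = coker f by e on
    the right gives the cokernel of f on powers of S. The cokernel of M -> S^k need not be a power
    of S: the functionals on S^k that vanish on M form an S * G-module that is free over S, hence
    projective over S * G since #G is invertible, but perhaps not free. Averaging over G yields pi,
    whose image E is an R-summand of S^l; this is why E has to be added to M. Exactness and liftings
    are first obtained after multiplication by elements of R whose action on M, or on S, factors
    through a free module, and the partial answers are glued by Koszul complexes. Such elements
    abound because these modules are free at every nonmaximal prime, where R is regular of dimension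
    at most two; freeness is tested by Koszul homology, so projective dimension never appears. A
    square of matrices is determined by neither its restriction to kernels nor its map of cokernels,
    so morphisms are compared by a relation that is total and single-valued in both directions, and
    the two functors are read off from it. *)

Definition submod M (L : M -> Prop) : Prop :=
  L 0 /\ forall a x y, L x -> L y -> L (a *: x + y).

Definition span M (I : finType) (b : I -> M) (x : M) : Prop :=
  exists c : I -> A, x = \sum_i c i *: b i.

Definition fgsub M (L : M -> Prop) : Prop :=
  exists (I : finType) (b : I -> M), forall x, L x <-> span b x.

Definition noethmod M : Prop := forall L : M -> Prop, submod L -> fgsub L.

Lemma submodD M (L : M -> Prop) x y : submod L -> L x -> L y -> L (x + y).
Proof. by move=> [_ h] Lx Ly; rewrite -[x]scale1r; apply: h. Qed.

Lemma submodZ M (L : M -> Prop) a x : submod L -> L x -> L (a *: x).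
Proof. by move=> [L0 h] Lx; rewrite -[_ *: _]addr0; apply: h. Qed.

Lemma submodN M (L : M -> Prop) x : submod L -> L x -> L (- x).
Proof. by move=> hL Lx; rewrite -scaleN1r; apply: submodZ. Qed.

Lemma submodB M (L : M -> Prop) x y : submod L -> L x -> L y -> L (x - y).
Proof. by move=> hL Lx Ly; apply: submodD => //; apply: submodN. Qed.

Lemma submod_sum M (L : M -> Prop) (I : finType) (F : I -> M) :
  submod L -> (forall i, L (F i)) -> L (\sum_i F i).
Proof.
move=> hL hF; elim/big_rec: _ => [|i x _ Lx]; first by case: hL.
exact: submodD.
Qed.

Lemma span_gen M (I : finType) (b : I -> M) i : span b (b i).
Proof.
exists (fun j => (j == i)%:R); rewrite (bigD1 i) //= eqxx scale1r big1 ?addr0 //.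
by move=> j /negPf ->; rewrite scale0r.
Qed.

Lemma span_submod M (I : finType) (b : I -> M) : submod (span b).
Proof.
split=> [|a _ _ [c ->] [d ->]].
  by exists (fun=> 0); rewrite big1 // => i _; rewrite scale0r.
exists (fun i => a * c i + d i); rewrite scaler_sumr -big_split /=.
by apply: eq_bigr => i _; rewrite scalerA scalerDl.
Qed.

Lemma span_min M (I : finType) (b : I -> M) (L : M -> Prop) :
  submod L -> (forall i, L (b i)) -> forall x, span b x -> L x.
Proof.
by move=> hL hb _ [c ->]; apply: submod_sum => // i; apply: submodZ.
Qed.

Lemma spanP_fg M (L : M -> Prop) (I : finType) (b : I -> M) : submod L ->
  (forall i, L (b i)) -> (forall x, L x -> span b x) -> fgsub L.
Proof.
move=> hL hb h; exists I, b => x; split; [exact: h | exact: span_min].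
Qed.

End Submodules.

Arguments submod {A M}.
Arguments fgsub {A M}.
Arguments noethmod {A}.

Section Noetherian.
Context {A : comNzRingType}.
Implicit Types (M N : lmodType A) (a r s t : A) (I J P : A -> Prop).

Definition ideal I : Prop := I 0 /\ forall a x y, I x -> I y -> I (a * x + y).

Definition primeP P : Prop :=
  [/\ ideal P, ~ P 1 & forall x y, P (x * y) -> P x \/ P y].

Definition noeth : Prop := noethmod (A^o : lmodType A).

Lemma ideal_submod I : ideal I -> submod (I : (A^o : lmodType A) -> Prop).
Proof. by []. Qed.

Lemma idealD I x y : ideal I -> I x -> I y -> I (x + y).
Proof. exact: (@submodD _ (A^o : lmodType A)). Qed.
Lemma idealB I x y : ideal I -> I x -> I y -> I (x - y).
Proof. exact: (@submodB _ (A^o : lmodType A)). Qed.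
Lemma idealN I x : ideal I -> I x -> I (- x).
Proof. exact: (@submodN _ (A^o : lmodType A)). Qed.
Lemma idealMl I a x : ideal I -> I x -> I (a * x).
Proof. exact: (@submodZ _ (A^o : lmodType A)). Qed.
Lemma idealMr I a x : ideal I -> I x -> I (x * a).
Proof. by move=> hI Ix; rewrite mulrC; apply: idealMl. Qed.
Lemma ideal_sum I (T : finType) (F : T -> A) :
  ideal I -> (forall i, I (F i)) -> I (\sum_i F i).
Proof. exact: (@submod_sum _ (A^o : lmodType A)). Qed.

Lemma primeX P a k : primeP P -> P (a ^+ k) -> P a.
Proof.
move=> [_ P1 PM]; elim: k => [|k IHk]; first by rewrite expr0.
by rewrite exprS => /PM[].
Qed.

Lemma prime_prod P (T : finType) (F : T -> A) :
  primeP P -> (forall i, ~ P (F i)) -> ~ P (\prod_i F i).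
Proof.
move=> [_ P1 PM] hF; elim/big_rec: _ => // i x _ Px /PM[]//.
exact: hF.
Qed.

(** Otherwise choice extends [I0] to a strictly increasing sequence in F; its union is finitely
    generated, all generators lie in one term, and the sequence stops there. *)
Lemma noeth_max (F : (A -> Prop) -> Prop) I0 : noeth ->
  (forall I, F I -> ideal I) -> F I0 ->
  exists I, [/\ F I, (forall x, I0 x -> I x) &
    forall J, F J -> (forall x, I x -> J x) -> forall x, J x -> I x].
Proof.
move=> nA idF F0; apply: contrapT => nomax.
pose T := {I | F I /\ forall x, I0 x -> I x}.
have /choice[next nextP] : forall I : T, exists J : T,
    (forall x, sval I x -> sval J x) /\ exists x, sval J x /\ ~ sval I x.
  move=> [I [FI I0I]] /=; apply: contrapT => nJ; apply: nomax.
  exists I; split=> // J FJ IJ x Jx; apply: contrapT => nIx; apply: nJ.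
  have J0 : F J /\ forall x, I0 x -> J x by split=> // y /I0I/IJ.
  by exists (exist _ J J0); split=> //=; exists x.
pose I_ n := sval (iter n next (exist _ I0 (conj F0 (fun x => id)))).
have I_S n x : I_ n x -> I_ n.+1 x by apply: (nextP _).1.
have I_le n k x : I_ n x -> I_ (n + k)%N x.
  by elim: k => [|k IHk]; rewrite ?addn0 // addnS => /IHk/I_S.
have I_le' n k x : (n <= k)%N -> I_ n x -> I_ k x.
  by move=> /subnKC <-; apply: I_le.
have I_id n : ideal (I_ n).
  by rewrite /I_; case: (iter _ _ _) => J [/= FJ _]; apply: idF.
pose U x := exists n, I_ n x.
have U_id : ideal U.
  split=> [|a x y [n nx] [k ky]]; first by exists 0%N; case: (I_id 0%N).
  by exists (n + k)%N; apply: (I_id _).2; [|rewrite addnC]; apply: I_le.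
have [T' [b bP]] := nA _ (ideal_submod U_id).
have /choice[N NP] : forall i, exists n, I_ n (b i).
  by move=> i; apply/(bP (b i)).2/span_gen.
have [x [x1 x0]] := (nextP (iter (\max_i N i) next
  (exist _ I0 (conj F0 (fun x => id))))).2.
apply: x0; have : U x by exists (\max_i N i).+1.
move=> /bP; apply: (@span_min _ (A^o : lmodType A)) => // [|i].
  by apply: ideal_submod; apply: I_id.
by apply: I_le' (NP i); apply: leq_bigmax.
Qed.

(** Induction on the number of generators: the coefficients at the first generator of elements of L
    form an ideal, and subtracting lifts of its generators leaves the part of L in the span of the
    other generators. *)
Lemma noethmod_span M (I : finType) (b : I -> M) : noeth ->
  forall L, submod L -> (forall x, L x -> span b x) -> fgsub L.
Proof.
move=> nA L hL Lb.
suff ordP n (b' : 'I_n -> M) : forall L : M -> Prop, submod L ->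
    (forall x, L x -> span b' x) -> fgsub L.
  apply: (ordP #|I| (fun i => b (enum_val i))) => // x /Lb[c ->].
  exists (fun i => c (enum_val i)).
  by rewrite (reindex _ (onW_bij _ (enum_val_bij I))).
elim: n b' {L hL Lb} => [|n IHn] b0 L hL Lb.
  exists void, (fun v : void => match v with end) => x; split.
    move=> /Lb[c ->]; exists (fun v : void => match v with end).
    by rewrite big_ord0 big1 // => -[].
  by move=> [c ->]; rewrite big1 => [|[]]; case: hL.
pose i0 : 'I_n.+1 := ord0; pose b' (i : 'I_n) := b0 (lift i0 i).
have splitb (c : 'I_n.+1 -> A) :
    \sum_i c i *: b0 i = c i0 *: b0 i0 + \sum_i c (lift i0 i) *: b' i.
  by rewrite big_ord_recl.
pose L' x := L x /\ span b' x.
have hL' : submod L'.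
  have hb := span_submod b'.
  split=> [|a x y [Lx bx] [Ly by_]]; first by split; [case: hL|case: hb].
  by split; [apply: hL.2 | apply: hb.2].
have [J [d dP]] := IHn b' L' hL' (fun x h => h.2).
pose J0 a := exists2 x, span b' x & L (a *: b0 i0 + x).
have J0id : ideal J0.
  have hb := span_submod b'.
  split=> [|a x y [u bu Lu] [v bv Lv]].
    by exists 0; [case: hb | rewrite scale0r addr0; case: hL].
  exists (a *: u + v); first exact: hb.2.
  by rewrite scalerDl addrACA -scalerA -scalerDr; apply: hL.2.
have [K [e eP]] := nA _ (ideal_submod J0id).
have /choice[u uP] : forall k, exists u, span b' u /\ L (e k *: b0 i0 + u).
  by move=> k; have [x bx Lx] := (eP (e k)).2 (span_gen e k); exists x.
pose g (k : J + K) := match k with inl j => d j | inr k => e k *: b0 i0 + u k end.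
apply: (@spanP_fg _ _ _ _ g) => // [[j|k]|x Lx] /=.
- by have [] := (dP (d j)).2 (span_gen d j).
- by case: (uP k).
have [c xE] := Lb _ Lx; rewrite splitb in xE.
have : J0 (c i0) by exists (\sum_i c (lift i0 i) *: b' i); [exists (c \o lift i0)|rewrite -xE].
move=> /eP[f fE].
pose y := x - \sum_k f k *: (e k *: b0 i0 + u k).
have L'y : L' y.
  split; first by apply: submodB => //; apply: submod_sum => // k;
    apply: submodZ => //; case: (uP k).
  rewrite /y xE fE scaler_suml -[X in _ - X]/(\sum_k f k *: (_ + _)).
  have -> : \sum_k f k *: (e k *: b0 i0 + u k) =
    \sum_k (f k * e k) *: b0 i0 + \sum_k f k *: u k.
    by rewrite -big_split; apply: eq_bigr => k _; rewrite scalerDr scalerA.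
  rewrite opprD addrACA subrr add0r.
  have hb := span_submod b'.
  apply: submodB => //; first by exists (c \o lift i0).
  by apply: submod_sum => // k; apply: submodZ => //; case: (uP k).
move/dP: L'y => [h yE].
exists (fun k => match k with inl j => h j | inr k => f k end).
by rewrite big_sumType /= -yE subrK.
Qed.

Definition fgmod M : Prop := exists (I : finType) (b : I -> M), forall x, span b x.

Lemma fg_noeth M : noeth -> fgmod M -> noethmod M.
Proof.
by move=> nA [I [b bP]] L hL; apply: (noethmod_span (b := b)) => // x _.
Qed.

Lemma fgmod_ffun (T : finType) M : fgmod M -> fgmod {ffun T -> M}.
Proof.
move=> [I [b bP]].
exists (T * I)%type, (fun ti => [ffun t => b ti.2 *+ (t == ti.1)]) => x.
have /choice[c cP] : forall t : T, exists c : I -> A, x t = \sum_i c i *: b i.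
  by move=> t; apply: bP.
exists (fun ti => c ti.1 ti.2).
rewrite -(pair_bigA _ (fun (u : T) i => c u i *: [ffun v => b i *+ (v == u)])) /=.
apply/ffunP => u; rewrite sum_ffunE (bigD1 u) //= [X in _ + X]big1 ?addr0 => [|t' ne].
  rewrite sum_ffunE cP; apply: eq_bigr => i _.
  by rewrite !ffunE /= eqxx.
rewrite sum_ffunE big1 // => i _; rewrite !ffunE /=.
by rewrite eq_sym (negPf ne) scaler0.
Qed.

Lemma fgmod_self : fgmod (A^o : lmodType A).
Proof.
by exists unit, (fun=> 1) => x; exists (fun=> x); rewrite big_const card_unit /= addr0 [RHS]mulr1.
Qed.

(** An ideal maximal among those containing I and missing W is prime: if x and y lie outside, P +
    (x) and P + (y) both meet W, and so does their product, which lies in P + (xy). *)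
Lemma prime_avoid I (W : A -> Prop) : noeth -> ideal I -> W 1 ->
  (forall x y, W x -> W y -> W (x * y)) -> (forall x, I x -> ~ W x) ->
  exists P, [/\ primeP P, (forall x, I x -> P x) & forall x, P x -> ~ W x].
Proof.
move=> nA hI W1 WM IW.
pose F J := ideal J /\ forall x, J x -> ~ W x.
have [J []//|//|P [[hP PW] IP Pmax]] := @noeth_max F I nA.
exists P; split=> //; split=> // [/PW//|x y Pxy].
have ext z : ~ P z -> exists2 w, W w & exists2 p, P p & exists c, w = p + c * z.
  move=> nPz; apply: contrapT => nw; apply: nPz.
  pose J u := exists2 p, P p & exists c, u = p + c * z.
  apply: (Pmax J); last by exists 0; [case: hP|exists 1; rewrite add0r mul1r].
    split; first split.
    - by exists 0; [case: hP|exists 0; rewrite mul0r addr0].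
    - move=> a _ _ [p Pp [c ->]] [q Pq [d ->]].
      exists (a * p + q); first exact: hP.2.
      by exists (a * c + d); ring.
    - by move=> u Ju Wu; apply: nw; exists u.
  by move=> u Pu; exists u => //; exists 0; rewrite mul0r addr0.
apply: contrapT => /not_orP[/ext[w Ww [p Pp [c wE]]] /ext[v Wv [q Pq [d vE]]]].
apply: (PW (w * v)); last exact: WM.
rewrite wE vE mulrDl mulrDr.
have -> : p * q + p * (d * y) + c * x * (q + d * y)
  = (q + d * y) * p + (c * x) * q + (c * d) * (x * y) by ring.
by do 2?apply: idealD => //; apply: idealMl.
Qed.

(** A maximal annihilator among those of the nonzero multiples of u in M/L is prime; this produces
    associated primes of M/L. *)
Lemma prime_conductor M (L : M -> Prop) u : noeth -> submod L -> ~ L u ->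
  exists r, ~ L (r *: u) /\ primeP (fun s => L (s *: (r *: u))).
Proof.
move=> nA hL nLu.
pose cond v := fun s : A => L (s *: v).
have cond_id v : ideal (cond v).
  split=> [|a x y cx cy]; rewrite /cond; first by rewrite scale0r; case: hL.
  by rewrite scalerDl -scalerA; apply: hL.2.
pose F J := exists r, ~ L (r *: u) /\ J = cond (r *: u).
have [_ [r [_ ->]]//||P [[r [nr ->]] _ Pmax]] := @noeth_max F (cond u) nA.
  by exists 1; rewrite scale1r.
exists r; split=> //; split=> [||x y cxy]; [exact: cond_id | by rewrite scale1r |].
have [Lx|nLx] := EM (L (y *: (r *: u))); first by right.
left; apply: (Pmax (cond ((y * r) *: u))).
- by exists (y * r); rewrite -scalerA.
- by move=> s Ls; rewrite /cond -scalerA scalerA mulrC -scalerA; apply: submodZ.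
- by rewrite /cond -scalerA scalerA.
Qed.

(** Multiplication by the adjugate, as in the Cayley-Hamilton theorem. *)
Lemma det_trick M (L : M -> Prop) n (b : 'I_n -> M) (B : 'M[A]_n) : submod L ->
  (forall i, L (\sum_j B i j *: b j)) -> forall j, L (\det B *: b j).
Proof.
move=> hL hB j.
suff -> : \det B *: b j = \sum_i \adj B j i *: (\sum_k B i k *: b k).
  by apply: submod_sum => // i; apply: submodZ.
under eq_bigr => i _ do rewrite scaler_sumr.
rewrite exchange_big /=.
transitivity (\sum_k (\adj B *m B) j k *: b k).
  rewrite mul_adj_mx (bigD1 j) //= mxE eqxx big1 ?addr0 // => k ne.
  by rewrite mxE eq_sym (negPf ne) scale0r.
apply: eq_bigr => k _; rewrite mxE scaler_suml; apply: eq_bigr => i _.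
by rewrite scalerA.
Qed.

(** Modulo P the matrix is scalar and its determinant is a power of t. *)
Lemma det_notin_prime P n t (X : 'M[A]_n) : primeP P -> ~ P t ->
  (forall i j, P (X i j)) -> ~ P (\det (t%:M - X)).
Proof.
move=> hP nPt PX; have [idP P1 PM] := hP.
rewrite /determinant (bigD1 (1%g : 'S_n)) //= odd_perm1 expr0 mul1r => Pdet.
have : P (\prod_i (t%:M - X) i ((1%g : 'S_n) i)).
  rewrite -[X in P X](addrK (\sum_(s : 'S_n | s != 1%g)
     (-1) ^+ s * \prod_i (t%:M - X) i (s i))).
  apply: idealB => //; elim/big_rec: _ => [|s x ne Px]; first by case: idP.
  apply: idealD => //; apply: idealMl => //.
  have [i si] : exists i, s i != i.
    apply/existsP; rewrite -negb_forall; apply: contra ne => /forallP h.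
    by apply/eqP/permP => i; rewrite perm1; apply/eqP.
  rewrite (bigD1 i) //= !mxE eq_sym (negPf si) sub0r mulNr.
  by apply: idealN => //; apply: idealMr.
apply: prime_prod => // i; rewrite perm1 !mxE eqxx => Pi; apply: nPt.
by rewrite -[t](subrK (X i i)); apply: idealD.
Qed.

End Noetherian.

Arguments noeth : clear implicits.

(** * Koszul complexes and depth *)

(* The square-zero extension of A by M turns identities between elements of a
   module into identities of a commutative ring, which [ring] decides. *)
Section SquareZero.
Context {A : comNzRingType} (M : lmodType A).

Definition sqz : Type := (A * M)%type.
HB.instance Definition _ := GRing.Zmodule.on sqz.
Implicit Types x y z : sqz.

Definition sqz_mul x y : sqz := (x.1 * y.1, x.1 *: y.2 + y.1 *: x.2).

Lemma sqz_mulC : commutative sqz_mul.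
Proof. by move=> x y; congr pair; [apply: mulrC | apply: addrC]. Qed.
Lemma sqz_mulA : associative sqz_mul.
Proof.
move=> x y z; congr pair => /=; first exact: mulrA.
rewrite !scalerDr !scalerA addrA; congr (_ + _ *: _); last by rewrite mulrC.
by congr (_ + _ *: _); rewrite mulrC.
Qed.
Lemma sqz_mul1 : left_id ((1, 0) : sqz) sqz_mul.
Proof.
by case=> a u; rewrite /sqz_mul /= mul1r scale1r scaler0 addr0.
Qed.
Lemma sqz_mulDl : left_distributive sqz_mul +%R.
Proof.
move=> x y z; congr pair => /=; first exact: mulrDl.
by rewrite scalerDl scalerDr addrACA.
Qed.
Lemma sqz_1neq0 : ((1, 0) : sqz) != 0.
Proof. by apply/eqP => -[/eqP]; rewrite oner_eq0. Qed.

HB.instance Definition _ := GRing.Zmodule_isComNzRing.Build sqz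
  sqz_mulA sqz_mulC sqz_mul1 sqz_mulDl sqz_1neq0.

Definition sqzA (a : A) : sqz := (a, 0).
Definition sqzM (u : M) : sqz := (0, u).

Lemma sqzM_inj : injective sqzM. Proof. by move=> u v []. Qed.
Lemma sqzMZ a u : sqzM (a *: u) = sqzA a * sqzM u.
Proof. by congr pair; rewrite /= ?mulr0 ?scale0r ?addr0. Qed.
Lemma sqzMD u v : sqzM (u + v) = sqzM u + sqzM v.
Proof. by congr pair; rewrite /= addr0. Qed.
Lemma sqzMN u : sqzM (- u) = - sqzM u.
Proof. by congr pair; rewrite /= oppr0. Qed.
Lemma sqzM0 : sqzM 0 = 0. Proof. by []. Qed.
Lemma sqzAM a b : sqzA (a * b) = sqzA a * sqzA b.
Proof. by congr pair; rewrite /= !scaler0 addr0. Qed.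
Lemma sqzAD a b : sqzA (a + b) = sqzA a + sqzA b.
Proof. by congr pair; rewrite /= addr0. Qed.
Lemma sqzAN a : sqzA (- a) = - sqzA a.
Proof. by congr pair; rewrite /= oppr0. Qed.
Lemma sqzA0 : sqzA 0 = 0. Proof. by []. Qed.
Lemma sqzA1 : sqzA 1 = 1. Proof. by []. Qed.

End SquareZero.

Ltac mring := apply: sqzM_inj;
  rewrite ?(sqzMD, sqzMN, sqzMZ, sqzM0, sqzAM, sqzAD, sqzAN, sqzA0, sqzA1); ring.

(** Spends a hypothesis x = y: what remains is an unconditional identity, within reach of [ring] or
    [mring]. *)
Lemma eq_by_sub (V : zmodType) (u v x y : V) : x = y -> u - v = x - y -> u = v.
Proof. by move=> -> /eqP; rewrite subrr subr_eq0 => /eqP. Qed.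

Section Regular.
Context {A : comNzRingType}.
Implicit Types (M N : lmodType A) (a b c r s t x : A) (I J P Q : A -> Prop).

(** A weakly regular sequence of length three, spelled out by equations so that it also makes sense
    for units and on the zero module. *)
Definition reg3 M a b c : Prop :=
  [/\ forall u : M, a *: u = 0 -> u = 0,
      forall u v : M, b *: u = a *: v -> exists w, u = a *: w &
      forall u v w : M, c *: u = a *: v + b *: w ->
        exists v' w', u = a *: v' + b *: w'].

Lemma reg3_inj M a b c (u v : M) : reg3 M a b c -> a *: u = a *: v -> u = v.
Proof.
move=> [h _ _] uv; apply/eqP; rewrite -subr_eq0; apply/eqP/h.
by rewrite scalerBr uv subrr.
Qed.

(** Second Koszul cohomology vanishes. Typically the e's are cross differences b p_a - a p_b of
    partial solutions over a, b and c, and the f's are the corrections that make these solutions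
    compatible. *)
Lemma koszul_exact M a b c (eab eac ebc : M) : reg3 M a b c ->
  c *: eab + a *: ebc = b *: eac -> exists fa fb fc,
  [/\ eab = b *: fa - a *: fb, eac = c *: fa - a *: fc & ebc = c *: fb - b *: fc].
Proof.
move=> hr he; have [h1 h2 h3] := hr.
have [|v [w eabE]] := h3 eab (- ebc) eac.
  by apply: (eq_by_sub he); mring.
have [|fc fcE] := h2 (c *: w - eac) (- c *: v - ebc).
  by apply: (eq_by_sub he); rewrite eabE; mring.
exists w, (- v), fc; split.
- by rewrite eabE; mring.
- by rewrite -fcE; mring.
apply: (reg3_inj hr); have := congr1 ( *:%R b) fcE => bE.
apply: (eq_by_sub he); rewrite eabE.
by apply: (eq_by_sub (esym bE)); mring.
Qed.

(** Entries are multiplied one at a time; powers and norms of regular elements are reached in this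
    way. *)
Lemma reg3_mul1 M a a' b c : reg3 M a b c -> reg3 M a' b c -> reg3 M (a * a') b c.
Proof.
move=> hr hr'; have [h1 h2 h3] := hr; have [h1' h2' h3'] := hr'; split.
- by move=> u; rewrite -scalerA => /h1/h1'.
- move=> u v; rewrite -scalerA => uv; have [w uE] := h2 _ _ uv.
  have /h2'[w' wE] : b *: w = a' *: v.
    by apply: (reg3_inj hr); rewrite -uv uE; mring.
  by exists w'; rewrite uE wE scalerA.
move=> u v w uE.
have [|p [q pE]] := h3 u (a' *: v) w; first by rewrite uE; mring.
have [|t tE] := h2 (w - c *: q) (c *: p - a' *: v).
  by apply: (eq_by_sub (esym uE)); rewrite pE; mring.
have [|p' [q' p'E]] := h3' p v t.
  apply: (reg3_inj hr); apply: (eq_by_sub uE).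
  have -> : w = a *: t + c *: q by rewrite -tE subrK.
  by rewrite pE; mring.
by exists p', (a *: q' + q); rewrite pE p'E; mring.
Qed.

Lemma reg3_mul2 M a b b' c : reg3 M a b c -> reg3 M a b' c -> reg3 M a (b * b') c.
Proof.
move=> hr hr'; have [h1 h2 h3] := hr; have [h1' h2' h3'] := hr'; split=> //.
  move=> u v uE; have [|w wE] := h2 (b' *: u) v; first by rewrite -uE; mring.
  exact: h2' wE.
move=> u v w uE.
have [|p [q pE]] := h3 u v (b' *: w); first by rewrite uE; mring.
have [|t tE] := h2 (c *: q - b' *: w) (v - c *: p).
  by apply: (eq_by_sub uE); rewrite pE; mring.
have [|p' [q' p'E]] := h3' q t w; first by rewrite -tE; mring.
by exists (p + b *: p'), q'; rewrite pE p'E; mring.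
Qed.

Lemma reg3_mul3 M a b c c' : reg3 M a b c -> reg3 M a b c' -> reg3 M a b (c * c').
Proof.
move=> [h1 h2 h3] [h1' h2' h3']; split=> // u v w uE.
have [|p [q pE]] := h3 (c' *: u) v w; first by rewrite -uE; mring.
exact: h3' pE.
Qed.

Lemma reg3_unit1 M b c : reg3 M 1 b c.
Proof.
split=> [u|u v _|u v w _]; first by rewrite scale1r.
  by exists u; rewrite scale1r.
by exists u, 0; rewrite scale1r scaler0 addr0.
Qed.

Lemma reg3_expn M a b c i j k : reg3 M a b c -> reg3 M (a ^+ i) (b ^+ j) (c ^+ k).
Proof.
move=> hr.
have {}hr : reg3 M (a ^+ i) b c.
  elim: i => [|i IHi]; first exact: reg3_unit1.
  by rewrite exprS; apply: reg3_mul1.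
move: (a ^+ i) hr => {}a hr; have [h1 h2 h3] := hr.
have {}hr : reg3 M a (b ^+ j) c.
  elim: j => [|j IHj]; last by rewrite exprS; apply: reg3_mul2.
  split=> // [u v|u v w _]; first by rewrite expr0 scale1r => ->; exists v.
  by exists 0, u; rewrite expr0 scale1r scaler0 add0r.
elim: k {h1 h2 h3} => [|k IHk]; last by rewrite exprS; apply: reg3_mul3.
have [h1 h2 h3] := hr; split=> // u v w; rewrite expr0 scale1r => ->.
by exists v, w.
Qed.

Definition local_with (m : A -> Prop) : Prop :=
  primeP m /\ forall x, ~ m x -> exists y, x * y = 1.

Lemma fgsub_ord M (L : M -> Prop) : fgsub L ->
  exists n (b : 'I_n -> M), forall u, L u <-> span b u.
Proof.
move=> [I [b bP]]; exists #|I|, (fun i => b (enum_val i)) => x.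
split=> [/bP[c ->]|[c ->]]; last first.
  apply/bP; exists (fun i => c (enum_rank i)).
  rewrite (reindex _ (onW_bij _ (enum_val_bij I))) /=.
  by apply: eq_bigr => i _; rewrite enum_valK.
exists (fun i => c (enum_val i)).
by rewrite (reindex _ (onW_bij _ (enum_val_bij I))).
Qed.

(** The hypothesis gives a matrix X over m with (1 - X) b in L for the generators b of U; its
    determinant 1 - ... is a unit, and [det_trick] applies. *)
Lemma nakayama m M (L U : M -> Prop) a : local_with m -> m a -> submod L ->
  fgsub U -> (forall u, U u -> exists l v, [/\ L l, U v & u = l + a *: v]) ->
  forall u, U u -> L u.
Proof.
move=> [hm mU] ma hL /fgsub_ord[n [b bP]] hU.
have [mi _ _] := hm.
have /choice[l lP] : forall i, exists l : M * ('I_n -> A),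
    L l.1 /\ b i = l.1 + a *: \sum_j l.2 j *: b j.
  move=> i; have [l [v [Ll /bP[c ->] bE]]] := hU _ ((bP _).2 (span_gen b i)).
  by exists (l, c).
pose X := \matrix_(i, j) (a * (l i).2 j).
have : ~ m (\det (1%:M - X)).
  apply: det_notin_prime => [//||i j]; first by case: hm.
  by rewrite mxE; apply: idealMr.
move=> /mU[y yE] u /bP; apply: span_min => // j.
rewrite -[b j]scale1r -yE mulrC -scalerA; apply: submodZ => //.
apply: (det_trick hL) => i.
have -> : \sum_j (1%:M - X) i j *: b j = (l i).1; last by have [] := lP i.
under eq_bigr => k _ do rewrite !mxE scalerBl.
rewrite sumrB (bigD1 i) //= eqxx scale1r big1 ?addr0 => [|k ne]; last first.
  by rewrite eq_sym (negPf ne) scale0r.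
have [_ bE] := lP i; rewrite {1}bE scaler_sumr.
under [X in _ - X]eq_bigr => k _ do rewrite -scalerA.
by rewrite addrK.
Qed.

Definition subset_lt P Q : Prop := (forall x, P x -> Q x) /\ exists2 x, Q x & ~ P x.

Definition dim_le (d : nat) : Prop := forall P : nat -> A -> Prop,
  (forall i, (i <= d.+1)%N -> primeP (P i)) ->
  (forall i, (i <= d)%N -> subset_lt (P i) (P i.+1)) -> False.

Lemma dim3_chain P0 P1 P2 P3 P4 : dim_le 3 -> primeP P0 -> primeP P1 ->
  primeP P2 -> primeP P3 -> primeP P4 -> subset_lt P0 P1 -> subset_lt P1 P2 ->
  subset_lt P2 P3 -> subset_lt P3 P4 -> False.
Proof.
move=> hd h0 h1 h2 h3 h4 h01 h12 h23 h34.
by apply: (hd (nth P4 [:: P0; P1; P2; P3; P4])) => [] [|[|[|[|[|]]]]].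
Qed.

(* A regular element cuts the dimension of the support: primes over ann(M/L')
   are not minimal over ann(M/L). *)
Lemma regular_prime_below M (L : M -> Prop) r P : noeth A -> submod L ->
  (forall u, L (r *: u) -> L u) -> primeP P ->
  (forall t, (forall u, exists l v, L l /\ t *: u = l + r *: v) -> P t) ->
  exists Q, [/\ primeP Q, subset_lt Q P & forall t, (forall u, L (t *: u)) -> Q t].
Proof.
move=> nA hL rL hP annP; have [idP P1 PM] := hP.
pose W x := exists i s, ~ P s /\ x = r ^+ i * s.
pose I t := forall u, L (t *: u).
have rLi i u : L (r ^+ i *: u) -> L u.
  elim: i u => [|i IHi] u; first by rewrite expr0 scale1r.
  by rewrite exprS -scalerA => /rL/IHi.
have [||||Q [hQ IQ QW]] := @prime_avoid _ I W nA.
- split=> [u|a x y Ix Iy u]; first by rewrite scale0r; case: hL.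
  by rewrite scalerDl -scalerA; apply: hL.2.
- by exists 0%N, 1; rewrite expr0 mulr1.
- move=> _ _ [i [s [Ps ->]]] [j [t [Pt ->]]]; exists (i + j)%N, (s * t).
  by split; [move=> /PM[] | rewrite exprD; ring].
- move=> x Ix [i [s [Ps xE]]]; apply: Ps; apply: annP => u.
  exists (s *: u), 0; rewrite scaler0 addr0; split=> //.
  by apply: (rLi i); rewrite scalerA -xE; apply: Ix.
exists Q; split=> //; split=> [x Qx|].
  apply: contrapT => nPx; apply: (QW x Qx).
  by exists 0%N, x; rewrite expr0 mul1r.
exists r; first by apply: annP => u; exists 0, u; rewrite add0r; case: hL.
by move=> /QW; apply; exists 1%N, 1; rewrite expr1 mulr1.
Qed.

(* If P is associated to M/L, some strictly larger prime is associated to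
   M/(L + aM). *)
Lemma associated_prime_above m M (L : M -> Prop) a P u : noeth A ->
  local_with m -> m a -> noethmod M -> submod L ->
  (forall u, L (a *: u) -> L u) -> ~ L u -> (forall p, P p -> L (p *: u)) ->
  exists Q v, [/\ primeP Q, subset_lt P Q,
    ~ (exists l w, L l /\ v = l + a *: w) &
    forall q, Q q -> exists l w, L l /\ q *: v = l + a *: w].
Proof.
move=> nA hm ma nM hL aL nLu Pu.
pose U v := forall p, P p -> L (p *: v).
pose L' v := exists l w, L l /\ v = l + a *: w.
have hL' : submod L'.
  split; first by exists 0, 0; rewrite scaler0 addr0; case: hL.
  move=> r _ _ [l [w [Ll ->]]] [l' [w' [Ll' ->]]].
  by exists (r *: l + l'), (r *: w + w'); split; [apply: hL.2 | mring].
have hU : submod U.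
  split=> [p Pp|r x y Ux Uy p Pp]; first by rewrite scaler0; case: hL.
  have -> : p *: (r *: x + y) = r *: (p *: x) + p *: y by mring.
  by apply: hL.2; [apply: Ux | apply: Uy].
(* U/L, the part of M/L killed by P, is nonzero. Were U inside L + aM, regularity of a would place
   it inside L + aU, and Nakayama inside L. *)
have [v [Uv nL'v]] : exists v, U v /\ ~ L' v.
  apply: contrapT => UL'; apply: nLu.
  apply: (nakayama (U := U) hm ma hL (nM _ hU)) => // v Uv.
  have [l [w [Ll vE]]] : L' v by apply: contrapT => nv; apply: UL'; exists v.
  exists l, w; split=> // p Pp; apply: aL.
  have -> : a *: (p *: w) = p *: v - p *: l by rewrite vE; mring.
  by apply: submodB => //; [apply: Uv | apply: submodZ].
have [r [nr hQ]] := prime_conductor nA hL' nL'v.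
exists (fun s => L' (s *: (r *: v))), (r *: v); split=> //; split.
  move=> p Pp; exists (p *: (r *: v)), 0; rewrite scaler0 addr0; split=> //.
  have -> : p *: (r *: v) = r *: (p *: v) by mring.
  by apply: submodZ => //; apply: Uv.
exists a; first by exists 0, (r *: v); rewrite add0r; case: hL.
by move=> Pa; apply: nLu; apply: aL; apply: Pu.
Qed.

Definition domainP : Prop := forall x y : A, x * y = 0 -> x = 0 \/ y = 0.

Definition torsion_free M : Prop := forall r (u : M), r *: u = 0 -> r = 0 \/ u = 0.

Lemma prime0 : domainP -> primeP (fun x : A => x = 0).
Proof.
move=> dA; split=> [|/eqP|x y /dA//]; last by rewrite oner_eq0.
by split=> // a x y -> ->; rewrite mulr0 addr0.
Qed.

(** A torsion element gives an associated prime P of M with 0 < P; the regular sequence pushes it up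
    three times, and the resulting chain of four strict inclusions exceeds dimension three. *)
Lemma CM_torsion_free m M a b c : noeth A -> local_with m -> domainP ->
  dim_le 3 -> noethmod M -> m a -> m b -> m c -> reg3 M a b c ->
  torsion_free M.
Proof.
move=> nA hm dA d3 nM ma mb mc [h1 h2 h3] r u ru0.
apply: contrapT => /not_orP[r0 u0].
pose L0 (v : M) := v = 0.
have hL0 : submod L0 by split=> // x v w -> ->; rewrite scaler0 addr0.
have [t [nt hP]] := prime_conductor nA hL0 u0.
set P := fun s => L0 _ in hP.
have [|Q1 [u1 [hQ1 PQ1 nu1 Qu1]]] :=
  associated_prime_above (P := P) nA hm ma nM hL0 h1 nt; first by [].
pose L1 v := exists l w, L0 l /\ v = l + a *: w.
have L1P v : L1 v <-> exists w, v = a *: w.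
  by split=> [[_ [w [-> ->]]]|[w ->]]; [exists w | exists 0, w]; rewrite ?add0r.
have hL1 : submod L1.
  split; first by apply/L1P; exists 0; rewrite scaler0.
  move=> x v w /L1P[v' ->] /L1P[w' ->]; apply/L1P.
  by exists (x *: v' + w'); mring.
have h2' v : L1 (b *: v) -> L1 v by move=> /L1P[w /h2]; apply: (L1P _).2.
have [Q2 [u2 [hQ2 Q12 nu2 Qu2]]] :=
  associated_prime_above (P := Q1) nA hm mb nM hL1 h2' nu1 Qu1.
pose L2 v := exists l w, L1 l /\ v = l + b *: w.
have L2P v : L2 v <-> exists w w', v = a *: w + b *: w'.
  split=> [[l [w [/L1P[w' ->] ->]]]|[w [w' ->]]]; first by exists w', w.
  by exists (a *: w), w'; split=> //; apply/L1P; exists w.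
have hL2 : submod L2.
  split; first by apply/L2P; exists 0, 0; rewrite !scaler0 addr0.
  move=> x v w /L2P[v1 [v2 ->]] /L2P[w1 [w2 ->]]; apply/L2P.
  by exists (x *: v1 + w1), (x *: v2 + w2); mring.
have h3' v : L2 (c *: v) -> L2 v by move=> /L2P[w [w' /h3]]; apply: (L2P _).2.
have [Q3 [u3 [hQ3 Q23 nu3 Qu3]]] :=
  associated_prime_above (P := Q2) nA hm mc nM hL2 h3' nu2 Qu2.
apply: (dim3_chain d3 (prime0 dA) hP hQ1 hQ2 hQ3) => //.
split=> [x ->|]; first by rewrite /P /L0 scale0r.
exists r => //; rewrite /P /L0.
have -> : r *: (t *: u) = t *: (r *: u) by mring.
by rewrite ru0 scaler0.
Qed.

End Regular.

(** * Depth at primes of coheight one and a Koszul criterion for freeness *)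

Section Depth.
Context {A : comNzRingType}.
Implicit Types (M N : lmodType A) (a b c r s t x : A) (I J P Q : A -> Prop).

Lemma tf_inj M r (u v : M) : torsion_free M -> r <> 0 -> r *: u = r *: v -> u = v.
Proof.
move=> tM r0 uv; have [|//|/eqP] := tM r (u - v).
  by rewrite scalerBr uv subrr.
by rewrite subr_eq0 => /eqP.
Qed.

Lemma power_in_ideal m a I : noeth A -> ideal I -> m a ->
  (forall Q, primeP Q -> (forall z, I z -> Q z) -> forall z, m z -> Q z) ->
  exists i, I (a ^+ i).
Proof.
move=> nA hI ma hQ; apply: contrapT => nI.
have [||||Q [hQp IQ QW]] := @prime_avoid _ I (fun z => exists i, z = a ^+ i) nA.
- by [].
- by exists 0%N.
- by move=> _ _ [i ->] [j ->]; exists (i + j)%N; rewrite exprD.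
- by move=> z Iz [i zE]; apply: nI; exists i; rewrite -zE.
by apply: (QW a); [apply: hQ | exists 1%N].
Qed.

Lemma ideal_sum_principal P x : ideal P ->
  ideal (fun z => exists p r, P p /\ z = p + x * r).
Proof.
move=> hP; split; first by exists 0, 0; split; [case: hP | ring].
move=> a _ _ [p [r [Pp ->]]] [p' [r' [Pp' ->]]].
by exists (a * p + p'), (a * r + r'); split; [apply: hP.2 | ring].
Qed.

(* Ext^1(A/P, M) = 0 for a prime P of coheight one and M of depth three, written
   with fractions: u/n is an element of the localized module such that P (u/n)
   lies in M. *)
Lemma CM_ext1 m M a b c P n : noeth A -> local_with m -> noethmod M ->
  torsion_free M -> m a -> m b -> m c -> reg3 M a b c ->
  primeP P -> n <> 0 -> (exists2 x, m x & ~ P x) ->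
  (forall Q, primeP Q -> subset_lt P Q -> forall z, m z -> Q z) ->
  forall u : M, (forall p, P p -> exists v, p *: u = n *: v) ->
  exists v, u = n *: v.
Proof.
move=> nA hm nM tM ma mb mc hr hP n0 [x mx nPx] Pmax.
have [hmp mU] := hm; have [idP P1 PM] := hP.
have x0 : x <> 0 by move=> xE; apply: nPx; rewrite xE; case: idP.
(* Every prime above P + (x) contains m, so each element of m has a power in P + (x). The regular
   sequence can thus be replaced by one of the form p + x r with p in P. *)
have pow y : m y -> exists i p r, P p /\ y ^+ i = p + x * r.
  move=> my; apply: (power_in_ideal nA (ideal_sum_principal x idP) my).
  move=> Q hQ PQ; apply: Pmax => //; split=> [z Pz|].
    by apply: PQ; exists z, 0; split=> //; ring.
  by exists x => //; apply: PQ; exists 0, 1; split; [case: idP | ring].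
have [i [pa [ra [Ppa aE]]]] := pow a ma.
have [j [pb [rb [Ppb bE]]]] := pow b mb.
have [k [pc [rc [Ppc cE]]]] := pow c mc.
move/(reg3_expn i j k): hr; rewrite {}aE {}bE {}cE.
set a' := pa + _; set b' := pb + _; set c' := pc + _ => hr.
have [h1 h2 h3] := hr.
pose U (u : M) := forall p, P p -> exists v, p *: u = n *: v.
pose L (u : M) := exists v, u = n *: v.
have hL : submod L.
  split; first by exists 0; rewrite scaler0.
  by move=> r _ _ [v ->] [w ->]; exists (r *: v + w); mring.
have hU : submod U.
  split=> [p Pp|r v w Uv Uw p Pp]; first by exists 0; rewrite !scaler0.
  have [v' vE] := Uv p Pp; have [w' wE] := Uw p Pp; exists (r *: v' + w').
  have -> : p *: (r *: v + w) = r *: (p *: v) + p *: w by mring.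
  by rewrite vE wE; mring.
(* U is finitely generated, so it is enough to write u = n mu + x u' with u' again in U. *)
apply: (nakayama (a := x) hm mx hL (nM _ hU)) => u Uu.
have [ma' maE] := Uu _ Ppa; have [mb' mbE] := Uu _ Ppb.
have [mc' mcE] := Uu _ Ppc.
have cross p q (v w : M) : p *: u = n *: v -> q *: u = n *: w -> q *: v = p *: w.
  move=> vE wE; apply: (tf_inj tM n0).
  have -> : n *: (q *: v) = q *: (n *: v) by mring.
  by rewrite -vE; have -> : n *: (p *: w) = p *: (n *: w); [|rewrite -wE]; mring.
have eE p q r s (v w : M) : p *: u = n *: v -> q *: u = n *: w ->
    x *: (s *: v - r *: w) = (q + x * s) *: v - (p + x * r) *: w.
  by move=> vE wE; apply: (eq_by_sub (esym (cross _ _ _ _ vE wE))); mring.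
(* For pa, pb in place of a', b' the difference b' ma' - a' mb' would vanish; hence it is divisible
   by x, and the quotients form a Koszul cocycle. Its primitive f corrects ma' and mb' by multiples
   of x until they become multiples a' mu and b' mu. *)
have [|fa [fb [fc [eabE eacE ebcE]]]] := @koszul_exact _ M a' b' c'
    (rb *: ma' - ra *: mb') (rc *: ma' - ra *: mc') (rc *: mb' - rb *: mc') hr.
  apply: (tf_inj tM x0).
  have -> : x *: (c' *: (rb *: ma' - ra *: mb') + a' *: (rc *: mb' - rb *: mc'))
    = c' *: (x *: (rb *: ma' - ra *: mb')) + a' *: (x *: (rc *: mb' - rb *: mc')).
    by mring.
  have -> : x *: (b' *: (rc *: ma' - ra *: mc')) =
    b' *: (x *: (rc *: ma' - ra *: mc')) by mring.
  rewrite (eE _ _ _ _ _ _ maE mbE) (eE _ _ _ _ _ _ maE mcE).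
  by rewrite (eE _ _ _ _ _ _ mbE mcE) -/a' -/b' -/c'; mring.
have [|mu muE] := h2 (ma' - x *: fa) (mb' - x *: fb).
  have := eE _ _ ra rb _ _ maE mbE; rewrite -/a' -/b' eabE => e.
  by apply: (eq_by_sub (esym e)); mring.
have muE' : mb' - x *: fb = b' *: mu.
  apply: (reg3_inj hr); have := eE _ _ ra rb _ _ maE mbE.
  rewrite -/a' -/b' eabE => e; have bmu := congr1 ( *:%R b') muE.
  by apply: (eq_by_sub bmu); apply: (eq_by_sub e); mring.
pose za := ra *: u + n *: fa; pose zb := rb *: u + n *: fb.
have zaE : a' *: (u - n *: mu) = x *: za.
  have := congr1 ( *:%R n) muE => e; apply: (eq_by_sub maE).
  by apply: (eq_by_sub e); rewrite /za /a'; mring.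
have zbE : b' *: (u - n *: mu) = x *: zb.
  have := congr1 ( *:%R n) muE' => e; apply: (eq_by_sub mbE).
  by apply: (eq_by_sub e); rewrite /zb /b'; mring.
have [|u' u'E] := h2 za zb.
  apply: (tf_inj tM x0).
  have -> : x *: (b' *: za) = b' *: (x *: za) by mring.
  have -> : x *: (a' *: zb) = a' *: (x *: zb) by mring.
  by rewrite -zaE -zbE; mring.
have uE : u - n *: mu = x *: u'.
  by apply: (reg3_inj hr); rewrite zaE u'E; mring.
have u'E' : zb = b' *: u'.
  by apply: (tf_inj tM x0); rewrite -zbE uE; mring.
exists (n *: mu), u'; split; [by exists mu | | by rewrite -uE addrC subrK].
move=> p Pp; have [v vE] := Uu p Pp.
have aE : a' *: (p *: u') = n *: (ra *: v + p *: fa).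
  have -> : a' *: (p *: u') = p *: (a' *: u') by mring.
  rewrite -u'E /za.
  have -> : p *: (ra *: u + n *: fa) = ra *: (p *: u) + p *: (n *: fa) by mring.
  by rewrite vE; mring.
have bE : b' *: (p *: u') = n *: (rb *: v + p *: fb).
  have -> : b' *: (p *: u') = p *: (b' *: u') by mring.
  rewrite -u'E' /zb.
  have -> : p *: (rb *: u + n *: fb) = rb *: (p *: u) + p *: (n *: fb) by mring.
  by rewrite vE; mring.
have [|w wE] := h2 (ra *: v + p *: fa) (rb *: v + p *: fb).
  apply: (tf_inj tM n0).
  have -> : n *: (b' *: (ra *: v + p *: fa)) = b' *: (n *: (ra *: v + p *: fa)).
    by mring.
  have -> : n *: (a' *: (rb *: v + p *: fb)) = a' *: (n *: (rb *: v + p *: fb)).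
    by mring.
  by rewrite -aE -bE; mring.
by exists w; apply: (reg3_inj hr); rewrite aE wE; mring.
Qed.

Lemma finite_denom P (T : finType) (E : T -> A -> Prop) : primeP P ->
  (forall i s t, E i s -> E i (t * s)) -> (forall i, exists2 t, ~ P t & E i t) ->
  exists2 t, ~ P t & forall i, E i t.
Proof.
move=> hP hE ht; have /choice[f fP] : forall i, exists t, ~ P t /\ E i t.
  by move=> i; have [t] := ht i; exists t.
exists (\prod_i f i).
  by apply: prime_prod => // i; case: (fP i).
by move=> i; rewrite (bigD1 i) //= mulrC; apply: hE; case: (fP i).
Qed.

Lemma alternating_sum (V : zmodType) d (F : 'I_d -> 'I_d -> V) :
  (forall j l, F l j = - F j l) -> (forall j, F j j = 0) ->
  \sum_j \sum_l F j l = 0.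
Proof.
move=> FN F0; rewrite pair_bigA /= (bigID (fun p : 'I_d * 'I_d => (p.1 < p.2)%N)) /=.
apply/eqP; rewrite addr_eq0; apply/eqP.
rewrite [in RHS](bigID (fun p : 'I_d * 'I_d => (p.2 < p.1)%N)) /=.
rewrite [X in _ = - (_ + X)]big1 ?addr0; last first.
  move=> [j l] /=; rewrite -!leqNgt => /andP[lj jl].
  by have /val_inj -> : j = l :> nat by apply/eqP; rewrite eqn_leq jl lj.
rewrite -sumrN (reindex_inj (h := fun p : 'I_d * 'I_d => (p.2, p.1))) /=.
  apply: eq_big => [[j l]|[j l] _] /=; last by rewrite FN.
  by case: ltngtP.
by move=> [j l] [j' l'] [-> ->].
Qed.

(* A module whose first Koszul homology on generators x of the maximal ideal
   of A_P vanishes is free at P: the relations between elements that form a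
   minimal generating family at P satisfy Rel = (x) Rel. *)
Lemma koszul_free M P d (x : 'I_d -> A) : noeth A -> primeP P -> fgmod M ->
  (forall i, P (x i)) ->
  (forall p, P p -> exists2 t, ~ P t & exists c : 'I_d -> A,
     t * p = \sum_i c i * x i) ->
  (forall u : 'I_d -> M, \sum_i x i *: u i = 0 ->
     exists2 t, ~ P t & exists w : 'I_d -> 'I_d -> M,
       [/\ forall i j, w j i = - w i j, forall i, w i i = 0 &
           forall i, t *: u i = \sum_j x j *: w i j]) ->
  exists k (b : 'I_k -> M), exists2 t, ~ P t &
    (forall u, span b (t *: u)) /\
    (forall c : 'I_k -> A, \sum_i c i *: b i = 0 -> forall i, t * c i = 0).
Proof.
move=> nA hP [T [b0 b0P]] Px Pgen kz; have [idP P1 PM] := hP.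
pose gen k := `[< exists (b : 'I_k -> M), exists2 t, ~ P t &
  forall u, span b (t *: u) >].
have exgen : exists k, gen k.
  have hT : submod (fun _ : M => True) by [].
  have [|n [b bP]] := @fgsub_ord _ M (fun=> True); first by exists T, b0.
  exists n; apply/asboolP; exists b, 1 => // u; exact/bP.
case: (ex_minnP exgen) => k /asboolP[b [t0 nPt0 t0P]] kmin.
exists k, b.
pose Rel (c : {ffun 'I_k -> A^o}) := exists2 t, ~ P t & t *: (\sum_i (c i : A) *: b i) = 0.
have hRel : submod (Rel : {ffun 'I_k -> (A^o : lmodType A)} -> Prop).
  split; first by exists 1; rewrite // big1 ?scaler0 // => i _; rewrite ffunE scale0r.
  move=> r c d' [t nPt tE] [s nPs sE]; exists (t * s); first by move=> /PM[].
  transitivity ((s * r) *: (t *: (\sum_i (c i : A) *: b i)) +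
                t *: (s *: (\sum_i (d' i : A) *: b i))); last first.
    by rewrite tE sE !scaler0 addr0.
  have -> : \sum_i ((r *: c + d' : {ffun 'I_k -> A^o}) i : A) *: b i =
     r *: (\sum_i (c i : A) *: b i) + \sum_i (d' i : A) *: b i.
    rewrite scaler_sumr -big_split; apply: eq_bigr => i _.
    by rewrite !ffunE /= scalerDl scalerA.
  by mring.
(* A coefficient outside P would make the generator [b i] redundant at P, against the minimality of
   k. *)
have RelP (c : {ffun 'I_k -> A^o}) : Rel c -> forall i, P (c i).
  case=> t nPt tE i; apply: contrapT => nPc.
  case: k b t0P kmin Rel hRel c tE i nPc => [|k] b t0P kmin Rel hRel c tE i nPc.
    by case: i nPc.
  suff : gen k by move=> /kmin; rewrite ltnn.
  apply/asboolP; exists (fun j => b (lift i j)), (t * c i * t0).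
    by move=> /PM[/PM[]|].
  move=> u; have [e eE] := t0P u.
  have ciE : (t * c i) *: b i = - \sum_j (t * c (lift i j)) *: b (lift i j).
    have := tE; rewrite (bigD1_ord i) //= scalerDr scalerA scaler_sumr => /eqP.
    rewrite addr_eq0 => /eqP ->; congr (- _).
    by apply: eq_bigr => j _; rewrite scalerA.
  have -> : (t * c i * t0) *: u = (t * c i) *: (t0 *: u) by mring.
  rewrite eE (bigD1_ord i) //=.
  exists (fun j => (t * c i) * e (lift i j) - e i * (t * c (lift i j))).
  rewrite scalerDr.
  have -> : (t * c i) *: (e i *: b i) = e i *: ((t * c i) *: b i) by mring.
  rewrite ciE scalerN addrC !scaler_sumr -sumrN -big_split /=.
  by apply: eq_bigr => j _; rewrite scalerBl !scalerA.
have step (c : {ffun 'I_k -> A^o}) : Rel c -> exists2 t, ~ P t & exists v : 'I_d -> {ffun 'I_k -> A^o},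
    (forall j, Rel (v j)) /\ t *: c = \sum_j x j *: v j.
  move=> Rc; have [s nPs sE] := Rc.
  have [t nPt tP] : exists2 t, ~ P t & forall i, exists e : 'I_d -> A,
      t * c i = \sum_j e j * x j.
    apply: (finite_denom hP) => [i s' t [e eE]|i]; last exact/Pgen/RelP.
    exists (fun j => t * e j); rewrite -mulrA eE mulr_sumr.
    by apply: eq_bigr => j _; rewrite mulrA.
  have /choice[u uP] := tP.
  (* With t c = \sum_j x_j u_j the relation reads \sum_j x_j V_j = 0. Koszul vanishing writes V_j
     through an alternating family w, and lifts of w to coefficient vectors correct the u_j to
     relations. *)
  pose V j : M := \sum_i (s * u i j) *: b i.
  have [|t1 nPt1 [w [wN w0 wP]]] := kz V.
    transitivity (t *: (s *: (\sum_i (c i : A) *: b i))); last by rewrite sE scaler0.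
    under eq_bigr => j _ do rewrite scaler_sumr.
    rewrite exchange_big /= !scaler_sumr; apply: eq_bigr => i _.
    transitivity ((s * \sum_j u i j * x j) *: b i).
      by rewrite mulr_sumr scaler_suml; apply: eq_bigr => j _; rewrite scalerA; congr (_ *: _); ring.
    by rewrite -uP; mring.
  have /choice[om0 om0P] : forall jl : 'I_d * 'I_d, exists e : {ffun 'I_k -> A^o},
      t0 *: w jl.1 jl.2 = \sum_i (e i : A) *: b i.
    move=> jl; have [e eE] := t0P (w jl.1 jl.2).
    by exists [ffun i => e i]; rewrite eE; apply: eq_bigr => i _; rewrite ffunE.
  (* Chosen lifts of w need not alternate; they are kept for j < l and extended by antisymmetry, so
     that their contribution to \sum_j x_j v_j cancels. *)
  pose om (j l : 'I_d) : {ffun 'I_k -> A^o} :=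
    if (j < l)%N then om0 (j, l) else if (l < j)%N then - om0 (l, j) else 0.
  have omN j l : om l j = - om j l.
    by rewrite /om; case: ltngtP => // _; rewrite ?opprK ?oppr0.
  have omP j l : t0 *: w j l = \sum_i (om j l i : A) *: b i.
    rewrite /om; case: ltngtP => [_|_|/val_inj ->]; first exact: (om0P (j, l)).
      rewrite wN scalerN (om0P (l, j)) -sumrN; apply: eq_bigr => i _.
      by rewrite ffunE scaleNr.
    by rewrite w0 scaler0 big1 // => i _; rewrite ffunE scale0r.
  pose v j : {ffun 'I_k -> A^o} :=
    [ffun i => t0 * t1 * s * u i j] - \sum_l x l *: om j l.
  exists (t0 * t1 * s * t); first by move=> /PM[/PM[/PM[]|]|].
  exists v; split.
    move=> j; exists 1 => //; rewrite scale1r.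
    transitivity (t0 *: (t1 *: V j) - \sum_l x l *: (t0 *: w j l)); last first.
      rewrite wP scaler_sumr; apply/eqP; rewrite subr_eq0; apply/eqP.
      by apply: eq_bigr => l _; mring.
    have -> : t0 *: (t1 *: V j) = \sum_i (t0 * t1 * s * u i j) *: b i.
      rewrite /V !scaler_sumr; apply: eq_bigr => i _; mring.
    under [X in _ - X]eq_bigr => l _ do rewrite omP scaler_sumr.
    rewrite [X in _ - X]exchange_big -sumrB /=; apply: eq_bigr => i _.
    rewrite !ffunE sum_ffunE scalerBl scaler_suml; congr (_ - _).
    by apply: eq_bigr => l _; rewrite !ffunE scalerA.
  apply/ffunP => i; rewrite !sum_ffunE ffunE.
  under eq_bigr => j _ do rewrite !ffunE sum_ffunE scalerBr.
  rewrite sumrB.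
  have -> : \sum_j x j *: (\sum_l (x l *: om j l) i : A^o) = 0.
    under eq_bigr => j _ do rewrite scaler_sumr.
    apply: alternating_sum => [j l|j].
      by rewrite omN !ffunE /= !scalerN !scalerA [x l * x j]mulrC.
    by rewrite /om ltnn !ffunE /= !scaler0.
  rewrite subr0 /= -[LHS]/(t0 * t1 * s * t * c i) -mulrA uP mulr_sumr.
  by apply: eq_bigr => j _; rewrite -[RHS]/(x j * _); ring.
(* Nakayama at P: after multiplication by some t outside P, each generator of Rel has coefficients
   in P over the generators, so a determinant outside P kills Rel. *)
have [n [rho rhoP]] := fgsub_ord (fg_noeth nA (fgmod_ffun _ fgmod_self) hRel).
have Rrho i : Rel (rho i) by apply/rhoP/span_gen.
have [t nPt /choice[X XP]] : exists2 t, ~ P t & forall i, exists X : 'I_n -> A,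
    (forall l, P (X l)) /\ t *: rho i = \sum_l X l *: rho l.
  apply: (finite_denom hP) => [i s t [X [PX tE]]|i].
    exists (fun l => t * X l); split=> [l|]; first exact: idealMl.
    rewrite -scalerA tE scaler_sumr; apply: eq_bigr => l _.
    by rewrite scalerA.
  have [t nPt [v [Rv tE]]] := step _ (Rrho i); exists t => //.
  have /choice[kap kapE] : forall j, exists c : 'I_n -> A,
      v j = \sum_l c l *: rho l by move=> j; apply/rhoP.
  exists (fun l => \sum_j x j * kap j l); split=> [l|].
    by apply: ideal_sum => // j; apply: idealMr.
  rewrite tE; under eq_bigr => j _ do rewrite kapE scaler_sumr.
  rewrite exchange_big /=; apply: eq_bigr => l _; rewrite scaler_suml.
  by apply: eq_bigr => j _; rewrite scalerA.
pose Y := \matrix_(i, l) X i l.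
have nPd : ~ P (\det (t%:M - Y)).
  by apply: det_notin_prime => // i l; rewrite mxE; case: (XP i).
have rho0 i : \det (t%:M - Y) *: rho i = 0.
  pose Z (c : {ffun 'I_k -> (A^o : lmodType A)}) := c = 0.
  have hZ : submod Z by split=> // r c e -> ->; rewrite scaler0 addr0.
  apply: (det_trick hZ) => j; rewrite /Z.
  under eq_bigr => l _ do rewrite !mxE scalerBl.
  rewrite sumrB (bigD1 j) //= eqxx big1 ?addr0 => [|l ne]; last first.
    by rewrite eq_sym (negPf ne) scale0r.
  by rewrite mulr1n; have [_ ->] := XP j; rewrite subrr.
exists (t0 * \det (t%:M - Y)); first by move=> /PM[].
split=> [u|c cE i].
  have -> : (t0 * \det (t%:M - Y)) *: u = t0 *: (\det (t%:M - Y) *: u) by mring.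
  exact: t0P.
pose cf : {ffun 'I_k -> (A^o : lmodType A)} := [ffun i => c i].
have /rhoP[e eE] : Rel cf.
  exists 1 => //; rewrite scale1r -[RHS]cE.
  by apply: eq_bigr => j _; rewrite ffunE.
have : \det (t%:M - Y) *: cf = 0.
  rewrite eE scaler_sumr big1 // => l _.
  have -> : \det (t%:M - Y) *: (e l *: rho l) = e l *: (\det (t%:M - Y) *: rho l).
    by rewrite !scalerA mulrC.
  by rewrite rho0 scaler0.
move=> /ffunP/(_ i); rewrite !ffunE /= => dc.
by rewrite -mulrA -[_ * c i]/(_ *: (c i : A^o)) dc mulr0.
Qed.

End Depth.

Definition linear_of (A : pzRingType) (M N : lmodType A) (f : M -> N)
    (fL : linear f) : {linear M -> N} :=
  HB.pack_for {linear M -> N} f (GRing.isLinear.Build _ _ _ _ f fL).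

(** * Krull dimension, regular sequences and parameters *)

Section Translation.
Context {A : comNzRingType}.
Implicit Types (M N : lmodType A) (I J P Q m : A -> Prop).

Lemma prime_idealr_of P : primeP P ->
  exists Q : prime_idealr A, forall a, (a \in (Q : pred A)) <-> P a.
Proof.
move=> [[P0 PD] P1 PM]; pose p : A -> bool := fun a => `[< P a >].
have p_id : idealr_closed p.
  split; [exact/asboolP | exact/asboolPn |].
  by move=> a u v /asboolP Pu /asboolP Pv; apply/asboolP/PD.
have p_pr : prime_idealr_closed p.
  move=> u v /asboolP/PM[] h; apply/orP; [left|right]; exact/asboolP.
pose q : prime_idealr A := HB.pack p (isIdealr.Build _ _ p_id)
  (isPrimeIdealrClosed.Build _ _ p_pr).
by exists q => a; split=> [/asboolP//|Pa]; apply/asboolP.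
Qed.

Lemma prime_of_idealr (Q : prime_idealr A) : primeP (fun a => a \in (Q : pred A)).
Proof.
split=> [||x y]; first split=> [|a x y Qx Qy].
- exact: idealr0.
- by rewrite rpredD // ring_quotient.idealMr.
- by rewrite idealr1.
by rewrite prime_idealrM => /orP.
Qed.

Lemma krull_dim_of d (P : nat -> A -> Prop) : dim_le (A := A) d ->
  (forall i, (i <= d)%N -> primeP (P i)) ->
  (forall i, (i < d)%N -> subset_lt (P i) (P i.+1)) -> krull_dim A d.
Proof.
move=> dA hP hlt; split.
  have /choice[Q QP] : forall i : 'I_d.+1, exists Q : prime_idealr A,
      forall a, (a \in (Q : pred A)) <-> P i a.
    by move=> i; apply/prime_idealr_of/hP; rewrite -ltnS.
  exists Q => i j ij.
  have Psub k : (i + k <= d)%N -> forall a, P i a -> P (i + k)%N a.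
    elim: k => [|k IHk]; first by rewrite addn0.
    by rewrite addnS => lt a Pa; apply: (hlt _ lt).1; apply: IHk => //; apply: ltnW.
  have jE : j = (i + (j - i.+1)).+1 :> nat by rewrite -addSn subnKC.
  have lt_d : (i + (j - i.+1) < d)%N by rewrite -jE -ltnS.
  have [sub [a Pa nPa]] := hlt _ lt_d.
  have le_d := ltnW lt_d.
  split; first by move=> b /QP Pb; apply/QP; rewrite jE; apply/sub/Psub.
  exists a; first by apply/QP; rewrite jE.
  by apply/negP => /QP Pia; apply: nPa; apply: Psub.
move=> k P' hP'; rewrite leqNgt; apply/negP => lt_dk.
apply: (dA (fun i a => a \in (P' (inord i) : pred A))) => i lei.
  exact: prime_of_idealr.
have [|sub [a ain anotin]] := hP' (inord i) (inord i.+1).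
  have ik : (i < k)%N by apply: leq_ltn_trans lt_dk.
  by rewrite !inordK ?ltnS // ltnW.
by split; [|exists a => //; apply/negP].
Qed.

Lemma krull_dim_uniq d d' : krull_dim A d -> krull_dim A d' -> d = d'.
Proof.
move=> [[P hP] h] [[P' hP'] h']; apply/eqP; rewrite eqn_leq.
by rewrite (h' _ _ hP) (h _ _ hP').
Qed.

Lemma span_mul_submod M (s : seq A) : submod (span_mul s : M -> Prop).
Proof.
split=> [|a _ _ [y ->] [z ->]].
  by exists 0; rewrite big1 // => i _; rewrite ffunE scaler0.
exists (a *: y + z); rewrite scaler_sumr -big_split; apply: eq_bigr => i _.
by rewrite !ffunE /= scalerDr !scalerA mulrC.
Qed.

Lemma span_mul_nil M (x : M) : span_mul [::] x <-> x = 0.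
Proof. by split=> [[y]|->]; [|exists 0]; rewrite big_ord0. Qed.

Lemma span_mul_rcons M (s : seq A) a (x : M) :
  span_mul (rcons s a) x <-> exists l v, span_mul s l /\ x = l + a *: v.
Proof.
have szE : size (rcons s a) = (size s).+1 by rewrite size_rcons.
split=> [[y ->]|[l [v [[y ->] ->]]]].
  exists (\sum_(i < size s) s`_i *: y (cast_ord (esym szE) (widen_ord (leqnSn _) i))).
  exists (y (cast_ord (esym szE) ord_max)); split.
    by exists [ffun i => y (cast_ord (esym szE) (widen_ord (leqnSn _) i))];
      apply: eq_bigr => i _; rewrite ffunE.
  rewrite (reindex (cast_ord (esym szE))) /=; last first.
    by exists (cast_ord szE) => i _; rewrite ?cast_ordKV ?cast_ordK.
  rewrite big_ord_recr /= nth_rcons ltnn eqxx; congr (_ + _).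
  by apply: eq_bigr => i _; rewrite nth_rcons ltn_ord.
exists [ffun i => if insub (val i) is Some j then y j else v].
rewrite [RHS](reindex (cast_ord (esym szE))) /=; last first.
  by exists (cast_ord szE) => i _; rewrite ?cast_ordKV ?cast_ordK.
rewrite big_ord_recr /= nth_rcons ltnn eqxx ffunE /= insubN ?ltnn //.
congr (_ + _); apply: eq_bigr => i _; rewrite nth_rcons ltn_ord ffunE /=.
by rewrite valK.
Qed.

(** Peeling off the last term with [regular_prime_below] moves to a strictly smaller prime, still
    above the annihilator of the quotient by the shorter sequence. *)
Lemma regular_chain M (s : seq A) P : noeth A ->
  (forall i (x : M), (i < size s)%N ->
     span_mul (take i s) (s`_i *: x) -> span_mul (take i s) x) ->
  primeP P -> (forall t, (forall u : M, span_mul s (t *: u)) -> P t) ->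
  exists Q : nat -> A -> Prop, [/\ Q (size s) = P,
    forall i, (i <= size s)%N -> primeP (Q i) &
    forall i, (i < size s)%N -> subset_lt (Q i) (Q i.+1)].
Proof.
move=> nA; elim/last_ind: s P => [|s a IHs] P sreg hP annP.
  by exists (fun=> P); split.
have [||||P' [hP' ltP annP']] := @regular_prime_below _ M (span_mul s) a P nA.
- exact: span_mul_submod.
- move=> u; have := sreg (size s) u; rewrite size_rcons => /(_ (leqnn _)).
  by rewrite -cats1 take_size_cat // nth_cat ltnn subnn.
- exact: hP.
- by move=> t ht; apply: annP => u; apply/span_mul_rcons/ht.
have [i x lti|//|//|Q [QE Qpr Qlt]] := IHs P'.
  have := sreg i x; rewrite size_rcons ltnS (ltnW lti) => /(_ isT).
  by rewrite -cats1 takel_cat ?(ltnW lti) // nth_cat lti.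
exists (fun i => if (i <= size s)%N then Q i else P); rewrite size_rcons.
split=> [|i _|i]; first by rewrite ltnn.
  by case: ifP => [/Qpr|].
rewrite ltnS => lei; case: (ltngtP i (size s)) lei => // [lti|->] _.
  exact: Qlt.
by rewrite QE.
Qed.

Lemma reg3_regular M a b c : reg3 M a b c <->
  (forall i (x : M), (i < 3)%N -> span_mul (take i [:: a; b; c])
     ([:: a; b; c]`_i *: x) -> span_mul (take i [:: a; b; c]) x).
Proof.
have sp1 (x : M) : span_mul [:: a] x <-> exists v, x = a *: v.
  rewrite -[[:: a]]/(rcons [::] a); split.
    by move=> /span_mul_rcons[l [v [/span_mul_nil -> ->]]]; exists v; rewrite add0r.
  move=> [v ->]; apply/span_mul_rcons; exists 0, v; rewrite add0r.
  by split=> //; apply/span_mul_nil.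
have sp2 (x : M) : span_mul [:: a; b] x <-> exists v w, x = a *: v + b *: w.
  rewrite -[[:: a; b]]/(rcons [:: a] b); split.
    by move=> /span_mul_rcons[l [w [/sp1[v ->] ->]]]; exists v, w.
  move=> [v [w ->]]; apply/span_mul_rcons; exists (a *: v), w; split=> //.
  by apply/sp1; exists v.
split=> [[h1 h2 h3] [|[|[|//]]] x _ /=|h].
- by move=> /span_mul_nil/h1 ->; apply/span_mul_nil.
- by move=> /sp1[v /h2]/sp1.
- by move=> /sp2[v [w /h3]]/sp2.
split=> [u u0|u v uE|u v w uE].
- by apply/span_mul_nil/(h 0%N) => //=; apply/span_mul_nil.
- by apply/sp1/(h 1%N) => //=; apply/sp1; exists v.
- by apply/sp2/(h 2%N) => //=; apply/sp2; exists v, w.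
Qed.

Lemma fgmodP M : finitely_generated M <-> fgmod M.
Proof.
split=> [[n [p pP]]|fM].
  exists 'I_n, (fun i => p (delta_mx 0 i)) => x; have [v <-] := pP x.
  exists (fun i => v 0 i); rewrite {1}[v]row_sum_delta linear_sum.
  by apply: eq_bigr => i _; rewrite linearZ.
have hT : submod (fun _ : M => True) by [].
have [|n [b bP]] := @fgsub_ord _ M (fun=> True).
  by have [T [b bP]] := fM; exists T, b.
pose f (v : 'rV[A]_n) := \sum_i v 0 i *: b i.
have flin : linear f.
  move=> a u v; rewrite /f scaler_sumr -big_split; apply: eq_bigr => i _.
  by rewrite !mxE scalerDl scalerA.
exists n, (linear_of flin) => x.
have [c ->] := (bP x).1 I; exists (\row_i c i); rewrite /= /f.
by apply: eq_bigr => i _; rewrite mxE.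
Qed.

Lemma nonunitP m (a : A) : local_with m -> nonunit a <-> m a.
Proof.
move=> [[mi m1 _] mU]; split=> [nu|ma b]; last first.
  by apply/eqP => ab; apply: m1; rewrite -ab; apply: idealMr.
by apply: contrapT => /mU[b ab]; have := nu b; rewrite ab eqxx.
Qed.

Lemma regular_size m M (s : seq A) d : noeth A -> local_with m ->
  dim_le (A := A) d -> regular_sequence M s -> (size s <= d)%N.
Proof.
move=> nA hm dA [_ sreg [x nx]]; have [hmp _] := hm.
have [t ht|Q [QE Qpr Qlt]] := regular_chain nA sreg hmp.
  apply: contrapT => /(hm.2)[y ty]; apply: nx.
  rewrite -[x]scale1r -ty mulrC -scalerA; apply: submodZ => //.
  exact: span_mul_submod.
rewrite leqNgt; apply/negP => lt_d; apply: (dA Q) => i lei.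
  by apply: Qpr; apply: leq_trans lt_d.
by apply: Qlt; apply: leq_ltn_trans lt_d.
Qed.

(** If t M lies in s M with s inside P, a determinant congruent to a power of t modulo P kills M; as
    M is torsion free and nonzero it is 0, so t lies in P. *)
Lemma ann_quotient_prime M (s : seq A) P : fgmod M -> torsion_free M ->
  (exists u : M, u <> 0) -> primeP P -> (forall a, a \in s -> P a) ->
  forall t, (forall u : M, span_mul s (t *: u)) -> P t.
Proof.
move=> fM tM [u0 u0nz] hP sP t ht; apply: contrapT => nPt.
have hT : submod (fun _ : M => True) by [].
have [|n [b bP]] := @fgsub_ord _ M (fun=> True).
  by have [T [b bP]] := fM; exists T, b.
have idP : ideal P by case: hP.
have /choice[X XP] : forall i, exists X : 'I_n -> A,
    (forall j, P (X j)) /\ t *: b i = \sum_j X j *: b j.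
  move=> i; have [y ->] := ht (b i).
  have /choice[k kE] : forall l : 'I_(size s), exists k : 'I_n -> A,
      y l = \sum_j k j *: b j by move=> l; apply/bP.
  exists (fun j => \sum_(l < size s) s`_l * k l j); split=> [j|].
    by apply: ideal_sum => // l; apply: idealMr => //; apply/sP/mem_nth.
  under eq_bigr => l _ do rewrite kE scaler_sumr.
  rewrite exchange_big /=; apply: eq_bigr => j _; rewrite scaler_suml.
  by apply: eq_bigr => l _; rewrite scalerA.
pose Y := \matrix_(i, l) X i l.
have nPd : ~ P (\det (t%:M - Y)).
  by apply: det_notin_prime => // i l; rewrite mxE; case: (XP i).
have b0 i : \det (t%:M - Y) *: b i = 0.
  pose Z (c : M) := c = 0.
  have hZ : submod Z by split=> // r c e -> ->; rewrite scaler0 addr0.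
  apply: (det_trick hZ) => j; rewrite /Z.
  under eq_bigr => l _ do rewrite !mxE scalerBl.
  rewrite sumrB (bigD1 j) //= eqxx big1 ?addr0 => [|l ne]; last first.
    by rewrite eq_sym (negPf ne) scale0r.
  by rewrite mulr1n; have [_ ->] := XP j; rewrite subrr.
have [] := tM (\det (t%:M - Y)) u0 => //.
  have [c ->] := (bP u0).1 I; rewrite scaler_sumr big1 // => i _.
  by rewrite scalerA mulrC -scalerA b0 scaler0.
by move=> d0; apply: nPd; rewrite d0; case: idP.
Qed.

(** P lies above the annihilator of M/(a, b, c)M, so a chain of three strict inclusions ends at P;
    one more step up to m would exceed the dimension. *)
Lemma reg3_parameters m M (a b c : A) P : noeth A -> local_with m ->
  dim_le (A := A) 3 -> fgmod M -> torsion_free M -> (exists u : M, u <> 0) ->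
  reg3 M a b c -> primeP P -> P a -> P b -> P c -> forall z, m z -> P z.
Proof.
move=> nA hm d3 fM tM M0 hr hP Pa Pb Pc z mz; apply: contrapT => nPz.
have [x|Q [QE Qpr Qlt]] := @regular_chain M [:: a; b; c] P nA ((reg3_regular M a b c).1 hr) hP.
  apply: ann_quotient_prime => // y; rewrite !inE.
  by move=> /or3P[]/eqP ->.
apply: (d3 (fun i => if (i <= 3)%N then Q i else m)) => i lei.
  by case: ifP => [/Qpr//|_]; case: hm.
case: (ltngtP i 3) lei => // [lti|->] _; first exact: Qlt.
  rewrite -[3%N]/(size [:: a; b; c]) QE; split; last by exists z.
  move=> x Px; apply/(nonunitP _ hm) => y; apply/eqP => xy.
  by have [Pi P1 _] := hP; apply: P1; rewrite -xy; apply: idealMr.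
Qed.

End Translation.

Local Open Scope quotient_scope.

(** * Localization at a prime, in terms of fractions *)

Section LocalizationFacts.
Context {A : comNzRingType} (P : prime_idealr A).
Local Notation L := (localization P).
Local Notation Pp := (fun a => a \in (P : pred A)).

Definition loc_mk (a s : A) (hs : s \notin (P : pred A)) : L :=
  \pi_L (loc_frac a hs).

Lemma loc_mk_eqP a s hs b t ht : @loc_mk a s hs = @loc_mk b t ht <->
  exists2 u, ~ Pp u & u * (a * t) = u * (b * s).
Proof.
split=> [/eqmodP/asboolP[u uP uE]|[u uP uE]].
  by exists u => //; apply/negP.
by apply/loc_piP/asboolP; exists u => //; apply/negP.
Qed.

Lemma loc_mkM a s hs b t ht :
  @loc_mk a s hs * @loc_mk b t ht = loc_mk (a * b) (loc_denM (exist _ s hs) (exist _ t ht)).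
Proof. by rewrite /loc_mk -[LHS]loc_piM. Qed.

Lemma loc_mkD a s hs b t ht : @loc_mk a s hs + @loc_mk b t ht =
  loc_mk (a * t + b * s) (loc_denM (exist _ s hs) (exist _ t ht)).
Proof. by rewrite /loc_mk -[LHS]loc_piD. Qed.

Lemma loc_mk1 : loc_mk 1 (loc_den1 P) = 1.
Proof. by []. Qed.

Lemma loc_mk0 : loc_mk 0 (loc_den1 P) = 0.
Proof. by []. Qed.

Lemma loc_mk_surj (y : L) : exists a s hs, y = @loc_mk a s hs.
Proof. by elim/quotW: y => -[a [s hs]]; exists a, s, hs. Qed.

Lemma loc_mk_nonunit a s hs : nonunit (@loc_mk a s hs) <-> Pp a.
Proof.
split=> [nu|Pa y].
  apply: contrapT => nPa; have ha : a \notin (P : pred A) by apply/negP.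
  have := nu (loc_mk s ha); rewrite loc_mkM -loc_mk1 => /eqP; apply.
  by apply/loc_mk_eqP; exists 1; [apply/negP/loc_den1 | rewrite /=; ring].
have [b [t [ht ->]]] := loc_mk_surj y; apply/eqP; rewrite loc_mkM -loc_mk1.
move=> /loc_mk_eqP[u nPu /= uE].
have : u * (1 * (s * t)) \in (P : pred A).
  by rewrite -uE mulr1 mulrC -mulrA; rewrite prime_idealrM Pa.
rewrite mul1r !prime_idealrM (negPf hs) (negPf ht) !orbF.
by move=> /nPu.
Qed.

Lemma loc_chain d (Q : 'I_d.+1 -> prime_idealr L) : prime_chain Q ->
  exists C : nat -> A -> Prop,
  [/\ forall i, primeP (C i), forall i, (i < d)%N -> subset_lt (C i) (C i.+1) &
      forall i a, C i a -> Pp a].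
Proof.
move=> hQ; pose j a := loc_mk a (loc_den1 P).
have jD a b : j (a + b) = j a + j b.
  rewrite /j loc_mkD; apply/loc_mk_eqP; exists 1; first exact/negP/loc_den1.
  by rewrite /=; ring.
have jM a b : j (a * b) = j a * j b.
  rewrite /j loc_mkM; apply/loc_mk_eqP; exists 1; first exact/negP/loc_den1.
  by rewrite /=; ring.
exists (fun i a => j a \in (Q (inord i) : pred L)).
split=> [i|i lti|i a].
- split=> [||x y]; first split=> [|a x y Qx Qy].
  + exact: idealr0.
  + by rewrite jD jM rpredD // ring_quotient.idealMr.
  + by rewrite /j loc_mk1 idealr1.
  by rewrite jM prime_idealrM => /orP.
- have [|sub [y yin ynot]] := hQ (inord i) (inord i.+1).
    by rewrite !inordK // ltnS // ltnW.
  split=> [a|]; first exact: sub.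
  have [a [s [hs yE]]] := loc_mk_surj y; exists a.
    have -> : j a = j s * y; last exact: ring_quotient.idealMr.
    rewrite yE /j loc_mkM; apply/loc_mk_eqP; exists 1; first exact/negP/loc_den1.
    by rewrite /=; ring.
  move=> ja; move/negP: ynot; apply.
  have -> : y = loc_mk 1 hs * j a; last exact: ring_quotient.idealMr.
  rewrite yE /j loc_mkM; apply/loc_mk_eqP; exists 1; first exact/negP/loc_den1.
  by rewrite /=; ring.
move=> ja; apply/(loc_mk_nonunit a (loc_den1 P)) => y; apply/eqP => yE.
have : (1 : L) \in (Q (inord i) : pred L).
  by rewrite -yE mulrC; apply: ring_quotient.idealMr.
by rewrite idealr1.
Qed.

(** Clearing denominators: numerators of the generators still generate P up to multipliers outside
    P, which keeps later arguments inside A. *)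
Lemma loc_generators (s : seq L) :
  (forall y : L, nonunit y <-> ideal_span s y) ->
  exists x : 'I_(size s) -> A, (forall i, Pp (x i)) /\
    forall p, Pp p -> exists2 t, ~ Pp t & exists c : 'I_(size s) -> A,
      t * p = \sum_i c i * x i.
Proof.
move=> hs.
have /choice[x xP] : forall i : 'I_(size s),
    exists x, exists v (hv : v \notin (P : pred A)), s`_i = loc_mk x hv.
  by move=> i; have [a [v [hv sE]]] := loc_mk_surj s`_i; exists a, v, hv.
have Px i : Pp (x i).
  have [v [hv sE]] := xP i; apply/(loc_mk_nonunit _ hv); rewrite -sE; apply/hs.
  exists [ffun j => (j == i)%:R]; rewrite (bigD1 i) //= ffunE eqxx mul1r.
  by rewrite big1 ?addr0 // => j /negPf ne; rewrite ffunE ne mul0r.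
exists x; split=> // p Pp_.
pose good (y : L) := exists a v hv, y = @loc_mk a v hv /\
  exists2 t, ~ Pp t & exists c : 'I_(size s) -> A, t * a = \sum_i c i * x i.
have goodD y z : good y -> good z -> good (y + z).
  move=> [a [v [hv [-> [t nPt [c cE]]]]]] [b [w [hw [-> [t' nPt' [c' c'E]]]]]].
  exists (a * w + b * v), (v * w), (loc_denM (exist _ v hv) (exist _ w hw)).
  split; first exact: loc_mkD.
  exists (t * t'); first by rewrite prime_idealrM => /orP[].
  exists (fun i => t' * w * c i + t * v * c' i).
  transitivity (t' * w * (t * a) + t * v * (t' * b)); first by ring.
  rewrite cE c'E !mulr_sumr -big_split; apply: eq_bigr => i _ /=.
  by ring.
have good0 : good 0.
  exists 0, 1, (loc_den1 P); split; first by rewrite loc_mk0.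
  exists 1; first exact/negP/loc_den1.
  by exists (fun=> 0); rewrite mulr0 big1 // => i _; rewrite mul0r.
have [c cE] : ideal_span s (loc_mk p (loc_den1 P)).
  by apply/hs/loc_mk_nonunit.
have [a [v [hv [aE [t nPt [d dE]]]]]] : good (loc_mk p (loc_den1 P)).
  rewrite cE; elim/big_rec: _ => // i y _ gy; apply: goodD => //.
  have [v [hv ->]] := xP i; have [b [w [hw ->]]] := loc_mk_surj (c i).
  exists (b * x i), (w * v), (loc_denM (exist _ w hw) (exist _ v hv)).
  split; first exact: loc_mkM.
  exists 1; first exact/negP/loc_den1.
  exists (fun j => b * (j == i)%:R); rewrite mul1r (bigD1 i) //= eqxx mulr1.
  by rewrite big1 ?addr0 // => j /negPf ->; rewrite mulr0 mul0r.
move/loc_mk_eqP: aE => [u nPu uE].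
exists (u * t * v).
  by move=> h; have := h; rewrite !prime_idealrM (negPf hv) orbF => /orP[].
exists (fun i => u * d i).
transitivity (u * (t * a)); last first.
  by rewrite dE mulr_sumr; apply: eq_bigr => i _; rewrite mulrA.
transitivity (t * (u * (p * v))); first by ring.
by rewrite uE; ring.
Qed.

End LocalizationFacts.

(** * Freeness on the punctured spectrum *)

Section FreeFactor.
Context {A : comNzRingType}.
Implicit Types (M N : lmodType A) (I J P Q m : A -> Prop).

(** Multiplication by r on M factors through a finite free module; such r form an ideal and kill the
    obstructions to lifting maps out of M along surjections. *)
Definition free_factor M (r : A) : Prop :=
  exists (T : finType) (al : T -> M -> A) (mu : T -> M),
    (forall i, linear (al i : M -> A^o)) /\
    forall u, r *: u = \sum_i al i u *: mu i.

Lemma free_factor_ideal M : ideal (free_factor M).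
Proof.
split=> [|a x y [T [al [mu [alL alE]]]] [T' [al' [mu' [alL' alE']]]]].
  exists void, (fun v : void => match v with end), (fun v : void => match v with end).
  by split=> [[]|u]; rewrite scale0r big1 // => -[].
exists (T + T')%type, (fun k u => match k with inl i => al i u | inr j => al' j u end).
exists (fun k => match k with inl i => a *: mu i | inr j => mu' j end).
split=> [[i|j]|u]; [exact: alL | exact: alL' |].
rewrite big_sumType /= scalerDl -scalerA alE alE' scaler_sumr.
congr (_ + _); apply: eq_bigr => i _.
by rewrite !scalerA mulrC.
Qed.

Lemma free_factor_of_basis M k (b : 'I_k -> M) t : domainP (A := A) -> t <> 0 ->
  (forall u, span b (t *: u)) ->
  (forall c : 'I_k -> A, \sum_i c i *: b i = 0 -> forall i, t * c i = 0) ->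
  free_factor M t.
Proof.
move=> dA t0 bP bI; have [c cE] := choice bP.
exists 'I_k, (fun i u => c u i), b; split=> // i a u v.
have : forall j, t * (c (a *: u + v) j - (a * c u j + c v j)) = 0.
  apply: bI; under eq_bigr => j _ do rewrite scalerBl scalerDl -scalerA.
  rewrite sumrB big_split -scaler_sumr /= -!cE.
  by mring.
by move=> /(_ i)/dA[//|/eqP]; rewrite subr_eq0 => /eqP.
Qed.

Lemma finite_denom_ideal P d (x : 'I_d -> A) : noeth A -> primeP P ->
  (forall p, P p -> exists2 t, ~ P t & exists c : 'I_d -> A,
     t * p = \sum_i c i * x i) ->
  exists2 t, ~ P t & forall p, P p -> exists c : 'I_d -> A,
     t * p = \sum_i c i * x i.
Proof.
move=> nA hP Pgen; have [idP P1 PM] := hP.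
have [T [b bP]] := nA _ (ideal_submod idP).
pose E (i : T) t := exists c : 'I_d -> A, t * b i = \sum_j c j * x j.
have [i s t [c cE]|i|t nPt tP] := finite_denom (E := E) hP.
- exists (fun j => t * c j); rewrite -mulrA cE mulr_sumr.
  by apply: eq_bigr => j _; rewrite mulrA.
- by apply: Pgen; apply/bP/span_gen.
exists t => // p /bP[c ->].
have /choice[e eE] := tP.
exists (fun j => \sum_i c i * e i j); rewrite mulr_sumr.
under [RHS]eq_bigr => j _ do rewrite mulr_suml.
rewrite exchange_big /=; apply: eq_bigr => i _.
transitivity (c i * (t * b i)); first by rewrite -[_ *: _]/(_ * _); ring.
by rewrite eE mulr_sumr; apply: eq_bigr => j _; rewrite mulrA.
Qed.

(** With one generator x of P, Koszul vanishing is torsion freeness. If x = 0, then P vanishes in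
    the localization and the empty generating family is used instead. *)
Lemma dvr_free M P (x : A) : noeth A -> domainP (A := A) -> primeP P ->
  fgmod M -> torsion_free M -> P x ->
  (forall p, P p -> exists2 t, ~ P t & exists c, t * p = c * x) ->
  exists2 t, ~ P t & free_factor M t.
Proof.
move=> nA dA hP fM tM Px Pgen; have [idP P1 PM] := hP.
have t0 t : ~ P t -> t <> 0 by move=> nPt tE; apply: nPt; rewrite tE; case: idP.
have [x0|x0] := EM (x = 0).
  have [|||k [b [t nPt [bP bI]]]] :=
    @koszul_free _ M P 0 (fun=> 0) nA hP fM.
  - by case.
  - move=> p /Pgen[t nPt [c cE]]; exists t => //; exists (fun=> 0).
    by rewrite cE x0 mulr0 big_ord0.
  - by move=> u _; exists 1 => //; exists (fun _ _ => 0); split=> -[].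
  by exists t => //; apply: (free_factor_of_basis (b := b)) => //; apply: t0.
have [|||k [b [t nPt [bP bI]]]] := @koszul_free _ M P 1 (fun=> x) nA hP fM.
- by [].
- move=> p /Pgen[t nPt [c cE]]; exists t => //; exists (fun=> c).
  by rewrite big_ord1.
- move=> u; rewrite big_ord1 => /tM[//|u0].
  exists 1 => //; exists (fun _ _ => 0); split=> [i j|//|i]; first by rewrite oppr0.
  by rewrite big_ord1 scaler0 ord1 u0 scaler0.
by exists t => //; apply: (free_factor_of_basis (b := b)) => //; apply: t0.
Qed.

(** By [power_in_ideal] it is enough that no nonmaximal prime Q contains the ideal [free_factor M].
    The localization at Q is regular of dimension d at most 2 and M is free there: for d < 2 because
    it is torsion free, for d = 2 by [CM_ext1] and [koszul_free]. *)
Lemma CM_free_factor m M (a b c : A) : noeth A -> local_with m -> domainP (A := A) ->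
  dim_le (A := A) 3 -> isolated_singularity A -> fgmod M -> torsion_free M ->
  m a -> m b -> m c -> reg3 M a b c ->
  forall z, m z -> exists i, free_factor M (z ^+ i).
Proof.
move=> nA hm dA d3 isoA fM tM ma mb mc hr z mz.
apply: (power_in_ideal nA (free_factor_ideal M) mz) => Q hQ JQ.
apply: contrapT => nmQ; suff [t nQt /JQ//] : exists2 t, ~ Q t & free_factor M t.
have [idQ Q1 QM] := hQ.
have Qm y : Q y -> m y.
  move=> Qy; apply/(nonunitP _ hm) => y'; apply/eqP => yy.
  by apply: Q1; rewrite -yy; apply: idealMr.
have [x mx nQx] : exists2 x, m x & ~ Q x.
  apply: contrapT => h; apply: nmQ => y my; apply: contrapT => nQy.
  by apply: h; exists y.
have [Q' Q'P] := prime_idealr_of hQ.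
have [|nL lL [d [s [dL sd sgen]]]] := isoA Q'.
  by move=> h; apply: nQx; apply/Q'P/h/nonunitP; first exact: hm.
have [[C hC] _] := dL; have [Ch [Chp Chl ChQ]] := loc_chain hC.
have {}ChQ i y : Ch i y -> Q y by move=> /ChQ/Q'P.
have Qltm : subset_lt Q m by split=> //; exists x.
have chain_d k : (forall i, (i <= k)%N -> (i < d)%N -> subset_lt (Ch i) (Ch i.+1)).
  by move=> i _; apply: Chl.
have le_lt P0 P1 P2 : subset_lt P0 P1 -> (forall y, P1 y -> P2 y) -> subset_lt P0 P2.
  by move=> [h [y h1 h0]] h12; split=> [w /h/h12//|]; exists y => //; apply: h12.
have hmp : primeP m by case: hm.
have d_le2 : (d <= 2)%N.
  rewrite leqNgt; apply/negP => d_gt2.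
  apply: (dim3_chain d3 (Chp 0%N) (Chp 1%N) (Chp 2%N) (Chp 3%N) hmp).
  - by apply: Chl; apply: leq_trans d_gt2.
  - by apply: Chl; apply: leq_trans d_gt2.
  - exact: Chl.
  by split=> [y /ChQ/Qm//|]; exists x => // /ChQ.
have [xs [Qxs0 Qgen0]] := loc_generators sgen.
have Qxs i : Q (xs i) by apply/Q'P.
have Qgen p : Q p -> exists2 t, ~ Q t & exists c : 'I_(size s) -> A,
    t * p = \sum_i c i * xs i.
  by move=> /Q'P/Qgen0[t nt tE]; exists t => // /Q'P.
move: (size s) sd xs {Qxs0 Qgen0} Qxs Qgen => n -> {s sgen n} xs Qxs Qgen.
case: d d_le2 dL C hC Chl chain_d xs Qxs Qgen => [|[|[|//]]] _ dL C hC Chl _ xs Qxs Qgen.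
- apply: (dvr_free (x := 0) nA dA hQ fM tM); first by case: idQ.
  move=> p /Qgen[t nQt [e]]; rewrite big_ord0 => tE.
  by exists t => //; exists 0; rewrite tE mulr0.
- apply: (dvr_free (x := xs 0) nA dA hQ fM tM) => //.
  move=> p /Qgen[t nQt [e]]; rewrite big_ord1 => tE.
  by exists t => //; exists (e 0).
pose x0 := xs 0; pose x1 := xs (lift 0 0).
have sum2 (V : zmodType) (F : 'I_2 -> V) : \sum_i F i = F 0 + F (lift 0 0).
  by rewrite big_ord_recl big_ord1.
(* [CM_ext1] uses x1 as a denominator; if x1 = 0, then Q is locally principal and torsion freeness
   suffices. *)
have [x10|x1n0] := EM (x1 = 0).
  apply: (dvr_free (x := x0) nA dA hQ fM tM); first exact: Qxs.
  move=> p /Qgen[t nQt [e]]; rewrite sum2 -/x1 x10 mulr0 addr0 => tE.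
  by exists t => //; exists (e 0).
(* Two strict inclusions end at Q, so dimension three leaves no room between Q and m. *)
have Qmax P : primeP P -> subset_lt Q P -> forall y, m y -> P y.
  move=> hP QP y my; apply: contrapT => nPy.
  have Pm : subset_lt P m.
    split; last by exists y.
    move=> w Pw; apply/(nonunitP _ hm) => w'; apply/eqP => ww.
    by have [iP P1 _] := hP; apply: P1; rewrite -ww; apply: idealMr.
  apply: (dim3_chain d3 (Chp 0%N) (Chp 1%N) hQ hP hmp) => //; first exact: Chl.
  by apply: (le_lt _ (Ch 2%N)); [apply: Chl | apply: ChQ].
have [t nQt tP] := finite_denom_ideal nA hQ Qgen.
(* If x0 u0 + x1 u1 = 0 and t Q lies in (x0, x1), then Q t u0 is divisible by x1; [ext] makes t u0
   itself divisible, which is the Koszul vanishing at Q. *)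
have ext := CM_ext1 nA hm (fg_noeth nA fM) tM ma mb mc hr hQ x1n0 (ex_intro2 _ _ x mx nQx) Qmax.
have [|||k [e [t' nQt' [eP eI]]]] := @koszul_free _ M Q 2 xs nA hQ fM.
- exact: Qxs.
- exact: Qgen.
- move=> u; rewrite sum2 -/x0 -/x1 => uE.
  have [|w wE] := ext (t *: u 0).
    move=> p /tP[f]; rewrite sum2 -/x0 -/x1 => pE.
    exists (f (lift 0 0) *: u 0 - f 0 *: u (lift 0 0)).
    have -> : p *: (t *: u 0) = (t * p) *: u 0 by mring.
    rewrite pE; have := congr1 ( *:%R (f 0)) uE => uE'.
    by apply: (eq_by_sub uE'); mring.
  exists t => //.
  exists (fun i j => if (i < j)%N then w else if (j < i)%N then - w else 0).
  split=> [i j|i|i].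
  - by case: ltngtP; rewrite ?opprK ?oppr0.
  - by rewrite ltnn.
  rewrite sum2; have [->|->] : i = 0 \/ i = lift 0 0.
  - by case: i => -[|[|//]] lt; [left|right]; apply: val_inj.
  - by rewrite /= wE scaler0 add0r.
  rewrite /= -/x0 -/x1 scaler0 addr0; apply: (tf_inj tM x1n0).
  have := congr1 ( *:%R x0) wE => wE'; have := congr1 ( *:%R t) uE => uE'.
  by apply: (eq_by_sub uE'); apply: (eq_by_sub (esym wE')); mring.
exists t' => //; apply: (free_factor_of_basis (b := e)) => // t0.
by apply: nQt'; rewrite t0; case: idQ.
Qed.

End FreeFactor.

(** * Power series rings *)

Section SeriesCoefficients.
Context {n : nat} {F : comNzRingType}.
Local Notation S := (mfps n F).
Implicit Types (f g h : S) (m k u : 'X_{1..n}).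

Lemma mfps_coefD f g m : (f + g) m = f m + g m. Proof. by []. Qed.
Lemma mfps_coefN f m : (- f) m = - f m. Proof. by []. Qed.
Lemma mfps_coefB f g m : (f - g) m = f m - g m. Proof. by []. Qed.
Lemma mfps_coef0 m : (0 : S) m = 0. Proof. by []. Qed.
Lemma mfps_coef1 m : (1 : S) m = (m == 0%MM)%:R. Proof. by []. Qed.

Lemma mfps_coef_sum (I : Type) (r : seq I) (P : pred I) (E : I -> S) m :
  (\sum_(i <- r | P i) E i) m = \sum_(i <- r | P i) E i m.
Proof.
by elim/big_rec2: _ => [|i x y _ <-]; rewrite ?mfps_coef0 ?mfps_coefD.
Qed.

Lemma mfps_coefM f g m :
  (f * g) m = \sum_(k : 'X_{1..n < (mdeg m).+1} | (k <= m)%MM) f k * g (m - k)%MM.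
Proof.
have af := @mfps_truncP _ _ (mdeg m).+1 f; have ag := @mfps_truncP _ _ (mdeg m).+1 g.
rewrite -[LHS]/(mfps_mul f g m) -(mfps_approxM af ag) //.
rewrite [LHS](mcoeff_poly_mul_lin _ _ (k := (mdeg m).+1)) //.
apply: eq_bigr => k le_km; rewrite af ?bmdeg // ag // ltnS.
exact: mdegB.
Qed.

Definition mfps_mono u : S := fun m => (m == u)%:R.

Lemma mfps_monoM u f m :
  (mfps_mono u * f) m = if (u <= m)%MM then f (m - u)%MM else 0.
Proof.
rewrite mfps_coefM; case: ifP => le_um.
  have lt_u : (mdeg u < (mdeg m).+1)%N.
    by rewrite ltnS -(submK le_um) mdegD leq_addl.
  rewrite (bigD1 (BMultinom lt_u)) //= /mfps_mono eqxx mul1r big1 ?addr0 //.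
  move=> k /andP[_ ne]; suff /negPf -> : val k != u by rewrite mul0r.
  by apply: contra ne => /eqP ku; apply/eqP/val_inj.
rewrite big1 // => k le_km; rewrite /mfps_mono; case: eqP => [ku|]; last by rewrite mul0r.
by rewrite -ku le_km in le_um.
Qed.

Lemma mfps_mono0 : mfps_mono 0%MM = 1.
Proof. by []. Qed.

Lemma mdeg0_lt (k : nat) : (mdeg (0%MM : 'X_{1..n}) < k.+1)%N.
Proof. by rewrite mdeg0. Qed.

Lemma mfps_constM c f m : (mfps_const c * f) m = c * f m.
Proof.
rewrite mfps_coefM (bigD1 (BMultinom (mdeg0_lt (mdeg m)))) //=.
- rewrite /mfps_const eqxx mulr1n subm0 big1 ?addr0 // => k /andP[_ ne].
  suff /negPf -> : val k != 0%MM by rewrite mulr0n mul0r.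
  by apply: contra ne => /eqP k0; apply/eqP/val_inj.
- by apply/mnm_lepP => i; rewrite mnm0E.
Qed.

Lemma mfps_constMM c d : mfps_const c * mfps_const d = mfps_const (c * d) :> S.
Proof.
by apply: funext => m; rewrite mfps_constM /mfps_const -mulrnAr.
Qed.

Lemma mfps_constD c d : mfps_const (c + d) = mfps_const c + mfps_const d :> S.
Proof. by apply: funext => m; rewrite mfps_coefD /mfps_const mulrnDl. Qed.

Lemma mfps_coefM0 f g : (f * g) 0%MM = f 0%MM * g 0%MM.
Proof.
rewrite mfps_coefM (bigD1 (BMultinom (mdeg0_lt (mdeg 0%MM)))) //=.
- rewrite subm0 big1 ?addr0 // => k /andP[le ne]; case/negP: ne.
  apply/eqP/val_inj/mnmP => i /=; apply/eqP; rewrite mnm0E -leqn0.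
  by have /mnm_lepP/(_ i) := le; rewrite mnm0E.
- exact: lepm_refl.
Qed.

Section Filtration.
Context (del : 'X_{1..n} -> nat).

(** The weight [del] is left open: it is the total degree when units are inverted, and the degree in
    all variables but the last in Weierstrass division. *)
Definition mfps_order_ge (k : nat) f : Prop := forall m, (del m < k)%N -> f m = 0.

Lemma order_geN (k : nat) f : mfps_order_ge k f -> mfps_order_ge k (- f).
Proof. by move=> hf m lt; rewrite mfps_coefN hf ?oppr0. Qed.

Lemma order_geM (j k : nat) f g : (forall a b, del (a + b)%MM = (del a + del b)%N) ->
  mfps_order_ge j f -> mfps_order_ge k g -> mfps_order_ge (j + k) (f * g).
Proof.
move=> delD hf hg m lt; rewrite mfps_coefM big1 // => i le_im.
have mE : del m = (del (m - i)%MM + del i)%N by rewrite -delD submK.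
have [lti|gei] := ltnP (del i) j; first by rewrite hf ?mul0r.
rewrite [g _]hg ?mulr0 //; rewrite mE in lt.
by rewrite -(ltn_add2r (del i)) (leq_trans lt) // addnC leq_add2l.
Qed.

(* z is the coefficientwise finite sum of the (-L)^k g. *)
Lemma contraction (L : S -> S) : {morph L : x y / x - y} ->
  (forall (k : nat) f, mfps_order_ge k f -> mfps_order_ge k.+1 (L f)) ->
  forall g, exists z, z + L z = g.
Proof.
move=> LB Lord g; pose u (k : nat) := iter k (fun h => - L h) g.
have uord (k : nat) : mfps_order_ge k (u k).
  by elim: k => [//|k IHk]; apply/order_geN/Lord.
pose z : S := fun m => \sum_(k < (del m).+1) u k m.
exists z; apply/eqP; rewrite -subr_eq0; apply/eqP/funext => m.
pose N := (del m).+1; pose s : S := \sum_(k < N) u k.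
have L0 : L 0 = 0 by rewrite -{1}(subrr 0) LB subrr.
have LN x : L (- x) = - L x by rewrite -[- x]sub0r LB L0 sub0r.
have LD x y : L (x + y) = L x + L y by rewrite -{1}[y]opprK LB LN opprK.
have Ls : s + L s = g - u N.
  have -> : L s = - \sum_(k < N) u k.+1.
    rewrite /s (big_morph L LD L0) -sumrN; apply: eq_bigr => k _.
    by rewrite /= opprK.
  rewrite /s -[LHS]sumrB.
  elim: (N) => [|j IHj]; first by rewrite big_ord0 subrr.
  by rewrite big_ord_recr IHj /= addrA subrK.
have zs : mfps_order_ge N (z - s).
  move=> m' lt; rewrite mfps_coefB /z /s mfps_coef_sum.
  rewrite (big_ord_widen N (fun k : nat => u k m')) //
    [X in _ - X](bigID (fun k : 'I_N => (k < (del m').+1)%N)) /=.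
  rewrite [X in _ - (_ + X)]big1 ?addr0 ?subrr // => k; rewrite -leqNgt => lek.
  exact: uord.
have -> : z + L z - g = (z - s) + L (z - s) - u N.
  by rewrite LB; apply: (eq_by_sub Ls); ring.
have e1 := zs m (ltnSn _); have e2 := Lord N _ zs m (leqW (ltnSn _)).
have e3 := uord N m (ltnSn _).
rewrite -[LHS]/((z - s) m + L (z - s) m - u N m).
by rewrite e1 e2 e3 addr0 subrr.
Qed.

End Filtration.

Lemma mdeg_order1 f : f 0%MM = 0 -> mfps_order_ge (@mdeg n) 1 f.
Proof. by move=> f0 m; rewrite ltnS leqn0 mdeg_eq0 => /eqP ->. Qed.

End SeriesCoefficients.

Section SeriesField.
Context {n : nat} {F : fieldType}.
Local Notation S := (mfps n F).
Implicit Types (f g h : S) (m u : 'X_{1..n}).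

(** A geometric series, since f divided by its constant term is 1 + h with h of positive order. *)
Lemma mfps_unit f : f 0%MM != 0 -> exists g, f * g = 1.
Proof.
move=> f0; pose h := mfps_const (f 0%MM)^-1 * f - 1.
have h0 : h 0%MM = 0.
  by rewrite /h mfps_coefB mfps_constM mulVf // mfps_coef1 eqxx subrr.
have [||z zE] := @contraction _ _ (@mdeg n) (fun z => h * z) _ _ 1.
- by move=> x y; rewrite mulrBr.
- move=> k z hz; rewrite -add1n; apply: order_geM => //; first exact: mdegD.
  exact: mdeg_order1.
exists (mfps_const (f 0%MM)^-1 * z); rewrite -zE /h; ring.
Qed.

Definition mfps_max f : Prop := f 0%MM = 0.

Lemma mfps_local : local_with mfps_max.
Proof.
split; last by move=> f /eqP/mfps_unit.
split=> [||f g]; first split=> // a f g; rewrite /mfps_max.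
- by rewrite mfps_coefD mfps_coefM0 => -> ->; rewrite mulr0 addr0.
- by rewrite mfps_coef1 eqxx => /eqP; rewrite oner_eq0.
by rewrite mfps_coefM0 => /eqP; rewrite mulf_eq0 => /orP[]/eqP; [left|right].
Qed.

Lemma mfps_lowest f : f != 0 -> exists m, f m != 0 /\
  mfps_order_ge (@mdeg n) (mdeg m) f.
Proof.
move=> f0; pose Q d := `[< exists m, mdeg m = d /\ f m != 0 >].
have exQ : exists d, Q d.
  apply: contrapT => nQ; move/negP: f0; apply; apply/eqP/funext => m.
  apply/eqP/negPn/negP => fm; apply: nQ; exists (mdeg m).
  by apply/asboolP; exists m.
case: (ex_minnP exQ) => d /asboolP[m [mE fm]] dmin; exists m; split=> // k lt.
apply/eqP/negPn/negP => fk; have : Q (mdeg k) by apply/asboolP; exists k.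
by move/dmin; rewrite -mE leqNgt lt.
Qed.

(* The product of the two lowest homogeneous parts does not vanish. *)
Lemma mfps_domain : domainP (A := S).
Proof.
move=> f g fg; apply: contrapT => /not_orP[/eqP f0 /eqP g0].
have [mf [fmf ordf]] := mfps_lowest f0; have [mg [gmg ordg]] := mfps_lowest g0.
set d := mdeg mf in ordf; set e := mdeg mg in ordg.
pose p := mfps_trunc d.+1 f; pose q := mfps_trunc e.+1 g.
have pE m : p@_m = if (mdeg m <= d)%N then f m else 0.
  rewrite /p; case: ifP => le; first by rewrite (mfps_truncP f).
  rewrite /mfps_trunc raddf_sum /= big1 // => k _; rewrite mcoeffZ mcoeffX.
  case: eqP => [kE|]; last by rewrite mulr0.
  by have := bmdeg k; rewrite kE ltnS le.
have qE m : q@_m = if (mdeg m <= e)%N then g m else 0.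
  rewrite /q; case: ifP => le; first by rewrite (mfps_truncP g).
  rewrite /mfps_trunc raddf_sum /= big1 // => k _; rewrite mcoeffZ mcoeffX.
  case: eqP => [kE|]; last by rewrite mulr0.
  by have := bmdeg k; rewrite kE ltnS le.
have p0 : p != 0.
  by apply/eqP => p0; have := pE mf; rewrite p0 mcoeff0 leqnn => /esym/eqP; apply/negP.
have q0 : q != 0.
  by apply/eqP => q0; have := qE mg; rewrite q0 mcoeff0 leqnn => /esym/eqP; apply/negP.
have : p * q != 0 by rewrite mulf_neq0.
move=> /eqP; apply; apply/mpolyP => m; rewrite mcoeff0.
have -> : (p * q)@_m = \sum_(k : 'X_{1..n < (mdeg m).+1} | (k <= m)%MM)
    p@_k * q@_(m - k).
  exact: (mcoeff_poly_mul_lin _ _ (k := (mdeg m).+1)).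
have [lt|] := ltnP (mdeg m) (d + e).
  apply: big1 => k le; rewrite pE qE.
  have mE : mdeg m = (mdeg (m - k)%MM + mdeg k)%N by rewrite -mdegD submK.
  have [ltk|gek] := ltnP (mdeg k) d; first by rewrite ordf // if_same mul0r.
  rewrite [g _]ordg ?if_same ?mulr0 //.
  by rewrite -(ltn_add2r (mdeg k)) -mE (leq_trans lt) // addnC leq_add2l.
rewrite leq_eqVlt => /predU1P[mE|lt].
  have fgm : (f * g) m = 0 by rewrite fg.
  rewrite -[RHS]fgm mfps_coefM; apply: eq_bigr => k le.
  have mE' : mdeg m = (mdeg (m - k)%MM + mdeg k)%N by rewrite -mdegD submK.
  rewrite pE qE; case: (ltngtP (mdeg k) d) => [ltk|gtk|kE].
  - by rewrite ordf // !mul0r.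
  - rewrite mul0r [g _]ordg ?mulr0 //; move: mE' mE gtk; clear; lia.
  suff -> : (mdeg (m - k)%MM <= e)%N by [].
  move: mE' mE kE; clear; lia.
apply: big1 => k le; rewrite pE qE.
have mE : mdeg m = (mdeg (m - k)%MM + mdeg k)%N by rewrite -mdegD submK.
case: ifP => [lek|_]; last by rewrite mul0r.
case: ifP => [lek'|_]; last by rewrite mulr0.
by exfalso; move: lt mE lek lek'; clear; lia.
Qed.

Lemma mfps_mulI f g h : f <> 0 -> f * g = f * h -> g = h.
Proof.
move=> f0 fgh; have /mfps_domain[//|/eqP] : f * (g - h) = 0.
  by rewrite mulrBr fgh subrr.
by rewrite subr_eq0 => /eqP.
Qed.

End SeriesField.

(** * Weierstrass division with respect to the last variable T *)

Section Weierstrass.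
Context {n : nat} {F : fieldType}.
Local Notation B := (mfps n F).
Local Notation S := (mfps n.+1 F).
Local Notation widen := (widen_ord (leqnSn n)).
Local Notation U := (U_(ord_max : 'I_n.+1)%MM).
Implicit Types (f g h : S) (m : 'X_{1..n.+1}).

Definition mnm_restr m : 'X_{1..n} := [multinom m (widen i) | i < n].

Lemma mnm_split m : m = (mnmwiden (mnm_restr m) + U *+ m ord_max)%MM.
Proof.
apply/mnmP => i; rewrite mnmDE mulmnE mnm1E.
have [->|ne] := eqVneq i ord_max; first by rewrite mnmwiden_ordmax mul1n.
have lti : (i < n)%N.
  by rewrite ltn_neqAle -ltnS ltn_ord andbT; apply: contra ne => /eqP E; apply/eqP/val_inj.
have -> : i = widen (Ordinal lti) by apply: val_inj.
by rewrite mnmwiden_widen mnmE mul0n addn0.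
Qed.

Lemma mnm_restrD m k : mnm_restr (m + k) = (mnm_restr m + mnm_restr k)%MM.
Proof. by apply/mnmP => i; rewrite mnmDE !mnmE. Qed.

Lemma mnm_restrU i : mnm_restr (U *+ i) = 0%MM.
Proof.
apply/mnmP => j; rewrite mnmE mnm0E mulmnE mnm1E.
by rewrite -val_eqE /= eqn_leq leqNgt ltn_ord mul0n.
Qed.

Lemma mnm_lastU i : (U *+ i)%MM ord_max = i.
Proof. by rewrite mulmnE mnm1E eqxx mul1n. Qed.

Lemma lem_lastU i m : (U *+ i <= m)%MM = (i <= m ord_max)%N.
Proof.
apply/mnm_lepP/idP => [/(_ ord_max)|le j]; first by rewrite mnm_lastU.
rewrite mulmnE mnm1E; case: (ord_max =P j) => [<-|_]; first by rewrite mul1n.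
by rewrite mul0n.
Qed.

Definition mfps_widen (f : B) : S :=
  fun m => if m ord_max == 0%N then f (mnm_restr m) else 0.

Lemma mfps_approx_widen N p (f : B) : mfps_approx N p f ->
  mfps_approx N (mwiden p) (mfps_widen f).
Proof.
move=> pf m lt_mN; rewrite /mfps_widen; case: eqP => [m0|m0].
  have mE : m = mnmwiden (mnm_restr m).
    by rewrite {1}[m]mnm_split m0 mulm0n addm0.
  rewrite {1}mE mwiden_mnmwiden pf // mdegE; move: lt_mN.
  rewrite mdegE big_ord_recr /= m0 addn0.
  by under [X in _ -> (X < _)%N]eq_bigr => i _ do rewrite mnmE.
rewrite (mwidenE (k := msize p)) // raddf_sum /= big1 // => k _.
rewrite mcoeffZ mcoeffX; case: eqP => [kE|]; last by rewrite mulr0.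
by case: m0; rewrite -kE mnmwiden_ordmax.
Qed.

Lemma mfps_widenB : zmod_morphism mfps_widen.
Proof.
move=> f g; apply: funext => m; rewrite mfps_coefB /mfps_widen.
by case: ifP => _; rewrite ?subrr.
Qed.

Lemma mfps_widenM : monoid_morphism mfps_widen.
Proof.
split=> [|f g]; apply: mfps_approx_inj => N.
  exists (mwiden 1); last first.
    by move=> m lt_mN; rewrite mwiden1 -mpolyC1 (mfps_approxC _ lt_mN).
  by apply: mfps_approx_widen => m lt_mN; rewrite -mpolyC1 (mfps_approxC _ lt_mN).
have [af ag] := (@mfps_truncP _ _ N f, @mfps_truncP _ _ N g).
exists (mwiden (mfps_trunc N f * mfps_trunc N g)).
  by apply: mfps_approx_widen; apply: mfps_approxM.
by rewrite mwidenM; apply: mfps_approxM; apply: mfps_approx_widen.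
Qed.

HB.instance Definition _ :=
  GRing.isZmodMorphism.Build B S mfps_widen mfps_widenB.
HB.instance Definition _ :=
  GRing.isMonoidMorphism.Build B S mfps_widen mfps_widenM.

Definition mfps_shift s f : S := fun m => f (m + U *+ s)%MM.
Definition mfps_slice i f : B := fun k => f (mnmwiden k + U *+ i)%MM.
Definition mfps_low s f : S := fun m => if (m ord_max < s)%N then f m else 0.

Lemma mfps_lowE s f :
  mfps_low s f = \sum_(i < s) mfps_mono (U *+ i)%MM * mfps_widen (mfps_slice i f).
Proof.
apply: funext => m; rewrite mfps_coef_sum /mfps_low.
have term i : (mfps_mono (U *+ i)%MM * mfps_widen (mfps_slice i f)) m =
    if i == m ord_max then f m else 0.
  rewrite mfps_monoM lem_lastU /mfps_widen mnmBE mnm_lastU subn_eq0.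
  case: ltngtP => // iE; rewrite /mfps_slice iE; congr f.
  rewrite [RHS]mnm_split; congr (mnmwiden _ + _)%MM.
  apply/mnmP => j; rewrite !mnmE mulmnE mnm1E.
  by rewrite -val_eqE /= eqn_leq leqNgt ltn_ord mul0n subn0.
under eq_bigr => i _ do rewrite term.
case: ifP => [lt|ge].
  rewrite (bigD1 (Ordinal lt)) //= eqxx big1 ?addr0 // => i ne.
  by case: eqP => // iE; case/eqP: ne; apply: val_inj.
by rewrite big1 // => i _; case: eqP => // iE; rewrite -iE ltn_ord in ge.
Qed.

Lemma mfps_low_shift s f : f = mfps_low s f + mfps_mono (U *+ s)%MM * mfps_shift s f.
Proof.
apply: funext => m; rewrite mfps_coefD mfps_monoM lem_lastU /mfps_low /mfps_shift.
case: ltnP => [|le]; first by rewrite addr0.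
by rewrite add0r submK // lem_lastU.
Qed.

Definition mfps_bdeg m := mdeg (mnm_restr m).

Lemma mfps_bdegD m k : mfps_bdeg (m + k) = (mfps_bdeg m + mfps_bdeg k)%N.
Proof. by rewrite /mfps_bdeg mnm_restrD mdegD. Qed.

(** Restricted to the axis of the last variable, f has order s. *)
Definition mfps_regular s f : Prop :=
  (forall i, (i < s)%N -> f (U *+ i)%MM = 0) /\ f (U *+ s)%MM != 0.

(* Modulo the terms of T-degree < s, f is a unit times T^s plus a term that
   raises the order in the remaining variables. *)
Lemma weierstrass_division s f : mfps_regular s f -> forall g,
  exists q, exists r : 'I_s -> B,
  g = q * f + \sum_(i < s) mfps_mono (U *+ i)%MM * mfps_widen (r i).
Proof.
move=> [f0 fs] g; pose u := mfps_shift s f; pose l := mfps_low s f.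
have [v uv] : exists v, u * v = 1.
  by apply: mfps_unit; rewrite /u /mfps_shift add0m.
have shB : {morph mfps_shift s : x y / x - y} by [].
(* Write f = l + T^s u with l of T-degree below s, and q = v z. Then g - q f has T-degree below s
   exactly when z + shift (l v z) = shift g, and l, having no pure power of T, raises the order in
   the other variables. *)
have [||z zE] := @contraction _ _ mfps_bdeg (fun z => mfps_shift s (l * v * z)) _ _ (mfps_shift s g).
- by move=> x y; rewrite -shB mulrBr.
- move=> k z hz m lt; rewrite /mfps_shift -mulrA.
  have lord : mfps_order_ge mfps_bdeg 1 l.
    move=> a; rewrite ltnS leqn0 mdeg_eq0 => /eqP a0.
    rewrite /l /mfps_low; case: ifP => // lta.
    rewrite [a]mnm_split a0 mnmwiden0 add0m; exact: f0.
  apply: (order_geM mfps_bdegD lord (k := k)); last first.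
    by rewrite mfps_bdegD {2}/mfps_bdeg mnm_restrU mdeg0 addn0.
  by rewrite -[k]add0n; apply: order_geM => //; apply: mfps_bdegD.
pose q := v * z; exists q, (fun i => mfps_slice i (g - q * f)).
rewrite -mfps_lowE; apply/eqP; rewrite addrC -subr_eq; apply/eqP.
rewrite {1}[g - q * f](mfps_low_shift s); apply/eqP; rewrite -subr_eq0 addrAC subrr add0r.
suff -> : mfps_shift s (g - q * f) = 0 by rewrite mulr0.
rewrite shB -zE [q * f](_ : _ = q * (mfps_low s f + mfps_mono (U *+ s)%MM * mfps_shift s f));
  last by rewrite -mfps_low_shift.
rewrite -/l -/u mulrDr.
have -> : q * l + q * (mfps_mono (U *+ s)%MM * u) = l * v * z + mfps_mono (U *+ s)%MM * z.
  rewrite /q; apply: (eq_by_sub (congr1 (fun w => mfps_mono (U *+ s)%MM * z * w) uv)).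
  by ring.
have shD x y : mfps_shift s (x + y) = mfps_shift s x + mfps_shift s y by [].
rewrite shD; have -> : mfps_shift s (mfps_mono (U *+ s)%MM * z) = z.
  by apply: funext => m; rewrite /mfps_shift mfps_monoM lem_addl addmK.
by rewrite [z + _]addrC subrr.
Qed.

End Weierstrass.

Lemma base_expansion_inj N n (a b : nat -> nat) : (forall j, a j < N)%N ->
  (forall j, b j < N)%N ->
  (\sum_(j < n) a j * N ^ j = \sum_(j < n) b j * N ^ j)%N ->
  forall j, (j < n)%N -> a j = b j.
Proof.
elim: n a b => [//|n IHn] a b aN bN; rewrite !big_ord_recl !expn0 !muln1.
have tl (c : nat -> nat) : (\sum_(i < n) c (lift ord0 i) * N ^ lift ord0 i
   = N * \sum_(i < n) c i.+1 * N ^ i)%N.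
  by rewrite big_distrr /=; apply: eq_bigr => i _; rewrite /bump add1n expnS; lia.
rewrite !tl /= => e.
have N0 : (0 < N)%N by apply: leq_trans (aN 0%N).
have a0 : a 0%N = b 0%N.
  have := congr1 (modn^~ N) e; rewrite /= ![(_ + N * _)%N]addnC ![(N * _)%N]mulnC.
  by rewrite !modnMDl !modn_small.
have := e; rewrite a0 => /addnI/eqP; rewrite eqn_pmul2l // => /eqP e'.
case=> [//|j]; rewrite ltnS => ltj.
by apply: (IHn (fun i => a i.+1) (fun i => b i.+1)).
Qed.

(** Incomparability for integral extensions, by induction on the equation: the constant term lies in
    Q because a does, and if it lies in P the factor a outside P cancels. *)
Lemma incomparable (B S : comNzRingType) (io : {rmorphism B -> S})
    (P Q : S -> Prop) (a : S) (q : {poly B}) : primeP P -> primeP Q ->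
  (forall x, P x -> Q x) -> Q a -> ~ P a -> q \is monic ->
  P (map_poly io q).[a] -> exists2 c, Q (io c) & ~ P (io c).
Proof.
move=> hP hQ PQ Qa nPa; have [idP P1 PM] := hP; have [idQ Q1 QM] := hQ.
elim/poly_ind: q => [|q c IHq] qm; first by move: qm; rewrite monicE lead_coef0 eq_sym oner_eq0.
rewrite rmorphD rmorphM /= map_polyX map_polyC hornerD hornerMX hornerC.
have [q0|q0] := eqVneq q 0.
  move: qm; rewrite q0 mul0r add0r rmorph0 horner0 mul0r add0r.
  rewrite monicE lead_coefC => /eqP c1 Pc; case: P1.
  by rewrite -(rmorph1 io) -c1.
move=> Pe; have Qc : Q (io c).
  rewrite -[io c](addrK ((map_poly io q).[a] * a)) [io c + _]addrC.
  by apply: idealB => //; [apply: PQ | apply: idealMl].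
have [Pc|] := EM (P (io c)); last by exists c.
have Pqa : P ((map_poly io q).[a] * a).
  by rewrite -[_ * a](addrK (io c)); apply: idealB.
have [Pq|//] := PM _ _ Pqa; apply: IHq => //.
move: qm; rewrite !monicE lead_coefDl ?lead_coefMX // size_polyC size_mulX //.
by rewrite ltnS (leq_trans (leq_b1 _)) // lt0n size_poly_eq0.
Qed.

Lemma horner_char_poly (B S : comNzRingType) (io : {rmorphism B -> S}) n
    (X : 'M[B]_n) (a : S) :
  (map_poly io (char_poly X)).[a] = \det (a%:M - map_mx io X).
Proof.
have cf : commr_rmorph io a by move=> x; apply: mulrC.
rewrite -[LHS]/(horner_morph cf (char_poly X)) /char_poly -det_map_mx.
congr (\det _); apply/matrixP => i j; rewrite !mxE rmorphB rmorphMn /=.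
by rewrite horner_morphX horner_morphC.
Qed.

Lemma exists_nonroot (F : fieldType) (p : {poly F}) :
  (forall k, k.+1%:R != 0 :> F) -> p != 0 -> exists t, ~~ root p t.
Proof.
move=> ch0 p0; apply: contrapT => h.
have inj : injective (fun i : nat => i%:R : F).
  have wl i j : (i < j)%N -> i%:R != j%:R :> F.
    move=> lt; rewrite eq_sym -subr_eq0 -natrB ?(ltnW lt) //.
    by rewrite -(subnSK lt); apply: ch0.
  move=> i j eij; case: (ltngtP i j) => // /wl; rewrite eij eqxx //.
have := @max_poly_roots _ p [seq i%:R | i <- iota 0 (size p)] p0.
rewrite size_map size_iota ltnn => roots.
suff /roots : all (root p) [seq i%:R | i <- iota 0 (size p)].
  by rewrite map_inj_uniq ?iota_uniq // => /(_ isT).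
apply/allP => t _; apply/negPn/negP => nt; apply: h.
by exists t.
Qed.

(** * Linear changes of variables that make a series regular *)

Section LinearChange.
Context {n : nat} {F : fieldType} (ch0 : forall k, k.+1%:R != 0 :> F).
Local Notation S := (mfps n F).

Lemma mfps_subst_invl (A : 'M[F]_n) (f : S) : A \in unitmx ->
  mfps_subst (invmx A) (mfps_subst A f) = f.
Proof. by move=> uA; rewrite -mfps_subst_comp mulVmx // mfps_subst1. Qed.

Lemma mfps_subst_invr (A : 'M[F]_n) (f : S) : A \in unitmx ->
  mfps_subst A (mfps_subst (invmx A) f) = f.
Proof. by move=> uA; rewrite -mfps_subst_comp mulmxV // mfps_subst1. Qed.
End LinearChange.

Section Regularize.
Context {n : nat} {F : fieldType} (ch0 : forall k, k.+1%:R != 0 :> F).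
Local Notation S := (mfps n.+1 F).
Local Notation U := (U_(ord_max : 'I_n.+1)%MM).

(** The coefficient of the pure power of the last variable in a form is its value at the last unit
    vector, and substitution sends that point to the last row of A. *)
Lemma coef_subst_last (A : 'M[F]_n.+1) (k : 'X_{1..n.+1}) :
  ('X_[k] \mPo linear_forms A)@_(U *+ mdeg k) = \prod_j A ord_max j ^+ k j.
Proof.
pose e (i : 'I_n.+1) : F := (i == ord_max)%:R.
have hom := linear_forms_homog A k.
transitivity (('X_[k] \mPo linear_forms A).@[e]).
  rewrite mevalE.
  have term m : ('X_[k] \mPo linear_forms A)@_m * \prod_i e i ^+ m i =
      if m == (U *+ mdeg k)%MM then ('X_[k] \mPo linear_forms A)@_(U *+ mdeg k) else 0.
    case: eqP => [->|ne].
      rewrite big1 ?mulr1 // => i _; rewrite mulmnE mnm1E /e eq_sym.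
      by case: eqP => _; rewrite ?expr1n ?mul0n ?expr0.
    have [kE|ne'] := eqVneq (mdeg m) (mdeg k); last first.
      by rewrite (dhomog_nemf_coeff hom) ?mul0r.
    have [i ine mi] : exists2 i, i != ord_max & m i != 0%N.
      apply: contrapT => h; apply: ne.
      have m0 i : i != ord_max -> m i = 0%N.
        by move=> ine; apply/eqP/negPn/negP => mi; apply: h; exists i.
      apply/mnmP => i; rewrite mulmnE mnm1E.
      case: (ord_max =P i) => [<-|/eqP ne']; last by rewrite m0 // eq_sym.
      rewrite mul1n -kE mdegE (bigD1 ord_max) //= big1 ?addn0 //.
    rewrite (bigD1 i) //= /e (negPf ine) expr0n (negPf mi) mul0r mulr0 //.
  under eq_bigr => m _ do rewrite term.
  have [inm|ninm] := boolP ((U *+ mdeg k)%MM \in msupp ('X_[k] \mPo linear_forms A)).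
    rewrite (bigD1_seq _ inm) ?msupp_uniq //= eqxx big1 ?addr0 // => m ne.
    by rewrite (negPf ne).
  rewrite memN_msupp_eq0 // big1 // => m _; exact: if_same.
rewrite comp_mpoly_meval mevalX; apply: eq_bigr => j _; congr (_ ^+ _).
rewrite tnth_mktuple raddf_sum /= (bigD1 ord_max) //= mevalZ mevalXU /e eqxx mulr1.
rewrite big1 ?addr0 // => i ne.
by rewrite mevalZ mevalXU (negPf ne) mulr0.
Qed.

(* Kronecker substitution: the lowest form of f does not vanish at
   (t, t^N, t^(N^2), ...) for a suitable t. *)
Lemma exists_regular_change (f : S) : f != 0 ->
  exists2 A : 'M[F]_n.+1, A \in unitmx & exists s, mfps_regular s (mfps_subst A f).
Proof.
move=> f0; have [m0 [fm0 ordf]] := mfps_lowest f0; set d := mdeg m0 in ordf.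
(* Exponents in a monomial of degree d are digits in base d + 1, so distinct monomials of that
   degree give distinct powers of t. *)
pose N := d.+1; pose e (k : 'X_{1..n.+1}) := (\sum_(j < n.+1) k j * N ^ j)%N.
pose p : {poly F} := \sum_(k : 'X_{1..n.+1 < d.+1}) (if mdeg k == d then f k else 0) *: 'X^(e k).
have p0 : p != 0.
  apply/eqP => p0; have := congr1 (fun q : {poly F} => q`_(e m0)) p0.
  rewrite coef0 coef_sum (bigD1 (BMultinom (ltnSn d))) //= eqxx coefZ coefXn eqxx mulr1.
  rewrite big1 ?addr0 => [/eqP|k ne]; first exact/negP.
  rewrite coefZ coefXn; case: eqP => [kE|]; last by rewrite mul0r.
  case: eqP => [E|]; last by rewrite mulr0.
  case/eqP: ne; apply: val_inj; apply/mnmP => i /=.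
  have dig (m : 'X_{1..n.+1}) : mdeg m = d -> forall j : nat, (m (inord j) < N)%N.
    move=> mE j; rewrite ltnS -mE mdegE (bigD1 (inord j)) //=; exact: leq_addr.
  have sumE (m : 'X_{1..n.+1}) : e m = (\sum_(j < n.+1) m (inord j) * N ^ j)%N.
    by apply: eq_bigr => j _; rewrite inord_val.
  rewrite !sumE in E.
  have := base_expansion_inj (dig _ kE) (dig m0 (erefl _)) (esym E) (ltn_ord i).
  by rewrite inord_val.
(* The factor 'X also excludes t = 0, as a power of t is the last diagonal entry of A. *)
have [t nt] : exists t, ~~ root (p * 'X) t.
  by apply: exists_nonroot; rewrite // mulf_neq0 // polyX_eq0.
rewrite rootM negb_or rootX in nt; have /andP[pt t0] := nt.
pose A : 'M[F]_n.+1 := \matrix_(i, j)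
  (if i == ord_max then t ^+ (N ^ j) else (i == j)%:R).
exists A.
  rewrite unitmxE det_trig; last first.
    apply/is_trig_mxP => i j lt; rewrite mxE.
    case: eqP => [im|_]; last by rewrite -val_eqE (ltn_eqF lt).
    by exfalso; move: lt (ltn_ord j); rewrite im /=; clear; lia.
  rewrite unitfE; apply/prodf_neq0 => i _; rewrite mxE eqxx.
  by case: ifP => _; rewrite ?expf_neq0 ?oner_eq0.
have degU i : mdeg (U *+ i)%MM = i by rewrite mdegMn mdeg1 mul1n.
exists d; split=> [i lt|].
  rewrite /mfps_subst big1 // => k _; rewrite ordf ?mul0r //.
  by rewrite (leq_trans (bmdeg k)) // degU.
rewrite /mfps_subst; move: pt; rewrite rootE; congr (_ != 0).
rewrite horner_sum degU; apply: eq_bigr => k _; rewrite hornerZ hornerXn.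
case: eqP => [kE|/eqP ne].
  have := coef_subst_last A k; rewrite kE => ->; congr (_ * _).
  rewrite /e expr_sum; apply: eq_bigr => j _.
  by rewrite mxE eqxx mulnC exprM.
rewrite mul0r ordf ?mul0r // ltn_neqAle ne /=.
by rewrite -ltnS bmdeg.
Qed.

End Regularize.

(** * Noetherianity and dimension of power series rings *)

Section NoetherDimension.
Context {F : fieldType} (ch0 : forall k, k.+1%:R != 0 :> F).

Lemma mfps0_unit (f : mfps 0 F) : f <> 0 -> exists g, f * g = 1.
Proof.
move=> f0; apply: mfps_unit; apply/eqP => f00; apply: f0.
apply: funext => m; suff -> : m = 0%MM by [].
by apply/mnmP => -[].
Qed.

Lemma ideal_unit (A : comNzRingType) (I : A -> Prop) f g : ideal I -> I f ->
  f * g = 1 -> forall x, I x.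
Proof.
move=> hI If fg x; rewrite -[x]mul1r -fg -mulrA; exact: idealMr.
Qed.

Lemma ideal_preim (A B : comNzRingType) (s : {rmorphism A -> B}) (I : B -> Prop) :
  ideal I -> ideal (fun x => I (s x)).
Proof.
move=> [I0 hI]; split; first by rewrite rmorph0.
by move=> a x y Ix Iy; rewrite rmorphD rmorphM; apply: hI.
Qed.

Lemma prime_preim (A B : comNzRingType) (s : {rmorphism A -> B}) (P : B -> Prop) :
  primeP P -> primeP (fun x => P (s x)).
Proof.
move=> [idP P1 PM]; split; first exact: ideal_preim.
  by rewrite rmorph1.
by move=> x y; rewrite rmorphM => /PM.
Qed.

(** Once some f in I is regular of order s, division reduces I modulo f to remainders; these form a
    submodule of the s-th power of the series ring in one variable fewer, finitely generated by
    induction. *)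
Lemma mfps_noeth n : noeth (mfps n F).
Proof.
elim: n => [|n IHn] I hI.
  have [[f [If f0]]|nI] := EM (exists f, I f /\ f <> 0).
    have [g fg] := mfps0_unit f0; have IA := ideal_unit (hI : ideal I) If fg.
    exists unit, (fun=> 1) => x; split=> // _; exists (fun=> x).
    by rewrite big_const card_unit /= addr0 [RHS]mulr1.
  exists void, (fun v : void => match v with end) => x; split.
    move=> Ix; exists (fun v : void => match v with end); rewrite big1 => [|[]//].
    by apply: contrapT => x0; apply: nI; exists x.
  by move=> [c ->]; rewrite big1 => [|[]//]; case: hI.
have [[f [If f0]]|nI] := EM (exists f, I f /\ f <> 0); last first.
  exists void, (fun v : void => match v with end) => x; split.
    move=> Ix; exists (fun v : void => match v with end); rewrite big1 => [|[]//].
    by apply: contrapT => x0; apply: nI; exists x.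
  by move=> [c ->]; rewrite big1 => [|[]//]; case: hI.
move/eqP: f0 => f0; have [A uA [s reg]] := exists_regular_change ch0 f0.
pose phi := mfps_subst A f.
pose E (r : {ffun 'I_s -> mfps n F}) : mfps n.+1 F :=
  \sum_(i < s) mfps_mono (U_(ord_max) *+ i)%MM * mfps_widen (r i).
pose I' g := I (mfps_subst (invmx A) g).
have hI' : ideal I' by apply: ideal_preim.
have I'phi : I' phi by rewrite /I' mfps_subst_invl.
have ED r r' : E (r + r') = E r + E r'.
  by rewrite /E -big_split; apply: eq_bigr => i _; rewrite ffunE rmorphD mulrDr.
pose W (r : {ffun 'I_s -> ((mfps n F)^o : lmodType (mfps n F))}) := I' (E r).
have EZ a (r : {ffun 'I_s -> ((mfps n F)^o : lmodType (mfps n F))}) :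
    E (a *: r) = mfps_widen a * E r.
  rewrite /E mulr_sumr; apply: eq_bigr => i _; rewrite ffunE /= rmorphM /=.
  by ring.
have hW : submod W.
  split=> [|a x y Wx Wy].
    rewrite /W /E big1; first by case: hI'.
    by move=> i _; rewrite ffunE rmorph0 mulr0.
  by rewrite /W ED EZ; apply: idealD => //; apply: idealMl.
have [J [rho rhoP]] := fg_noeth IHn (fgmod_ffun _ fgmod_self) hW.
pose sI := mfps_subst (invmx A).
apply: (@spanP_fg _ ((mfps n.+1 F)^o : lmodType (mfps n.+1 F)) I (J + unit)%type (fun o : J + unit =>
   if o is inl j then sI (E (rho j)) else f)) => //.
  by move=> [j|] //; apply/rhoP/span_gen.
move=> x Ix; have [q [r qE]] := weierstrass_division reg (mfps_subst A x).
have Wr : W [ffun i => r i].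
  rewrite /W; have -> : E [ffun i => r i] = mfps_subst A x - q * phi.
    rewrite qE addrC addKr; apply: eq_bigr => i _.
    by rewrite ffunE.
  apply: idealB => //; last exact: idealMl.
  by rewrite /I' mfps_subst_invl.
have [c cE] := (rhoP _).1 Wr.
have Er : E [ffun i => r i] = \sum_j mfps_widen (c j) * E (rho j).
  rewrite cE (big_morph E ED (_ : E 0 = 0)).
    by apply: eq_bigr => j _; rewrite EZ.
  by rewrite /E big1 // => i _; rewrite ffunE rmorph0 mulr0.
exists (fun o => if o is inl j then sI (mfps_widen (c j)) else sI q).
rewrite big_sumType /= addrC (big_pred1 tt) /=; last by case.
rewrite -{1}[x](mfps_subst_invl _ uA) qE -/phi.
have -> : \sum_(i < s) mfps_mono (U_(ord_max) *+ i)%MM * mfps_widen (r i) = E [ffun i => r i].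
  by apply: eq_bigr => i _; rewrite ffunE.
rewrite Er rmorphD rmorphM rmorph_sum /= [mfps_subst _ phi]mfps_subst_invl //.
congr (_ + _); apply: eq_bigr => j _.
by rewrite rmorphM.
Qed.

(** Modulo P the T^i with i < s span the ring over the series in n variables, so a is a root of the
    characteristic polynomial of its multiplication matrix. *)
Lemma regular_integral n s (phi : mfps n.+1 F) (P : mfps n.+1 F -> Prop) a :
  mfps_regular s phi -> primeP P -> P phi ->
  exists2 q : {poly mfps n F}, q \is monic & P (map_poly mfps_widen q).[a].
Proof.
move=> reg hP Pphi; have [idP P1 PM] := hP.
(* The determinant is evaluated on 1 = T^0, which requires s > 0; for s = 0 the series phi is a unit
   and P would be improper. *)
case: s reg => [|s] reg.
  have [g gE] : exists g, phi * g = 1.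
    by apply: mfps_unit; case: reg => _; rewrite mulm0n.
  by case: P1; apply: (ideal_unit idP Pphi gE).
pose T i : (mfps n.+1 F)^o := mfps_mono (U_(ord_max) *+ i)%MM.
have /choice[r rP] : forall i : 'I_s.+1, exists r : 'I_s.+1 -> mfps n F,
    P (a * T i - \sum_j mfps_widen (r j) * T j).
  move=> i; have [q [r qE]] := weierstrass_division reg (a * T i).
  exists r; rewrite qE.
  have -> : \sum_j mfps_widen (r j) * T j = \sum_(j < s.+1)
     mfps_mono (U_(ord_max) *+ j)%MM * mfps_widen (r j).
    by apply: eq_bigr => j _; rewrite mulrC.
  by rewrite addrK; apply: idealMl.
pose X := \matrix_(i, j) r i j.
exists (char_poly X); first exact: char_poly_monic.
rewrite horner_char_poly.
have := @det_trick _ _ (P : (mfps n.+1 F)^o -> Prop) _ (fun j : 'I_s.+1 => T j)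
  (a%:M - map_mx mfps_widen X) idP _ ord0.
rewrite /T /= mulm0n mfps_mono0 -[_ *: 1]/(_ * 1) mulr1; apply => i.
have -> : \sum_j (a%:M - map_mx mfps_widen X) i j *: T j =
    a * T i - \sum_j mfps_widen (r i j) * T j.
  under eq_bigr => j _ do rewrite !mxE scalerBl.
  rewrite sumrB (bigD1 i) //= eqxx big1 ?addr0 => [|j ne]; first by [].
  by rewrite eq_sym (negPf ne) scale0r.
exact: rP.
Qed.

(** After a linear change some f in P_1 outside P_0 is regular. Contracting the chain from P_1
    upwards to one variable fewer keeps it strict by [incomparable], which contradicts the induction
    hypothesis. *)
Lemma mfps_dim n : dim_le (A := mfps n F) n.
Proof.
elim: n => [|n IHn] P hP lP.
  have [sub [x P1x nP0x]] := lP 0%N isT; have [|g xg] := @mfps0_unit x.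
    by move=> x0; apply: nP0x; rewrite x0; case: (hP 0%N isT) => -[].
  have [id1 P11 _] := hP 1%N isT; apply: P11.
  exact: (ideal_unit id1 P1x xg).
have [sub [f P1f nP0f]] := lP 0%N isT.
have f0 : f != 0.
  by apply/eqP => f0; apply: nP0f; rewrite f0; case: (hP 0%N isT) => -[].
have [A uA [s reg]] := exists_regular_change ch0 f0.
pose P' i g := P i (mfps_subst (invmx A) g).
have hP' i : (i <= n.+2)%N -> primeP (P' i) by move=> lei; apply/prime_preim/hP.
have P'sub i : (i <= n.+1)%N -> forall x, P' i x -> P' i.+1 x.
  by move=> lei x; apply: (lP _ lei).1.
pose phi := mfps_subst A f.
have P'phi i : (i <= n.+1)%N -> P' i.+1 phi.
  elim: i => [_|i IHi lei]; first by rewrite /P' mfps_subst_invl.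
  by apply: P'sub => //; apply: IHi; apply: ltnW.
apply: (IHn (fun i b => P' i.+1 (mfps_widen b))) => i lei.
  by apply: prime_preim; apply: hP'.
split=> [b|]; first by apply: P'sub.
have [_ [x Px nPx]] := lP i.+1 lei.
pose a := mfps_subst A x.
have Pa : P' i.+2 a by rewrite /P' mfps_subst_invl.
have nPa : ~ P' i.+1 a by rewrite /P' mfps_subst_invl.
have [|q qm qP] := @regular_integral n s phi (P' i.+1) a reg _ (P'phi i (leqW lei)).
  by apply: hP'; apply: leqW.
apply: (@incomparable _ _ _ (P' i.+1) (P' i.+2) a q) => //.
- by apply: hP'; apply: leqW.
- exact: hP'.
exact: P'sub.
Qed.

End NoetherDimension.

(** * Regular sequences of products and of linear forms *)

Section RegularProducts.
Context {A : comNzRingType} (M : lmodType A).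

Lemma reg3_prod1 (T : Type) (r : seq T) (a : T -> A) b c :
  (forall i, reg3 M (a i) b c) -> reg3 M (\prod_(i <- r) a i) b c.
Proof.
move=> h; elim/big_rec: _ => [|i x _ hx]; first exact: reg3_unit1.
exact: reg3_mul1.
Qed.

(** The sequence through [b0] takes care of the empty product, obtained as the power of [b0] with
    exponent 0. *)
Lemma reg3_prod2 (T : Type) (r : seq T) a b0 (b : T -> A) c : reg3 M a b0 c ->
  (forall i, reg3 M a (b i) c) -> reg3 M a (\prod_(i <- r) b i) c.
Proof.
move=> h0 h; elim/big_rec: _ => [|i x _ hx]; last exact: reg3_mul2.
by rewrite -(expr0 b0) -[a]expr1 -[c]expr1; apply: reg3_expn.
Qed.

Lemma reg3_prod3 (T : Type) (r : seq T) a b c0 (c : T -> A) : reg3 M a b c0 ->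
  (forall i, reg3 M a b (c i)) -> reg3 M a b (\prod_(i <- r) c i).
Proof.
move=> h0 h; elim/big_rec: _ => [|i x _ hx]; last exact: reg3_mul3.
by rewrite -(expr0 c0) -[a]expr1 -[b]expr1; apply: reg3_expn.
Qed.

End RegularProducts.

Section GenericVectors.
Context {F : fieldType} (ch0 : forall k, k.+1%:R != 0 :> F).

(** Each proper subspace lies in a hyperplane, which pulls back to a nonzero polynomial on the curve
    (1, t, t^2, ...); a common nonroot t exists because the field is infinite. *)
Lemma avoid_subspaces n (T : finType) (m : T -> nat) (B : forall k, 'M[F]_(m k, n)) :
  (forall k, (\rank (B k) < n)%N) -> exists v : 'rV[F]_n, forall k, ~~ (v <= B k)%MS.
Proof.
move=> rB.
have /choice[c cP] : forall k, exists c : 'cV[F]_n, c != 0 /\ B k *m c = 0.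
  move=> k; have : cokermx (B k) != 0.
    by rewrite -mxrank_eq0 mxrank_coker subn_eq0 -ltnNge.
  move=> /eqP/matrixP ne; apply: contrapT => h; apply: ne => i j.
  have [c0|c0] := eqVneq (col j (cokermx (B k))) 0.
    by have /matrixP/(_ i 0) := c0; rewrite !mxE.
  case: h; exists (col j (cokermx (B k))); split=> //.
  by rewrite colE mulmxA mulmx_coker mul0mx.
pose p (k : T) : {poly F} := \poly_(i < n) (if insub i is Some j then c k j 0 else 0).
have p0 k : p k != 0.
  have [ck _] := cP k; apply: contraNneq ck => pk; apply/eqP/matrixP => i j.
  have := congr1 (fun q : {poly F} => q`_i) pk.
  by rewrite coef_poly ltn_ord coef0 ord1 mxE valK.
have [t nt] : exists t, ~~ root (\prod_k p k) t.
  by apply: exists_nonroot => //; apply/prodf_neq0.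
exists (\row_j t ^+ j) => k; apply/negP => /submxP[D vE].
have := congr1 (mulmx^~ (c k)) vE; rewrite /= -mulmxA (cP k).2 mulmx0.
move=> /matrixP/(_ 0 0); rewrite !mxE => e.
move/negP: nt; apply; rewrite (bigD1 k) //= rootM rootE horner_poly.
apply/orP; left; apply/eqP; rewrite -[RHS]e; apply: eq_bigr => i _.
by rewrite mxE valK mulrC.
Qed.

Lemma rows3_unit (r1 r2 r3 : 'rV[F]_3) : r1 != 0 -> ~~ (r2 <= r1)%MS ->
  ~~ (r3 <= col_mx r1 r2)%MS -> \matrix_(i < 3) nth 0 [:: r1; r2; r3] i \in unitmx.
Proof.
move=> n1 n2 n3; set A := \matrix_i _.
have rk1 : (0 < \rank r1)%N by rewrite lt0n mxrank_eq0.
have rk2 : (\rank r1 < \rank (col_mx r1 r2))%N.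
  rewrite ltn_neqAle mxrankS ?andbT -?addsmxE ?addsmxSl //.
  apply: contra n2 => /eqP e; apply: submx_trans (addsmxSr r1 r2) _.
  by rewrite -(geq_leqif (mxrank_leqif_sup (addsmxSl r1 r2))) -e.
have rk3 : (\rank (col_mx r1 r2) < \rank (col_mx (col_mx r1 r2) r3))%N.
  rewrite ltn_neqAle mxrankS ?andbT; last first.
    by have := addsmxSl (col_mx r1 r2) r3; rewrite addsmxE.
  apply: contra n3 => /eqP e; apply: submx_trans (addsmxSr (col_mx r1 r2) r3) _.
  by rewrite -(geq_leqif (mxrank_leqif_sup (addsmxSl (col_mx r1 r2) r3))) addsmxE -e.
have rowA (i : 'I_3) : (nth 0 [:: r1; r2; r3] i <= A)%MS.
  by rewrite -[X in (X <= _)%MS](rowK (fun i : 'I_3 => nth 0 [:: r1; r2; r3] i) i); apply: row_sub.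
rewrite -row_free_unit -row_leq_rank.
apply: (@leq_trans (\rank (col_mx (col_mx r1 r2) r3))).
  by move: rk1 rk2 rk3; lia.
apply: mxrankS; rewrite !col_mx_sub.
by rewrite (rowA 0) (rowA (@Ordinal 3 1 isT)) (rowA (@Ordinal 3 2 isT)).
Qed.

End GenericVectors.

Section Variables.
Context {n : nat} {F : fieldType}.
Local Notation S := (mfps n F).
Implicit Types (f g h : S) (m : 'X_{1..n}) (i j k : 'I_n).

Definition mfps_var i : S := mfps_mono U_(i)%MM.

Lemma mfps_varM i f m : (mfps_var i * f) m = if m i != 0%N then f (m - U_(i))%MM else 0.
Proof. by rewrite mfps_monoM lep1mP. Qed.

Lemma mfps_var_dvd i f : (forall m, m i = 0%N -> f m = 0) ->
  f = mfps_var i * (fun m => f (m + U_(i))%MM : F).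
Proof.
move=> f0; apply: funext => m; rewrite mfps_varM; case: eqP => [/f0//|/eqP mi].
by rewrite submK // lep1mP.
Qed.

Lemma mfps_var_neq0 i : mfps_var i <> 0.
Proof.
move=> /(congr1 (fun f : S => f U_(i)%MM)); rewrite /mfps_var /mfps_mono eqxx.
by move/eqP; rewrite oner_eq0.
Qed.

Lemma mfps_var_cancel i f m : (mfps_var i * f) (m + U_(i))%MM = f m.
Proof. by rewrite mfps_varM mnmDE mnm1E eqxx addn1 addmK. Qed.

Lemma mfps_var_reg2 i j f g : i != j -> mfps_var j * f = mfps_var i * g ->
  exists h, f = mfps_var i * h.
Proof.
move=> ij fg; exists (fun m => f (m + U_(i))%MM); apply: mfps_var_dvd => m mi.
by rewrite -(mfps_var_cancel j) fg mfps_varM mnmDE mi mnm1E [j == i]eq_sym (negPf ij).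
Qed.

Lemma mfps_var_split2 i j f : (forall m, m i = 0%N -> m j = 0%N -> f m = 0) ->
  exists g h, f = mfps_var i * g + mfps_var j * h.
Proof.
move=> f0; pose f1 : S := fun m => if m i == 0%N then 0 else f m.
have h1 : f1 = mfps_var i * (fun m => f1 (m + U_(i))%MM).
  by apply: mfps_var_dvd => m mi; rewrite /f1 mi.
have h2 : f - f1 = mfps_var j * (fun m => (f - f1) (m + U_(j))%MM).
  apply: mfps_var_dvd => m mj; rewrite mfps_coefB /f1.
  by case: eqP => [mi|_]; rewrite ?subrr // f0 ?subr0.
exists (fun m => f1 (m + U_(i))%MM), (fun m => (f - f1) (m + U_(j))%MM).
by rewrite -h1 -h2 addrC subrK.
Qed.

Lemma mfps_var_reg3 i j k : i != j -> i != k -> j != k ->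
  reg3 (S^o : lmodType S) (mfps_var i) (mfps_var j) (mfps_var k).
Proof.
move=> ij ik jk; split=> [f|f g fg|f g h fgh].
- by move=> /mfps_domain[/mfps_var_neq0|].
- have [w wE] := mfps_var_reg2 ij (fg : mfps_var j * (f : S) = mfps_var i * (g : S)).
  by exists w.
apply: mfps_var_split2 => m mi mj.
rewrite -(mfps_var_cancel k) -[_ * _]/(mfps_var k *: (f : S^o)) fgh.
rewrite -[_ + _]/(mfps_var i * g + mfps_var j * h) mfps_coefD !mfps_varM.
by rewrite !mnmDE mi mj !mnm1E [k == i]eq_sym (negPf ik) [k == j]eq_sym (negPf jk) /= addr0.
Qed.

Lemma mfps_approx_var N i : mfps_approx N 'X_i (mfps_var i).
Proof. by move=> m _; rewrite mcoeffX /mfps_var /mfps_mono eq_sym. Qed.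

Definition linear_form (v : 'I_n -> F) : S := \sum_i mfps_const (v i) * mfps_var i.

Lemma mfps_subst_var (A : 'M[F]_n) j :
  mfps_subst A (mfps_var j) = linear_form (fun i => A i j).
Proof.
apply: mfps_approx_inj => N; exists ('X_j \mPo linear_forms A).
  exact/mfps_approx_subst/mfps_approx_var.
rewrite comp_mpolyXU -tnth_nth tnth_mktuple /linear_form.
apply: (big_rec2 (fun p f => mfps_approx N p f)) => [m _|i p f _ pf].
  by rewrite mcoeff0.
apply: mfps_approxD => //; rewrite -mul_mpolyC; apply: mfps_approxM.
  exact: mfps_approxC.
exact: mfps_approx_var.
Qed.

Lemma linear_form_max v : mfps_max (linear_form v).
Proof.
rewrite /mfps_max /linear_form mfps_coef_sum big1 // => i _.
rewrite mfps_coefM0 /mfps_var /mfps_mono eq_sym.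
by rewrite -mdeg_eq0 mdeg1 mulr0.
Qed.

Lemma linear_formB v w : linear_form v - linear_form w = linear_form (fun i => v i - w i).
Proof.
rewrite /linear_form -sumrB; apply: eq_bigr => i _.
rewrite -mulrBl mfps_constD -[mfps_const (- _)]/(_) -?mfps_constN; congr (_ * _).
by apply: funext => m; rewrite mfps_coefB mfps_coefD /mfps_const mulNrn.
Qed.

Lemma reg3_transport (A : 'M[F]_n) (a b c : S) : A \in unitmx ->
  reg3 (S^o : lmodType S) a b c ->
  reg3 (S^o : lmodType S) (mfps_subst A a) (mfps_subst A b) (mfps_subst A c).
Proof.
move=> uA [h1 h2 h3].
pose s := mfps_subst A : S -> S; pose t := mfps_subst (invmx A) : S -> S.
have st f : s (t f) = f by apply: mfps_subst_invr.
have ts f : t (s f) = f by apply: mfps_subst_invl.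
have sM f g : s (f * g) = s f * s g by rewrite /s rmorphM.
have tM f g : t (f * g) = t f * t g by rewrite /t rmorphM.
have tD f g : t (f + g) = t f + t g by rewrite /t rmorphD.
have sD f g : s (f + g) = s f + s g by rewrite /s rmorphD.
split=> [f|f g|f g h].
- move=> /(congr1 t); rewrite tM ts => e; have e0 : a *: (t f : S^o) = 0.
    by rewrite -[LHS]/(a * t f) e /t rmorph0.
  by rewrite -[f]st (h1 _ e0) /s rmorph0.
- move=> /(congr1 t); rewrite !tM !ts => /h2[w wE]; exists (s w).
  by rewrite -[f]st wE -[RHS]sM.
move=> /(congr1 t); rewrite tD !tM !ts => /h3[v [w wE]]; exists (s v), (s w).
by rewrite -[f]st wE [LHS]sD !sM.
Qed.

End Variables.

Section LinearForms3.
Context {F : fieldType} (ch0 : forall k, k.+1%:R != 0 :> F).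
Local Notation S := (mfps 3 F).

Definition row_form (v : 'rV[F]_3) : S := linear_form (fun i => v 0 i).

(** An invertible substitution carries the variables to the three forms; the transpose appears
    because [mfps_subst] reads images of variables in columns. *)
Lemma row_form_reg3 (r1 r2 r3 : 'rV[F]_3) : r1 != 0 -> ~~ (r2 <= r1)%MS ->
  ~~ (r3 <= col_mx r1 r2)%MS ->
  reg3 (S^o : lmodType S) (row_form r1) (row_form r2) (row_form r3).
Proof.
move=> n1 n2 n3; have uA := rows3_unit n1 n2 n3; set A := \matrix_i _ in uA.
have form (i : 'I_3) : row_form (nth 0 [:: r1; r2; r3] i) = mfps_subst A^T (mfps_var i).
  rewrite mfps_subst_var /row_form; congr linear_form; apply: funext => j.
  by rewrite !mxE.
have := form 0; have := form (@Ordinal 3 1 isT); have := form (@Ordinal 3 2 isT).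
move=> /= -> -> ->; apply: reg3_transport; first by rewrite unitmx_tr.
exact: mfps_var_reg3.
Qed.

Lemma row_form_reg2 (r1 r2 : 'rV[F]_3) (f g : S) : r1 != 0 -> ~~ (r2 <= r1)%MS ->
  row_form r2 * f = row_form r1 * g -> exists h, f = row_form r1 * h.
Proof.
move=> n1 n2 e.
have [|r3 n3] := avoid_subspaces ch0 (T := unit) (B := fun=> col_mx r1 r2).
  by move=> _; apply: leq_ltn_trans (rank_leq_row _) _.
have [_ h2 _] := row_form_reg3 n1 n2 (n3 tt).
exact: h2 e.
Qed.

Lemma maximal_ideal_vars (f : S) : mfps_max f -> exists g : 'I_3 -> S,
  f = \sum_i mfps_var i * g i.
Proof.
move=> f0; pose f1 : S := fun m => if m ord0 == 0%N then 0 else f m.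
have h1 : f1 = mfps_var ord0 * (fun m => f1 (m + U_(ord0))%MM : F).
  by apply: mfps_var_dvd => m mi; rewrite /f1 mi.
have [|g [h ghE]] := @mfps_var_split2 3 F (lift ord0 ord0) (lift ord0 (lift ord0 ord0)) (f - f1).
  move=> m m1 m2; rewrite mfps_coefB /f1; case: eqP => [m0|_]; last by rewrite subrr.
  rewrite subr0; suff -> : m = 0%MM by [].
  apply/mnmP => i; rewrite mnm0E.
  case: i => -[|[|[|//]]] lt.
  + by rewrite -[RHS]m0; congr (m _); apply: val_inj.
  + by rewrite -[RHS]m1; congr (m _); apply: val_inj.
  + by rewrite -[RHS]m2; congr (m _); apply: val_inj.
exists (fun i => if i == ord0 then (fun m => f1 (m + U_(ord0))%MM)
  else if i == lift ord0 ord0 then g else h).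
by rewrite !big_ord_recl big_ord0 addr0 /= -h1 -ghE addrC subrK.
Qed.

End LinearForms3.

(** * Invariant rings *)

Section Invariants.
Context {n : nat} {F : fieldType} (ch0 : forall k, k.+1%:R != 0 :> F).
Context (G : finGLsubgroup n F).
Local Notation S := (mfps n F).
Local Notation R := (invariant_ring G).
Local Notation SR := (mfps_module G : lmodType R).
Local Notation vR := (@invariant_val n F G).
Implicit Types (g h : G) (s t : S) (r : R).

Definition gl_inv g : G := FSetSub (gl_inv_closed (fsvalP g)).

Lemma gl_mulVg g : gl_mul (gl_inv g) g = gl_one G.
Proof. by apply: val_inj; apply: mulVmx; apply: (gl_unitmx (fsvalP g)). Qed.
Lemma gl_mulgV g : gl_mul g (gl_inv g) = gl_one G.
Proof. by apply: val_inj; apply: mulmxV; apply: (gl_unitmx (fsvalP g)). Qed.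
Lemma gl_mulKg g : cancel (gl_mul g) (gl_mul (gl_inv g)).
Proof. by move=> h; rewrite gl_mulA gl_mulVg gl_mul1g. Qed.
Lemma gl_mulgK h : cancel (fun g => gl_mul g h) (fun g => gl_mul g (gl_inv h)).
Proof. by move=> g; rewrite /= -gl_mulA gl_mulgV gl_mulg1. Qed.
Lemma gl_actK g : cancel (gl_act g) (gl_act (gl_inv g)).
Proof. by move=> s; rewrite -gl_actM gl_mulVg gl_act1. Qed.
Lemma gl_actVK g : cancel (gl_act (gl_inv g)) (gl_act g).
Proof. by move=> s; rewrite -gl_actM gl_mulgV gl_act1. Qed.

Lemma gl_act_const g c : gl_act g (mfps_const c) = mfps_const c.
Proof.
apply: mfps_approx_inj => N; exists c%:MP; last exact: mfps_approxC.
rewrite -(comp_mpolyC c (linear_forms (val g))).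
exact/mfps_approx_subst/mfps_approxC.
Qed.

Lemma vRM r r' : vR (r * r') = vR r * vR r'. Proof. by []. Qed.
Lemma vRD r r' : vR (r + r') = vR r + vR r'. Proof. by []. Qed.
Lemma vRN r : vR (- r) = - vR r. Proof. by []. Qed.
Lemma vR0 : vR 0 = 0. Proof. by []. Qed.
Lemma vR1 : vR 1 = 1. Proof. by []. Qed.
Lemma vR_inj : injective vR. Proof. exact: val_inj. Qed.
Lemma vR_act r g : gl_act g (vR r) = vR r.
Proof. by case: r => s /= si; have /asboolP := si; apply. Qed.
Lemma SR_scale r (s : SR) : r *: s = (vR r * s : S). Proof. by []. Qed.

Lemma invariantP s : (forall g, gl_act g s = s) -> s \in invariant G.
Proof. by move=> h; apply/asboolP. Qed.

Definition trace s : S := \sum_(g : G) gl_act g s.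
Definition norm s : S := \prod_(g : G) gl_act g s.

Lemma trace_act h s : trace (gl_act h s) = trace s.
Proof.
rewrite /trace [RHS](reindex_inj (can_inj (gl_mulgK h))) /=.
by apply: eq_bigr => g _; rewrite gl_actM.
Qed.

Lemma trace_inv s : trace s \in invariant G.
Proof.
apply: invariantP => h; rewrite /trace rmorph_sum [RHS](reindex_inj (can_inj (gl_mulKg h))) /=.
by apply: eq_bigr => g _; rewrite gl_actM.
Qed.

Lemma norm_inv s : norm s \in invariant G.
Proof.
apply: invariantP => h; rewrite /norm rmorph_prod [RHS](reindex_inj (can_inj (gl_mulKg h))) /=.
by apply: eq_bigr => g _; rewrite gl_actM.
Qed.

Definition trR s : R := InvariantRing (trace_inv s).
Definition nmR s : R := InvariantRing (norm_inv s).
Definition inv_card : S := mfps_const (#|` G|%:R^-1).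

Lemma card_neq0 : #|` G|%:R != 0 :> F.
Proof.
have : (0 < #|` G|)%N by rewrite cardfs_gt0; apply/fset0Pn; exists 1%:M; apply: gl_one_closed.
by case: #|` G| => // k _; apply: ch0.
Qed.

Lemma inv_card_mul (s : S) : inv_card * (s *+ #|` G|) = s.
Proof.
apply: funext => m; rewrite mfps_constM.
have -> : (s *+ #|` G|) m = s m *+ #|` G|.
  by elim: #|` G| => [|k IHk]; rewrite ?mulr0n // !mulrS mfps_coefD IHk.
by rewrite -[s m *+ _]mulr_natl mulrA mulVf ?mul1r // card_neq0.
Qed.

Lemma inv_card_inv : inv_card \in invariant G.
Proof. by apply: invariantP => g; apply: gl_act_const. Qed.

Definition reyn s : R := InvariantRing inv_card_inv * trR s.

Lemma trace_invariant r s : trace (vR r * s) = vR r * trace s.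
Proof.
by rewrite /trace mulr_sumr; apply: eq_bigr => g _; rewrite rmorphM /= vR_act.
Qed.

Lemma traceD s t : trace (s + t) = trace s + trace t.
Proof. by rewrite /trace -big_split; apply: eq_bigr => g _; rewrite rmorphD. Qed.

Lemma trace1 : trace 1 = 1 *+ #|` G|.
Proof.
rewrite /trace; under eq_bigr => g _ do rewrite rmorph1.
by rewrite big_const iter_addr_0 cardfE.
Qed.

Lemma reynM r s : reyn (vR r * s) = r * reyn s.
Proof. by apply: vR_inj; rewrite /reyn !vRM /= trace_invariant mulrCA. Qed.

Lemma reynD s t : reyn (s + t) = reyn s + reyn t.
Proof. by apply: vR_inj; rewrite vRD /reyn !vRM /= traceD mulrDr. Qed.

Lemma reyn_act h s : reyn (gl_act h s) = reyn s.
Proof. by apply: vR_inj; rewrite /reyn !vRM /= trace_act. Qed.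

Lemma reyn_id r : reyn (vR r) = r.
Proof.
rewrite -[vR r]mulr1 reynM -[RHS]mulr1; congr (_ * _).
by apply: vR_inj; rewrite /reyn vRM /= trace1 inv_card_mul.
Qed.

Lemma reyn0 : reyn 0 = 0.
Proof. by rewrite -vR0 reyn_id. Qed.

Lemma reyn_sum (T : Type) (l : seq T) (E : T -> S) :
  reyn (\sum_(i <- l) E i) = \sum_(i <- l) reyn (E i).
Proof. exact: (big_morph reyn reynD reyn0). Qed.

Definition maxR r : Prop := mfps_max (vR r).

Lemma inv_local : local_with maxR.
Proof.
have [[[m0 mD] m1 mM] mU] := @mfps_local n F.
split.
  split=> [|//|r r']; last exact: mM.
  by split=> // a x y; apply: mD.
move=> r /mU[s rs].
have sinv : s \in invariant G.
  apply: invariantP => g.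
  have e : vR r * gl_act g s = 1 by rewrite -{1}(vR_act r g) -rmorphM rs rmorph1.
  by rewrite -[LHS]mulr1 -rs mulrCA mulrA e mul1r.
by exists (InvariantRing sinv); apply: vR_inj.
Qed.

Lemma inv_domain : domainP (A := R).
Proof.
move=> r r' e; have : vR r * vR r' = 0 by rewrite -vRM e.
by move=> /mfps_domain[] h; [left|right]; apply: vR_inj.
Qed.

Lemma SR_torsion_free : torsion_free SR.
Proof.
by move=> r s /(@mfps_domain n F)[h|]; [left; apply: vR_inj | right].
Qed.

(* Hilbert's argument: I S is generated by finitely many elements of I, and the
   Reynolds operator brings the coefficients back to R. *)
Lemma inv_noeth : noeth R.
Proof.
move=> I hI; pose Sp (l : seq R) (s : S) := forall J : S -> Prop, ideal J ->
  (forall x, x \in l -> J (vR x)) -> J s.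
have Spsub l l' s : {subset l <= l'} -> Sp l s -> Sp l' s.
  by move=> ll' h J hJ Jl'; apply: h => // x /ll'/Jl'.
have Spid l : ideal (Sp l).
  by split=> [J [J0 _]|a x y Sx Sy J hJ Jl] //; apply: hJ.2; [apply: Sx | apply: Sy].
pose J s := exists l : seq R, (forall x, x \in l -> I x) /\ Sp l s.
have hJ : ideal J.
  split; first by exists [::]; split=> //; case: (Spid [::]).
  move=> a x y [l [lI lx]] [l' [l'I l'y]]; exists (l ++ l'); split.
    by move=> z; rewrite mem_cat => /orP[/lI|/l'I].
  apply: (Spid _).2; first by apply: Spsub lx => z; rewrite mem_cat => ->.
  by apply: Spsub l'y => z; rewrite mem_cat orbC => ->.
have [T [b bP]] := mfps_noeth ch0 (ideal_submod hJ).
have /choice[l lP] : forall i, J (b i) by move=> i; apply/bP/span_gen.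
pose L := flatten [seq l i | i <- enum T].
have LI x : x \in L -> I x.
  by move=> /flatten_mapP[i _]; case: (lP i) => h _; apply: h.
have SpL i : Sp L (b i).
  apply: Spsub (lP i).2 => x xl; apply/flatten_mapP; exists i => //.
  by rewrite mem_enum.
apply: (@spanP_fg _ (R^o : lmodType R) I 'I_(size L) (fun k => L`_k)) => //.
  by move=> k; apply/LI/mem_nth.
move=> r Ir; have Jr : J (vR r).
  by exists [:: r]; split=> [x|K hK Kr]; [rewrite inE => /eqP -> | apply: Kr; rewrite inE].
have SpLr : Sp L (vR r).
  move/bP: Jr => [c ->]; apply: ideal_sum; first exact: Spid.
  by move=> i; apply: (idealMl (c i) (Spid L) (SpL i)).
have [] := SpLr (span (M := (S^o : lmodType S)) (fun k : 'I_(size L) => vR L`_k)).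
- exact: span_submod.
- move=> x xL; have lt : (index x L < size L)%N by rewrite index_mem.
  by have := span_gen (M := (S^o : lmodType S)) (fun k : 'I_(size L) => vR L`_k) (Ordinal lt);
    rewrite /= nth_index.
move=> c cE; exists (fun k => reyn (c k)).
rewrite -[r]reyn_id cE reyn_sum; apply: eq_bigr => k _.
by rewrite -[c k *: _]/(c k * vR L`_k) mulrC reynM mulrC.
Qed.

(** Galois coordinates of S over R up to the factor d: they recover d s as \sum_j u_j tr(v_j s). *)
Definition dual_family (d : S) : Prop := exists (T : finType) (u v : T -> S),
  forall g, \sum_j u j * gl_act g (v j) = if g == gl_one G then d else 0.

(* The image of \prod_g (g y_g (x) 1 - 1 (x) y_g) in \prod_g S, where S (x) S acts
   through (u (x) v)_g = u (g v). *)
Lemma dual_family_prod (y : G -> S) :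
  dual_family (\prod_(g | g != gl_one G) (gl_act g (y g) - y g)).
Proof.
have step (l : seq G) : exists (T : finType) (u v : T -> S),
    \sum_j u j * v j = \prod_(g <- l) (gl_act g (y g) - y g) /\
    forall g, g \in l -> \sum_j u j * gl_act g (v j) = 0.
  elim: l => [|h l [T [u [v [uv1 uvl]]]]].
    exists unit, (fun=> 1), (fun=> 1); split=> //.
    by rewrite big_nil (big_pred1 tt) ?mulr1 // => -[].
  exists (T + T)%type.
  exists (fun k => match k with inl j => u j * gl_act h (y h) | inr j => - u j end).
  exists (fun k => match k with inl j => v j | inr j => v j * y h end).
  split.
    rewrite big_sumType big_cons /= -uv1 mulrBl !mulr_sumr -sumrN.
    congr (_ + _); apply: eq_bigr => j _; by ring.
  move=> g; rewrite inE big_sumType /= => hg.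
  have -> : \sum_i u i * gl_act h (y h) * gl_act g (v i) +
      \sum_i - u i * gl_act g (v i * y h) =
      (gl_act h (y h) - gl_act g (y h)) * \sum_i u i * gl_act g (v i).
    rewrite mulrBl !mulr_sumr -sumrN; congr (_ + _); apply: eq_bigr => j _.
      by ring.
    by rewrite rmorphM /=; ring.
  case/orP: hg => [/eqP ->|/uvl ->]; first by rewrite subrr mul0r.
  by rewrite mulr0.
have [T [u [v [uv1 uvl]]]] := step (enum [pred g | g != gl_one G]).
exists T, u, v => g; case: eqP => [->|ne].
  transitivity (\sum_j u j * v j); last by rewrite uv1 big_enum.
  by apply: eq_bigr => j _; rewrite gl_act1.
by apply: uvl; rewrite mem_enum inE; apply/eqP.
Qed.

Lemma linear_form_coef (v : 'I_n -> F) i : linear_form v U_(i)%MM = v i.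
Proof.
rewrite /linear_form mfps_coef_sum (bigD1 i) //= mfps_constM /mfps_var /mfps_mono.
rewrite eqxx mulr1 big1 ?addr0 // => j ne.
by rewrite mfps_constM eq_mnm1 eq_sym (negPf ne) mulr0.
Qed.

Lemma gl_act_var_sub g j : gl_act g (mfps_var j) - mfps_var j =
  linear_form (fun i => (val g - 1%:M) i j).
Proof.
rewrite /gl_act mfps_subst_var -[mfps_var j in LHS]mfps_subst1 mfps_subst_var.
by rewrite linear_formB; congr linear_form; apply: funext => i; rewrite !mxE.
Qed.

Lemma exists_dual_family : exists2 d, d <> 0 & dual_family d.
Proof.
have /choice[j jP] : forall g : G, exists j : option 'I_n, g != gl_one G ->
    if j is Some i then gl_act g (mfps_var i) - mfps_var i <> 0 else False.
  move=> g; have [->|ne] := eqVneq g (gl_one G); first by exists None.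
  have : val g - 1%:M != 0.
    by rewrite subr_eq0; apply: contra ne => /eqP e; apply/eqP/val_inj.
  move=> /eqP/matrixP h; apply: contrapT => h'; apply: h => a b.
  apply: contrapT => ab; apply: h'; exists (Some b) => _.
  rewrite gl_act_var_sub => e; apply: ab; rewrite [RHS]mxE.
  by have := linear_form_coef (fun i => (val g - 1%:M) i b) a; rewrite e => <-.
exists (\prod_(g | g != gl_one G)
  (gl_act g (if j g is Some i then mfps_var i else 0) - (if j g is Some i then mfps_var i else 0))).
  elim/big_ind: _ => [||g ne]; first by move/eqP; rewrite oner_eq0.
    by move=> x y x0 y0 /mfps_domain[].
  by have := jP g ne; case: (j g).
exact: dual_family_prod.
Qed.

(** The traces tr(v_j s) determine d s, hence s; this embeds S in a finite power of the noetherian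
    ring R. *)
Lemma SR_fgmod : fgmod SR.
Proof.
have [d d0 [T [u [v uv]]]] := exists_dual_family.
have recon s : d * s = \sum_j u j * trace (v j * s).
  rewrite /trace; under eq_bigr => j _ do rewrite mulr_sumr.
  rewrite exchange_big /= (bigD1 (gl_one G)) //= [X in _ + X]big1 ?addr0.
    have := uv (gl_one G); rewrite eqxx => <-; rewrite mulr_suml.
    by apply: eq_bigr => j _; rewrite !gl_act1 mulrA.
  move=> g ne; have := uv g; rewrite (negPf ne) => e.
  under eq_bigr => j _ do rewrite rmorphM mulrA.
  by rewrite -mulr_suml e mul0r.
pose phi (s : S) : {ffun T -> (R^o : lmodType R)} := [ffun j => trR (v j * s)].
have phiL r s t : phi (vR r * s + t) = r *: phi s + phi t.
  apply/ffunP => j; rewrite !ffunE; apply: vR_inj => /=.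
  by rewrite mulrDr traceD mulrCA trace_invariant.
pose W (w : {ffun T -> (R^o : lmodType R)}) := exists s, w = phi s.
have hW : submod W.
  split; first by exists 0; apply/ffunP => j; rewrite !ffunE; apply: vR_inj;
    rewrite /= mulr0 /trace big1 // => g _; rewrite rmorph0.
  by move=> r _ _ [s ->] [t ->]; exists (vR r * s + t); rewrite phiL.
have [J [w wP]] := fg_noeth inv_noeth (fgmod_ffun _ fgmod_self) hW.
have /choice[b bP] : forall j, W (w j) by move=> j; apply/wP/span_gen.
exists J, (b : J -> SR) => s; have [c cE] : span w (phi s) by apply/wP; exists s.
exists c; apply/eqP; rewrite -subr_eq0; apply/eqP.
set e := (X in s - X); have phie : phi e = phi s.
  rewrite cE /e; apply: (big_rec2 (fun (x : SR) y => phi x = y)).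
    by apply/ffunP => j; rewrite !ffunE; apply: vR_inj;
      rewrite /= mulr0 /trace big1 // => g _; rewrite rmorph0.
  by move=> j x y _ <-; rewrite [LHS]phiL bP.
apply: (mfps_mulI d0); rewrite mulr0 recon big1 // => j _.
have -> : trace (v j * (s - e)) = 0; last by rewrite mulr0.
have -> : v j * (s - e) = v j * s + (vR (- 1)) * (v j * e) by rewrite vRN vR1; ring.
rewrite traceD trace_invariant vRN vR1 mulN1r.
have /ffunP/(_ j) := phie; rewrite !ffunE => /(congr1 vR) /= ->.
by rewrite subrr.
Qed.

(** This ideal is stable under G and meets R in p, because the Reynolds operator fixes R; it
    replaces pS in the going-up argument. *)
Lemma reyn_ideal (p : R -> Prop) : ideal p -> ideal (fun s => forall t, p (reyn (t * s))).
Proof.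
move=> hp; split=> [t|a x y px py t]; first by rewrite mulr0 reyn0; case: hp.
by rewrite mulrDr mulrA reynD; apply: idealD.
Qed.

(** A prime containing Q + K and avoiding R outside p is sought. If r = q + k is invariant, its norm
    is a power of r and congruent to the norm of q modulo K; the latter is an invariant in Q, hence
    in p, and so r lies in p. *)
Lemma inv_going_up (Q : S -> Prop) (p : R -> Prop) : ideal Q -> primeP p ->
  (forall r, Q (vR r) -> p r) ->
  exists Q', [/\ primeP Q', forall s, Q s -> Q' s & forall r, Q' (vR r) <-> p r].
Proof.
move=> hQ hp Qp; have [idp p1 pM] := hp.
pose K s := forall t, p (reyn (t * s)).
have hK : ideal K by apply: reyn_ideal.
have KR r : p r -> K (vR r).
  by move=> pr t; rewrite mulrC reynM; apply: idealMr.
have RK r : K (vR r) -> p r by move=> /(_ 1); rewrite mul1r reyn_id.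
have Kact g s : K s -> K (gl_act g s).
  move=> Ks t; rewrite -[t](gl_actVK g) -rmorphM reyn_act; exact: Ks.
pose I s := exists q k, [/\ Q q, K k & s = q + k].
have [||||Q' [hQ' IQ' Q'W]] := @prime_avoid _ I (fun s => exists2 r, ~ p r & s = vR r)
   (mfps_noeth ch0 (n := n)).
- split; first by exists 0, 0; rewrite addr0; split=> //; [case: hQ | case: hK].
  move=> a _ _ [q [k [Qq Kk ->]]] [q' [k' [Qq' Kk' ->]]].
  exists (a * q + q'), (a * k + k'); split; [exact: hQ.2 | exact: hK.2 | by ring].
- by exists 1.
- move=> _ _ [r pr ->] [r' pr' ->]; exists (r * r') => //.
  by move=> /pM[].
- move=> s [q [k [Qq Kk ->]]] [r npr rE]; apply: npr.
  have Kprod : K (norm (vR r) - norm q).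
    rewrite -rE /norm; apply: (big_rec2 (fun x y => K (x - y))).
      by rewrite subrr; case: hK.
    move=> g x y _ Kxy; rewrite rmorphD.
    have -> : (gl_act g q + gl_act g k) * x - gl_act g q * y =
      gl_act g q * (x - y) + x * gl_act g k by ring.
    by apply: (idealD hK (idealMl _ hK Kxy) (idealMl _ hK (Kact g k Kk))).
  have Qn : Q (norm q).
    by rewrite /norm (bigD1 (gl_one G)) //= gl_act1; apply: (idealMr _ hQ Qq).
  have pn : p (nmR q) by apply: Qp.
  have : K (norm (vR r)).
    by rewrite -[norm _](subrK (norm q)); apply: (idealD hK Kprod (KR (nmR q) pn)).
  have -> : norm (vR r) = vR (r ^+ #|G|).
    rewrite /norm; under eq_bigr => g _ do rewrite vR_act.
    rewrite prodr_const; elim: #|_| => // k' IHk.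
    by rewrite !exprS vRM -IHk.
  by move/RK; apply: primeX.
exists Q'; split=> // [s Qs|r].
  by apply: IQ'; exists s, 0; rewrite addr0; split=> //; case: hK.
split=> [Q'r|pr].
  by apply: contrapT => npr; apply: (Q'W _ Q'r); exists r.
by apply: IQ'; exists 0, (vR r); rewrite add0r; split; [case: hQ | apply: KR |].
Qed.

(** Chains of primes lift to S term by term by going-up, and strictness is already visible on
    invariants. *)
Lemma inv_dim : dim_le (A := R) n.
Proof.
move=> p hp lp.
have lift k : (k <= n.+1)%N -> exists Q : nat -> S -> Prop,
    (forall i, (i <= k)%N -> primeP (Q i) /\ forall r, Q i (vR r) <-> p i r) /\
    forall i, (i < k)%N -> forall s, Q i s -> Q i.+1 s.
  elim: k => [_|k IHk lek].
    have [||Q [hQ _ QP]] := @inv_going_up (fun s => s = 0) (p 0%N) _ (hp 0%N isT).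
    - by split=> // a x y -> ->; rewrite mulr0 addr0.
    - by move=> r /(vR_inj (x2 := 0)) ->; have [[]] := hp 0%N isT.
    by exists (fun=> Q); split=> // i; rewrite leqn0 => /eqP ->.
  have [Q [QP Qs]] := IHk (ltnW lek).
  have [hQk QkP] := QP k (leqnn k).
  have [idk _ _] := hQk.
  have [|Q' [hQ' QQ' Q'P]] := inv_going_up idk (hp _ lek).
    by move=> r /QkP; apply: (lp k lek).1.
  exists (fun i => if (i <= k)%N then Q i else Q'); split=> i lei.
    case: leqP => [lt|gt]; first exact: QP.
    by have -> : i = k.+1 by lia.
  rewrite ltnS in lei; case: (ltngtP i k) lei => // [lt _|-> _]; first exact: Qs.
  exact: QQ'.
have [Q [QP Qs]] := lift n.+1 (leqnn _).
apply: (mfps_dim ch0 (n := n)) => [i lei|i lei]; first exact: (QP i lei).1.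
split; first exact: Qs.
have [_ [r pr npr]] := lp i lei; exists (vR r); first by apply/(QP i.+1 lei).2.
by move=> /((QP i (leqW lei)).2 r).
Qed.

End Invariants.

(** * The skew group algebra and Auslander's theorem *)

Section SkewAction.
Context {n : nat} {F : fieldType} (ch0 : forall k, k.+1%:R != 0 :> F).
Context (G : finGLsubgroup n F).
Local Notation S := (mfps n F).
Local Notation R := (invariant_ring G).
Local Notation SR := (mfps_module G : lmodType R).
Local Notation vR := (@invariant_val n F G).
Local Notation SG := (skew_group_algebra G).
Implicit Types (g h : G) (s t : S) (r : R) (a b : SG).

Definition skew_act a s : S := \sum_(g : G) a g * gl_act g s.

Lemma skew_actD a s t : skew_act a (s + t) = skew_act a s + skew_act a t.
Proof.
by rewrite /skew_act -big_split; apply: eq_bigr => g _; rewrite rmorphD mulrDr.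
Qed.

Lemma skew_act_linear a : linear (skew_act a : SR -> SR).
Proof.
move=> r s t; rewrite skew_actD; congr (_ + _); rewrite !SR_scale /skew_act.
rewrite mulr_sumr; apply: eq_bigr => g _.
by rewrite rmorphM /= vR_act mulrCA.
Qed.

Lemma skew_actDl a b s : skew_act (a + b) s = skew_act a s + skew_act b s.
Proof.
by rewrite /skew_act -big_split; apply: eq_bigr => g _; rewrite ffunE mulrDl.
Qed.

Lemma skew_act0l s : skew_act 0 s = 0.
Proof. by rewrite /skew_act big1 // => g _; rewrite ffunE mul0r. Qed.

Lemma skew_act0 a : skew_act a 0 = 0.
Proof. by rewrite /skew_act big1 // => g _; rewrite rmorph0 mulr0. Qed.

Lemma skew_actNl a s : skew_act (- a) s = - skew_act a s.
Proof. by rewrite /skew_act -sumrN; apply: eq_bigr => g _; rewrite ffunE mulNr. Qed.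

Lemma skew_actM a b s : skew_act (a * b) s = skew_act a (skew_act b s).
Proof.
rewrite /skew_act.
transitivity (\sum_g \sum_h a g * gl_act g (b h) * gl_act (gl_mul g h) s).
  rewrite pair_bigA /= (partition_big (fun gh : G * G => gl_mul gh.1 gh.2) xpredT) //=.
  apply: eq_bigr => k _; rewrite -[(a * b) k]/(skew_mul a b k) ffunE mulr_suml.
  by apply: eq_bigr => gh /eqP <-.
apply: eq_bigr => g _; rewrite rmorph_sum mulr_sumr; apply: eq_bigr => h _.
by rewrite rmorphM /= -gl_actM mulrA.
Qed.

Lemma skew_act_term s g t : skew_act (skew_term s g) t = s * gl_act g t.
Proof.
rewrite /skew_act (bigD1 g) //= ffunE eqxx mulr1n big1 ?addr0 // => h ne.
by rewrite ffunE (negPf ne) mulr0n mul0r.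
Qed.

Lemma skew_act1 s : skew_act 1 s = s.
Proof. by rewrite [LHS]skew_act_term mul1r gl_act1. Qed.

Lemma skew_act_e s : skew_act (skew_idempotent G) s = vR (reyn G s).
Proof.
rewrite /skew_idempotent (big_morph (fun a => skew_act a s)
  (fun a b => skew_actDl a b s) (skew_act0l s)) /=.
transitivity (inv_card G * trace G s) => //.
rewrite /trace mulr_sumr; apply: eq_bigr => g _; exact: skew_act_term.
Qed.

(** Pairing the action of a with the h-translate of a dual family isolates the coefficient of h, up
    to the nonzero factor h(d). *)
Lemma skew_act_inj a : (forall s, skew_act a s = 0) -> a = 0.
Proof.
move=> a0; have [d d0 [T [u [v uv]]]] := exists_dual_family G.
apply/ffunP => h; rewrite ffunE.
have gd0 : gl_act h d <> 0.
  by move=> /(congr1 (gl_act (gl_inv h))); rewrite gl_actK rmorph0.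
apply: (mfps_mulI gd0); rewrite mulr0.
transitivity (\sum_j gl_act h (u j) * skew_act a (v j)); last first.
  by rewrite big1 // => j _; rewrite a0 mulr0.
rewrite /skew_act; under [RHS]eq_bigr => j _ do rewrite mulr_sumr.
rewrite exchange_big /= (bigD1 h) //= [X in _ = _ + X]big1 ?addr0 => [|g ne].
  have := uv (gl_one G); rewrite eqxx => <-; rewrite rmorph_sum mulr_suml.
  by apply: eq_bigr => j _; rewrite rmorphM /= gl_act1; ring.
have := uv (gl_mul (gl_inv h) g); case: eqP => [e|_ uv0].
  by case/eqP: ne; rewrite -[g](gl_mul1g) -(gl_mulgV h) -gl_mulA e gl_mulg1.
transitivity (a g * gl_act h (\sum_j u j * gl_act (gl_mul (gl_inv h) g) (v j))).
  rewrite rmorph_sum mulr_sumr; apply: eq_bigr => j _.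
  by rewrite rmorphM /= -gl_actM gl_mulA gl_mulgV gl_mul1g; ring.
by rewrite uv0 rmorph0 mulr0.
Qed.

Lemma skew_act_eq a b : (forall s, skew_act a s = skew_act b s) -> a = b.
Proof.
move=> ab; apply/eqP; rewrite -subr_eq0; apply/eqP/skew_act_inj => s.
by rewrite skew_actDl skew_actNl ab subrr.
Qed.

Definition skew_endo (f : S -> S) : Prop := exists a, forall s, f s = skew_act a s.

(** From d s = \sum_j tr(v_j s) u_j and R-linearity, f(d s) = \sum_g (\sum_j f(u_j) g(v_j)) g(s). *)
Lemma skew_endo_dual f d : linear (f : SR -> SR) -> dual_family G d ->
  skew_endo (fun s => f (d * s)).
Proof.
move=> fL [T [u [v uv]]]; exists [ffun g => \sum_j f (u j) * gl_act g (v j)] => s.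
have recon : d * s = \sum_j trace G (v j * s) * u j.
  rewrite /trace; under eq_bigr => j _ do rewrite mulr_suml.
  rewrite exchange_big /= (bigD1 (gl_one G)) //= [X in _ + X]big1 ?addr0.
    have := uv (gl_one G); rewrite eqxx => <-; rewrite mulr_suml.
    by apply: eq_bigr => j _; rewrite !gl_act1; ring.
  move=> g ne; have := uv g; rewrite (negPf ne) => e.
  transitivity (gl_act g s * \sum_j u j * gl_act g (v j)); last by rewrite e mulr0.
  by rewrite mulr_sumr; apply: eq_bigr => j _; rewrite rmorphM /=; ring.
have f0 : f 0 = 0.
  by have := fL (-1) 0 0; rewrite scaler0 addr0 scaleN1r addNr.
have fD x y : f (x + y) = f x + f y by have := fL 1 x y; rewrite !scale1r.
have fZ r x : f (vR r * x) = vR r * f x.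
  by have := fL r x 0; rewrite !addr0 f0 addr0.
rewrite recon (big_morph f fD f0).
under eq_bigr => j _ do rewrite (fZ (trR G (v j * s))) /= /trace mulr_suml.
rewrite exchange_big; apply: eq_bigr => g _; rewrite ffunE mulr_suml.
by apply: eq_bigr => j _; rewrite rmorphM /=; ring.
Qed.

(** If f composed with l and with l' is given by a and b, evaluating at l l' s yields g(l') a_g =
    g(l) b_g; coprimality makes g(l) divide a_g, and the quotients are the coefficients of f. *)
Lemma skew_endo_divide (f : S -> S) (l l' : S) : linear (f : SR -> SR) -> l <> 0 ->
  (forall u v, l' * u = l * v -> exists w, u = l * w) ->
  skew_endo (fun s => f (l * s)) -> skew_endo (fun s => f (l' * s)) -> skew_endo f.
Proof.
move=> fL l0 reg [a aE] [b bE].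
have ab g : gl_act g l' * a g = gl_act g l * b g.
  pose a' : SG := [ffun g => gl_act g l' * a g].
  pose b' : SG := [ffun g => gl_act g l * b g].
  suff /ffunP/(_ g) : a' = b' by rewrite !ffunE.
  apply: skew_act_eq => s; transitivity (f (l * (l' * s))).
    rewrite aE; apply: eq_bigr => h _; rewrite ffunE rmorphM /=; ring.
  rewrite mulrCA bE; apply: eq_bigr => h _; rewrite ffunE rmorphM /=; ring.
have /choice[c cE] : forall g, exists c, a g = gl_act g l * c.
  move=> g; have [|w wE] := reg (gl_act (gl_inv g) (a g)) (gl_act (gl_inv g) (b g)).
    by rewrite -{1}[l'](gl_actK g) -{1}[l](gl_actK g) -!rmorphM /= ab.
  by exists (gl_act g w); rewrite -[a g](gl_actVK g) wE rmorphM.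
exists [ffun g => c g] => s.
(* The norm of l is an invariant multiple of l. R-linearity takes it out of f, which passes from f(l
   s) back to f(s). *)
have nE : norm G l = l * \prod_(g | g != gl_one G) gl_act g l.
  by rewrite /norm (bigD1 (gl_one G)) //= gl_act1.
set c0 := \prod_(g | _) _ in nE.
have n0 : norm G l <> 0.
  rewrite /norm; elim/big_ind: _ => [|x y x0 y0 /mfps_domain[]//|g _].
    by move/eqP; rewrite oner_eq0.
  by move=> /(congr1 (gl_act (gl_inv g))); rewrite gl_actK rmorph0.
have f0 : f 0 = 0.
  by have := fL (-1) 0 0; rewrite scaler0 addr0 scaleN1r addNr.
have fZ r x : f (vR r * x) = vR r * f x.
  by have := fL r x 0; rewrite !addr0 f0 addr0.
apply: (mfps_mulI n0).
rewrite -(fZ (nmR G l)) /= nE -mulrA aE -nE /skew_act mulr_sumr.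
apply: eq_bigr => g _; rewrite ffunE cE.
have -> : norm G l = gl_act g (l * c0) by rewrite -nE (vR_act (nmR G l) g).
by rewrite !rmorphM /=; ring.
Qed.

End SkewAction.

(** * Auslander's theorem and parameters of the invariant ring *)

Section Auslander.
Context {F : fieldType} (ch0 : forall k, k.+1%:R != 0 :> F).
Context (G : finGLsubgroup 3 F).
Local Notation S := (mfps 3 F).
Local Notation R := (invariant_ring G).
Local Notation SR := (mfps_module G : lmodType R).
Local Notation vR := (@invariant_val 3 F G).
Local Notation SG := (skew_group_algebra G).
Implicit Types (g h : G) (s t : S) (r : R) (a b : SG).

Lemma row_form_neq0 (v : 'rV[F]_3) : v != 0 -> row_form v <> 0.
Proof.
move=> /eqP/rowP v0 e; apply: v0 => i.
by rewrite mxE -(linear_form_coef (fun i => v 0 i) i) -/(row_form v) e.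
Qed.

(** The rank of g - 1 is neither 0 nor 1, so two of the linear forms g(x) - x are independent, hence
    coprime. *)
Lemma reflection_forms g : no_pseudo_reflection G -> g != gl_one G ->
  exists i j, [/\ gl_act g (mfps_var i) - mfps_var i <> 0 &
   forall u v, (gl_act g (mfps_var j) - mfps_var j) * u =
     (gl_act g (mfps_var i) - mfps_var i) * v ->
   exists w, u = (gl_act g (mfps_var i) - mfps_var i) * w].
Proof.
move=> hG ne; pose M := (val g - 1%:M)^T.
have rkM : \rank M != 1%N by rewrite mxrank_tr; apply: hG; apply: fsvalP.
have formE i : gl_act g (mfps_var i) - mfps_var i = row_form (row i M).
  by rewrite gl_act_var_sub /row_form; congr linear_form; apply: funext => j; rewrite !mxE.
have [i i0] : exists i, row i M != 0.
  apply: contrapT => h; move/negP: ne; apply; apply/eqP/val_inj.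
  suff M0 : M = 0.
    by apply/eqP; rewrite -subr_eq0 -[_ - _]trmxK -/M M0 trmx0.
  apply/row_matrixP => i; apply/eqP/negPn/negP => i0; apply: h; exists i.
  by apply: contra i0 => /eqP ->; rewrite row0.
have [j jn] : exists j, ~~ (row j M <= row i M)%MS.
  apply: contrapT => h; move/negP: rkM; apply.
  have /mxrankS le : (M <= row i M)%MS.
    apply/row_subP => j; apply/negPn/negP => nj; apply: h; by exists j.
  have := leq_trans le (rank_leq_row _).
  rewrite leq_eqVlt ltnS leqn0 mxrank_eq0 => /orP[//|/eqP M0].
  by move: i0; rewrite M0 row0 eqxx.
exists i, j; rewrite !formE; split; first exact: row_form_neq0.
by move=> u v; apply: (row_form_reg2 ch0).
Qed.

(** Dual families represent f after multiplication by any product of g(y_g) - y_g over g different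
    from 1. The factors are removed one g at a time: two choices of y_g with coprime factors permit
    division. *)
Lemma auslander (f : S -> S) : no_pseudo_reflection G -> linear (f : SR -> SR) ->
  skew_endo G f.
Proof.
move=> hG fL.
have step (l : seq G) : uniq l -> all [pred g | g != gl_one G] l ->
    (forall y : G -> S, skew_endo G (fun s =>
       f (\prod_(g <- l) (gl_act g (y g) - y g) * s))) -> skew_endo G f.
  elim: l => [_ _ /(_ (fun=> 0))|g l IHl].
    by move=> [a aE]; exists a => s; rewrite -aE big_nil mul1r.
  rewrite cons_uniq [all _ _]/= => /andP[gl ul] /andP[ne al] hy; apply: IHl => // y.
  have [i [j [li reg]]] := reflection_forms hG ne.
  pose upd k := fun h => if h == g then mfps_var k else y h : S.
  have updE k s : \prod_(h <- g :: l) (gl_act h (upd k h) - upd k h) * s =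
      \prod_(h <- l) (gl_act h (y h) - y h) * ((gl_act g (mfps_var k) - mfps_var k) * s).
    rewrite big_cons (eq_big_seq (fun h => gl_act h (y h) - y h)) => [|h hl].
      by rewrite /upd eqxx mulrAC mulrC.
    by rewrite /upd; case: eqP => // hg; move: gl; rewrite -hg hl.
  have hL : linear ((fun s => f (\prod_(h <- l) (gl_act h (y h) - y h) * s)) : SR -> SR).
    move=> r s t; rewrite -fL; congr f.
    by rewrite !SR_scale; rewrite mulrDr mulrCA.
  apply: (skew_endo_divide hL li reg).
    by have [a aE] := hy (upd i); exists a => s; rewrite -aE updE.
  by have [a aE] := hy (upd j); exists a => s; rewrite -aE updE.
apply: (step (enum [pred g | g != gl_one G])); first exact: enum_uniq.
  by apply/allP => g; rewrite mem_enum.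
move=> y; have [a aE] := skew_endo_dual fL (dual_family_prod y).
by exists a => s; rewrite -aE big_enum.
Qed.

Lemma gl_act_row g (v : 'rV[F]_3) : gl_act g (row_form v) = row_form (v *m (val g)^T).
Proof.
rewrite /row_form /linear_form rmorph_sum /=.
under eq_bigr => i _ do rewrite rmorphM /= gl_act_const /gl_act mfps_subst_var /linear_form mulr_sumr.
rewrite exchange_big /=; apply: eq_bigr => j _; rewrite mxE.
rewrite (big_morph mfps_const (@mfps_constD 3 F) (_ : mfps_const 0 = 0)) ?mulr_suml.
  by apply: eq_bigr => i _; rewrite mxE -mfps_constMM mulrA.
by apply: funext => m; rewrite /mfps_const mul0rn.
Qed.

(** Norms of three linear forms in general position: any translates of the three, one of each, are
    independent, so products over all translates stay regular. *)
Lemma exists_theta : exists t1 t2 t3 : R,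
  [/\ maxR t1, maxR t2, maxR t3 & reg3 SR t1 t2 t3].
Proof.
have trU g : (val g)^T \in unitmx by rewrite unitmx_tr; apply: (gl_unitmx (fsvalP g)).
have subU m (B : 'M[F]_(m, 3)) (v : 'rV[F]_3) (A : 'M[F]_3) : A \in unitmx ->
    (v *m A <= B)%MS -> (v <= B *m invmx A)%MS.
  by move=> uA h; rewrite -[v](mulmxK uA); apply: submxMr.
have [r1 n1] : exists r1 : 'rV[F]_3, r1 != 0.
  have [|v h] := avoid_subspaces ch0 (T := unit) (B := fun=> (0 : 'M[F]_(1,3))).
    by move=> _; rewrite mxrank0.
  by exists v; apply: contra (h tt) => /eqP ->; apply: sub0mx.
have n1' g : r1 *m (val g)^T != 0.
  by apply: contra n1 => /eqP e; rewrite -[r1](mulmxK (trU g)) e mul0mx.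
have [|r2 n2] := avoid_subspaces ch0 (T := (G * G)%type)
    (B := fun gh => r1 *m (val gh.1)^T *m invmx (val gh.2)^T).
  by move=> gh; apply: leq_ltn_trans (rank_leq_row _) _.
have n2' g h : ~~ (r2 *m (val h)^T <= r1 *m (val g)^T)%MS.
  by apply: contra (n2 (g, h)) => /(subU _ _ _ _ (trU h)).
have [|r3 n3] := avoid_subspaces ch0 (T := (G * G * G)%type)
    (B := fun ghk => col_mx (r1 *m (val ghk.1.1)^T) (r2 *m (val ghk.1.2)^T) *m invmx (val ghk.2)^T).
  by move=> ghk; apply: leq_ltn_trans (rank_leq_row _) _.
have n3' g h (k : G) : ~~ (r3 *m (val k)^T <= col_mx (r1 *m (val g)^T) (r2 *m (val h)^T))%MS.
  by apply: contra (n3 (g, h, k)) => /(subU _ _ _ _ (trU k)).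
have norm_max (r : 'rV[F]_3) : mfps_max (norm G (row_form r)).
  have [[mi _ _] _] := @mfps_local 3 F.
  by rewrite /norm (bigD1 (gl_one G)) //= gl_act1; apply: (idealMr _ mi); apply: linear_form_max.
exists (nmR G (row_form r1)), (nmR G (row_form r2)), (nmR G (row_form r3)).
have reg : reg3 (S^o : lmodType S) (norm G (row_form r1)) (norm G (row_form r2)) (norm G (row_form r3)).
  have base g h (k : G) : reg3 (S^o : lmodType S) (gl_act g (row_form r1))
      (gl_act h (row_form r2)) (gl_act k (row_form r3)).
    by rewrite !gl_act_row; apply: row_form_reg3.
  have o := gl_one G.
  have p3 g h : reg3 (S^o : lmodType S) (gl_act g (row_form r1))
      (gl_act h (row_form r2)) (norm G (row_form r3)).
    exact: (reg3_prod3 _ (base g h o) (base g h)).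
  have p2 g : reg3 (S^o : lmodType S) (gl_act g (row_form r1))
      (norm G (row_form r2)) (norm G (row_form r3)).
    exact: (reg3_prod2 _ (p3 g o) (p3 g)).
  exact: (reg3_prod1 _ p2).
split; [exact: norm_max | exact: norm_max | exact: norm_max |].
have [h1 h2 h3] := reg; split=> [u|u v|u v w]; [exact: h1 | exact: h2 | exact: h3].
Qed.

Lemma SR_nonzero : exists u : SR, u <> 0.
Proof. by exists (1 : S); move/eqP; rewrite (oner_eq0 S). Qed.

(** The regular sequence of invariants on S yields four primes ending at the maximal ideal;
    [inv_dim] is the upper bound. *)
Lemma inv_krull_dim : krull_dim R 3.
Proof.
have [t1 [t2 [t3 [m1 m2 m3 reg]]]] := exists_theta.
have hm := inv_local G; have [hmp mU] := hm; have [mi mone _] := hmp.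
have nR : noeth R := @inv_noeth 3 F ch0 G.
have [|Q [QE Qp Ql]] := @regular_chain _ SR [:: t1; t2; t3] (@maxR _ _ G)
    nR ((reg3_regular SR t1 t2 t3).1 reg) hmp.
  move=> t ht; apply: contrapT => /mU[y ty].
  have h u : span_mul [:: t1; t2; t3] (u : SR).
    rewrite -[u]scale1r -ty mulrC -scalerA; apply: submodZ => //.
    exact: span_mul_submod.
  have [c /(congr1 (fun s : S => s 0%MM))] := h (1 : S).
  rewrite !big_ord_recl big_ord0 addr0 /= !SR_scale !mfps_coefD !mfps_coefM0.
  rewrite m1 m2 m3 !mul0r !addr0 => /eqP.
  by rewrite mfps_coef1 eqxx oner_eq0.
exact: (krull_dim_of (inv_dim ch0 (G := G)) Qp Ql).
Qed.

End Auslander.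

(** * Vanishing of Ext^1(S, S) *)

Section SubmoduleType.
Context {A : comNzRingType} {V : lmodType A}.

Record submodule := Submodule { submodule_pred :> V -> Prop;
                                submoduleP : submod submodule_pred }.

Definition submodule_mem (W : submodule) : {pred V} := fun x => `[< W x >].

Lemma submodule_closed (W : submodule) : GRing.submod_closed (submodule_mem W).
Proof.
have [W0 WD] := submoduleP W.
split=> [|a x y /asboolP Wx /asboolP Wy]; apply/asboolP => //; exact: WD.
Qed.

HB.instance Definition _ (W : submodule) :=
  GRing.isSubmodClosed.Build A V (submodule_mem W) (submodule_closed W).

Record submodule_type (W : submodule) :=
  SubmoduleElt { submodule_val : V; _ : submodule_val \in submodule_mem W }.

HB.instance Definition _ (W : submodule) := [isSub for @submodule_val W].
HB.instance Definition _ (W : submodule) := [Choice of submodule_type W by <:].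
HB.instance Definition _ (W : submodule) :=
  [SubChoice_isSubLmodule of submodule_type W by <:].

Lemma submodule_valP (W : submodule) (x : submodule_type W) : W (submodule_val x).
Proof. by case: x => v /= /asboolP. Qed.

Definition submodule_elt (W : submodule) x (Wx : W x) : submodule_type W :=
  SubmoduleElt (introT (asboolP _) Wx).

Lemma submodule_val_linear (W : submodule) : linear (@submodule_val W).
Proof. by []. Qed.

Lemma submodule_val_inj (W : submodule) : injective (@submodule_val W).
Proof. exact: val_inj. Qed.

Lemma fgmod_submodule (W : submodule) : noethmod V -> fgmod (submodule_type W).
Proof.
move=> nV; have [T [b bP]] := nV _ (submoduleP W).
have Wb t : W (b t) by apply/bP/span_gen.
exists T, (fun t => submodule_elt (Wb t)) => v.
have [c cE] := (bP _).1 (submodule_valP v); exists c; apply: submodule_val_inj.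
by rewrite [LHS]cE (big_morph _ (id1 := 0) (op1 := +%R)).
Qed.
End SubmoduleType.

Section FinitePowers.
Context {A : comNzRingType} (M : lmodType A).

Lemma reg3_ffun (T : finType) a b c : reg3 M a b c -> reg3 {ffun T -> M} a b c.
Proof.
move=> [h1 h2 h3]; split=> [u /ffunP u0|u v /ffunP uv|u v w /ffunP uvw].
- by apply/ffunP => i; have := u0 i; rewrite !ffunE => /h1.
- have /choice[w wE] : forall i, exists w, u i = a *: w.
    by move=> i; apply: (h2 _ (v i)); have := uv i; rewrite !ffunE.
  by exists [ffun i => w i]; apply/ffunP => i; rewrite !ffunE.
have /choice[p pE] : forall i, exists p : M * M, u i = a *: p.1 + b *: p.2.
  move=> i; have [|x [y xyE]] := h3 (u i) (v i) (w i); last by exists (x, y).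
  by have := uvw i; rewrite !ffunE.
exists [ffun i => (p i).1], [ffun i => (p i).2].
by apply/ffunP => i; rewrite !ffunE.
Qed.

Lemma torsion_free_ffun (T : finType) : torsion_free M -> torsion_free {ffun T -> M}.
Proof.
move=> tM r u /ffunP ru; have [->|r0] := EM (r = 0); [by left | right].
by apply/ffunP => i; rewrite ffunE; have := ru i; rewrite !ffunE => /tM[].
Qed.

Lemma linear_fun0 (N : lmodType A) (f : N -> M) : linear f -> f 0 = 0.
Proof. by move=> fL; have := fL (-1) 0 0; rewrite scaler0 addr0 scaleN1r addNr. Qed.
Lemma linear_funD (N : lmodType A) (f : N -> M) x y : linear f -> f (x + y) = f x + f y.
Proof. by move=> fL; have := fL 1 x y; rewrite !scale1r. Qed.
Lemma linear_funZ (N : lmodType A) (f : N -> M) a x : linear f -> f (a *: x) = a *: f x.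
Proof. by move=> fL; have := fL a x 0; rewrite !addr0 linear_fun0 // addr0. Qed.
Lemma linear_funN (N : lmodType A) (f : N -> M) x : linear f -> f (- x) = - f x.
Proof. by move=> fL; rewrite -scaleN1r linear_funZ // scaleN1r. Qed.
Lemma linear_funB (N : lmodType A) (f : N -> M) x y : linear f -> f (x - y) = f x - f y.
Proof. by move=> fL; rewrite linear_funD // linear_funN. Qed.
Lemma linear_fun_sum (N : lmodType A) (f : N -> M) (T : finType) (E : T -> N) :
  linear f -> f (\sum_i E i) = \sum_i f (E i).
Proof.
move=> fL; apply: (big_morph f _ (linear_fun0 fL)) => x y.
exact: linear_funD.
Qed.
End FinitePowers.

Section FunctionalsOnPowers.
Context {F : fieldType} (ch0 : forall k, k.+1%:R != 0 :> F).
Context (G : finGLsubgroup 3 F).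
Local Notation S := (mfps 3 F).
Local Notation R := (invariant_ring G).
Local Notation SR := (mfps_module G : lmodType R).
Local Notation vR := (@invariant_val 3 F G).
Local Notation SG := (skew_group_algebra G).

Definition row_act (T : finType) (a : T -> SG) (x : {ffun T -> SR}) : SR :=
  \sum_j skew_act (a j) (x j).

Lemma row_act_linear (T : finType) (a : T -> SG) : linear (row_act a).
Proof.
move=> r x y; rewrite /row_act scaler_sumr -big_split; apply: eq_bigr => j _.
by rewrite !ffunE skew_act_linear.
Qed.

Definition ffun_delta (T : finType) (j : T) (s : SR) : {ffun T -> SR} :=
  [ffun i => if i == j then s else 0].

Lemma row_act_delta (T : finType) (a : T -> SG) j s : row_act a (ffun_delta j s) = skew_act (a j) s.
Proof.
rewrite /row_act (bigD1 j) //= ffunE eqxx big1 ?addr0 // => i /negPf ne.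
by rewrite ffunE ne; apply: skew_act0.
Qed.

Lemma ffun_delta_sum (T : finType) (x : {ffun T -> SR}) : x = \sum_j ffun_delta j (x j).
Proof.
apply/ffunP => i; rewrite sum_ffunE (bigD1 i) //= ffunE eqxx big1 ?addr0 //.
by move=> j ne; rewrite ffunE eq_sym (negPf ne).
Qed.

Lemma ffun_delta_linear (T : finType) (j : T) : linear (ffun_delta j).
Proof.
move=> r s t; apply/ffunP => i; rewrite !ffunE; case: ifP => _ //.
by rewrite scaler0 addr0.
Qed.

Lemma row_act_inj (T : finType) (a b : T -> SG) : (forall x, row_act a x = row_act b x) -> a =1 b.
Proof.
by move=> ab j; apply: skew_act_eq => s; rewrite -!row_act_delta ab.
Qed.

Lemma row_act_repr (T : finType) (f : {ffun T -> SR} -> SR) : no_pseudo_reflection G ->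
  linear f -> exists a : T -> SG, forall x, f x = row_act a x.
Proof.
move=> hG fL; have /choice[a aE] : forall j, exists a : SG,
    forall s, f (ffun_delta j s) = skew_act a s.
  move=> j; apply: (auslander ch0 (f := fun s => f (ffun_delta j s))) => //.
  by move=> r s t; rewrite ffun_delta_linear fL.
exists a => x; rewrite {1}[x]ffun_delta_sum linear_fun_sum //.
by apply: eq_bigr => j _; apply: aE.
Qed.

Lemma SR_free_factor : isolated_singularity R -> forall z, maxR z ->
  exists i, free_factor SR (z ^+ i).
Proof.
move=> iso; have [t1 [t2 [t3 [m1 m2 m3 reg]]]] := exists_theta ch0 G.
apply: (CM_free_factor (m := @maxR _ _ G) _ (inv_local G) _ _ iso) reg => //.
- exact: (@inv_noeth _ _ ch0).
- exact: (@inv_domain _ _ G).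
- exact: (@inv_dim _ _ ch0).
- exact: SR_fgmod.
- exact: (@SR_torsion_free _ _ G).
Qed.

Section Extension.
Context (hG : no_pseudo_reflection G) (iso : isolated_singularity R).
Context (k l : nat) (M : lmodType R) (i : M -> {ffun 'I_k -> SR})
  (f : {ffun 'I_k -> SR} -> {ffun 'I_l -> SR}).
Hypotheses (iL : linear i) (fL : linear f) (i_inj : injective i).
Hypothesis f_ker : forall x, f x = 0 <-> exists u, x = i u.
Hypothesis f_surj : forall y, exists x, f x = y.

Lemma factor_through_surj (chi : {ffun 'I_k -> SR} -> SR) : linear chi ->
  (forall u, chi (i u) = 0) ->
  exists2 psi : {ffun 'I_l -> SR} -> SR, linear psi & forall x, chi x = psi (f x).
Proof.
move=> cL c0; have [s sE] := choice f_surj.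
have cE x x' : f x = f x' -> chi x = chi x'.
  move=> e; have [|u uE] := (f_ker (x - x')).1; first by rewrite linear_funB // e subrr.
  by rewrite -[x](subrK x') linear_funD // uE c0 add0r.
exists (fun y => chi (s y)); last by move=> x; apply: cE; rewrite sE.
by move=> r x y; rewrite -cL; apply: cE; rewrite sE fL !sE.
Qed.

(** Multiplication by r on S^l factors through a free module and so lifts along f to some h; then r
    x - h (f x) lies in M, where phi is defined. *)
Lemma extend_multiple r (phi : M -> SR) : free_factor SR r -> linear phi ->
  exists2 psi : {ffun 'I_k -> SR} -> SR, linear psi & forall u, psi (i u) = r *: phi u.
Proof.
move=> [T [al [mu [alL alE]]]] pL.
have /choice[X XE] : forall tj : T * 'I_l, exists x, f x = ffun_delta tj.2 (mu tj.1).
  by move=> tj; apply: f_surj.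
pose h (y : {ffun 'I_l -> SR}) := \sum_j \sum_t al t (y j) *: X (t, j).
have hL : linear h.
  move=> a x y; rewrite /h scaler_sumr -big_split; apply: eq_bigr => j _ /=.
  rewrite scaler_sumr -big_split; apply: eq_bigr => t _ /=.
  by rewrite !ffunE alL scalerDl scalerA.
have fh y : f (h y) = r *: y.
  rewrite {2}[y]ffun_delta_sum /h linear_fun_sum // scaler_sumr.
  apply: eq_bigr => j _; rewrite linear_fun_sum //.
  rewrite -(linear_funZ _ _ (ffun_delta_linear j)) alE.
  rewrite (linear_fun_sum _ (ffun_delta_linear j)); apply: eq_bigr => t _.
  by rewrite (linear_funZ _ _ (ffun_delta_linear j)) linear_funZ // XE.
have /choice[ka kaE] : forall x, exists u, r *: x - h (f x) = i u.
  by move=> x; apply/f_ker; rewrite linear_funB // fh linear_funZ // subrr.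
have kaL : linear ka.
  move=> a x y; apply: i_inj; rewrite iL -!kaE fL hL; mring.
exists (fun x => phi (ka x)) => [a x y|u]; first by rewrite kaL pL.
rewrite -linear_funZ //; congr phi; apply: i_inj; rewrite -kaE linear_funZ //.
have -> : f (i u) = 0 by apply/f_ker; exists u.
by rewrite linear_fun0 // subr0.
Qed.

(* Ext^1_R(S, S) = 0: Ext^1_R(S, S) is killed by powers of a system of
   parameters, and End_R(S) = S * G has depth three. *)
Lemma extend_from_kernel (phi : M -> SR) : linear phi ->
  exists2 psi : {ffun 'I_k -> SR} -> SR, linear psi & forall u, psi (i u) = phi u.
Proof.
move=> pL; have [t1 [t2 [t3 [m1 m2 m3 reg]]]] := exists_theta ch0 G.
have [i1 f1] := SR_free_factor iso m1; have [i2 f2] := SR_free_factor iso m2.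
have [i3 f3] := SR_free_factor iso m3.
move/(reg3_expn i1 i2 i3): reg => reg.
move: (t1 ^+ i1) (t2 ^+ i2) (t3 ^+ i3) f1 f2 f3 reg => a b c fa fb fc reg.
move=> {t1 t2 t3 m1 m2 m3 i1 i2 i3}.
have [pa paL paE] := extend_multiple fa pL.
have [pb pbL pbE] := extend_multiple fb pL.
have [pc pcL pcE] := extend_multiple fc pL.
(* After cross-multiplication two partial extensions differ by a functional that vanishes on M,
   hence by a row over S * G composed with f. *)
have diff p q (P Q : {ffun 'I_k -> SR} -> SR) : linear P -> linear Q ->
    (forall u, P (i u) = p *: phi u) -> (forall u, Q (i u) = q *: phi u) ->
    exists A : 'I_l -> SG, forall x, q *: P x - p *: Q x = row_act A (f x).
  move=> PL QL PE QE.
  have [||e eL eE] := @factor_through_surj (fun x => q *: P x - p *: Q x).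
  - by move=> r x y; rewrite PL QL; mring.
  - by move=> u; rewrite PE QE; mring.
  have [A AE] := row_act_repr hG eL.
  by exists A => x; rewrite eE AE.
have [Aab abE] := diff _ _ _ _ paL pbL paE pbE.
have [Aac acE] := diff _ _ _ _ paL pcL paE pcE.
have [Abc bcE] := diff _ _ _ _ pbL pcL pbE pcE.
pose sc (r : R) (A : 'I_l -> SG) j : SG := [ffun g => vR r * A j g].
have scE r A y : row_act (sc r A) y = r *: row_act A y.
  rewrite /row_act scaler_sumr; apply: eq_bigr => j _.
  rewrite SR_scale /skew_act mulr_sumr; apply: eq_bigr => g _.
  by rewrite ffunE mulrA.
have addE A B y : row_act (fun j => A j + B j) y = row_act A y + row_act B y.
  by rewrite /row_act -big_split; apply: eq_bigr => j _; apply: skew_actDl.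
(* Rows over S * G are determined by their action and have coefficients in S, so Koszul exactness of
   S applies to every coefficient. *)
have cocycle j g : c *: (Aab j g : SR) + a *: (Abc j g : SR) = b *: (Aac j g : SR).
  suff /(_ j)/ffunP/(_ g) : (fun j => sc c Aab j + sc a Abc j) =1 sc b Aac.
    by rewrite !ffunE.
  apply: row_act_inj => y; have [x <-] := f_surj y.
  by rewrite addE !scE -abE -bcE -acE; mring.
have /choice[w wE] : forall jg : 'I_l * G, exists w : SR * SR * SR,
    [/\ (Aab jg.1 jg.2 : SR) = b *: w.1.1 - a *: w.1.2,
        (Aac jg.1 jg.2 : SR) = c *: w.1.1 - a *: w.2 &
        (Abc jg.1 jg.2 : SR) = c *: w.1.2 - b *: w.2].
  move=> [j g]; have [wa [wb [wc [h1 h2 h3]]]] := koszul_exact reg (cocycle j g).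
  by exists (wa, wb, wc).
pose xa (j : 'I_l) : SG := [ffun g => (w (j, g)).1.1].
pose xb (j : 'I_l) : SG := [ffun g => (w (j, g)).1.2].
have abE' y : row_act Aab y = b *: row_act xa y - a *: row_act xb y.
  rewrite -!scE -[- row_act _ y]scaleN1r -scE -addE.
  rewrite /row_act; apply: eq_bigr => j _; congr (skew_act _ _).
  apply/ffunP => g; rewrite !ffunE vRN vR1 mulN1r.
  by have [-> _ _] := wE (j, g).
(* Corrected by the primitive, the partial extensions over a and b become proportional; regularity
   divides qa by a, and the quotient extends phi. *)
pose qa x := pa x - row_act xa (f x); pose qb x := pb x - row_act xb (f x).
have qE x : b *: qa x = a *: qb x.
  have e := abE x; rewrite abE' in e.
  by apply: (eq_by_sub e); rewrite /qa /qb; mring.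
have [_ h2 _] := reg.
have /choice[psi psiE] : forall x, exists v, qa x = a *: v.
  by move=> x; apply: h2 (qE x).
exists psi => [r x y|u]; apply: (reg3_inj reg).
  have -> : a *: (r *: psi x + psi y) = r *: (a *: psi x) + a *: psi y by mring.
  rewrite -!psiE /qa paL fL (row_act_linear xa); mring.
rewrite -psiE /qa paE; have -> : f (i u) = 0 by apply/f_ker; exists u.
by rewrite (linear_fun0 (row_act_linear xa)) subr0.
Qed.

End Extension.
End FunctionalsOnPowers.

(** * Presentations of Cohen-Macaulay modules *)

Section CMData.
Context {F : fieldType} (ch0 : forall k, k.+1%:R != 0 :> F).
Context (G : finGLsubgroup 3 F).
Local Notation S := (mfps 3 F).
Local Notation R := (invariant_ring G).
Local Notation SR := (mfps_module G : lmodType R).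
Local Notation vR := (@invariant_val 3 F G).
Local Notation SG := (skew_group_algebra G).

Lemma R_noeth : noeth R. Proof. exact: (@inv_noeth _ _ ch0). Qed.
Lemma R_dim : dim_le (A := R) 3. Proof. exact: (@inv_dim _ _ ch0). Qed.
Lemma R_domain : domainP (A := R). Proof. exact: (@inv_domain _ _ G). Qed.
Lemma SR_tf : torsion_free SR. Proof. exact: (@SR_torsion_free _ _ G). Qed.

(** The last clause says that (a, b, c) is primary to the maximal ideal; on the zero module
    regularity alone would not constrain a, b and c. *)
Definition CM_system (M : lmodType R) (a b c : R) : Prop :=
  [/\ maxR a, maxR b, maxR c, a <> 0 & reg3 M a b c] /\
  forall P, primeP P -> P a -> P b -> P c -> forall z, maxR z -> P z.

Lemma CM_data (M : lmodType R) : isolated_singularity R -> maximal_CM M ->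
  [/\ fgmod M, torsion_free M, exists a b c, CM_system M a b c &
      forall z, maxR z -> exists i, free_factor M (z ^+ i)].
Proof.
move=> iso [/fgmodP fM CM].
have [M0|[u u0]] : (forall x : M, x = 0) \/ exists u : M, u <> 0.
  have [h|h] := EM (exists u : M, u <> 0); first by right.
  by left => x; apply: contrapT => x0; apply: h; exists x.
  (* On the zero module every sequence is regular, so parameters coming from S are taken. *)
  have [t1 [t2 [t3 [m1 m2 m3 reg]]]] := exists_theta ch0 G.
  split=> //.
  - by move=> r x _; right; apply: M0.
  - exists t1, t2, t3; split; first split=> //.
    + move=> t10; have [h _ _] := reg; have [s s0] := SR_nonzero G.
      by apply: s0; apply: h; rewrite t10 scale0r.
    + split=> [x _|x y _|x y z _]; [exact: M0 | by exists 0; rewrite (M0 x) (M0 (_ *: _)) |].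
      by exists 0, 0; rewrite (M0 x) (M0 (_ + _)).
    + move=> P hP; apply: (reg3_parameters R_noeth (inv_local G) R_dim _ SR_tf _ reg) => //.
        exact: SR_fgmod.
      exact: SR_nonzero.
  - move=> z _; exists 0%N; exists void, (fun v : void => match v with end), (fun v : void => match v with end).
    by split=> [[]|x]; rewrite (M0 (_ *: _)) big1 // => -[].
case: CM => [/(_ u)//|[d kd [[s sd [snu sreg _]] _]]].
have d3 : d = 3%N by apply: krull_dim_uniq kd (inv_krull_dim ch0 G).
case: s sd snu sreg => [|a [|b [|c [|? ?]]]]; rewrite d3 //= => _ snu sreg.
have reg : reg3 M a b c by apply/reg3_regular.
have mx x : x \in [:: a; b; c] -> maxR x.
  by move=> /snu/(nonunitP _ (inv_local G)).
have [ma mb mc] : [/\ maxR a, maxR b & maxR c].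
  by split; apply: mx; rewrite !inE eqxx ?orbT.
have tM : torsion_free M.
  exact: (CM_torsion_free R_noeth (inv_local G) R_domain R_dim (fg_noeth R_noeth fM) ma mb mc reg).
split=> //; last first.
  exact: (CM_free_factor R_noeth (inv_local G) R_domain R_dim iso fM tM ma mb mc reg).
exists a, b, c; split; first split=> //.
  by move=> a0; have [h _ _] := reg; apply: u0; apply: h; rewrite a0 scale0r.
move=> P hP; apply: (reg3_parameters R_noeth (inv_local G) R_dim fM tM _ reg) => //.
by exists u.
Qed.

Lemma tf_SR_inj r (u v : SR) : r <> 0 -> r *: u = r *: v -> u = v.
Proof. by move=> r0; apply: tf_inj SR_tf r0. Qed.

(* A fraction u / a whose denominators include a system of parameters lies in S. *)
Lemma parameters_glue (a b c : R) (u v w : SR) : a <> 0 ->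
  (forall P, primeP P -> P a -> P b -> P c -> forall z, maxR z -> P z) ->
  b *: u = a *: v -> c *: u = a *: w -> exists x, u = a *: x.
Proof.
move=> a0 par buE cuE; have [t1 [t2 [t3 [m1 m2 m3 reg]]]] := exists_theta ch0 G.
pose I z := exists x y t, z = x * a + y * b + t * c.
have hI : ideal I.
  split; first by exists 0, 0, 0; ring.
  move=> r _ _ [x [y [t ->]]] [x' [y' [t' ->]]].
  by exists (r * x + x'), (r * y + y'), (r * t + t'); ring.
have Ip Q : primeP Q -> (forall z, I z -> Q z) -> forall z, maxR z -> Q z.
  move=> hQ IQ; apply: par => //; apply: IQ.
  - by exists 1, 0, 0; ring.
  - by exists 0, 1, 0; ring.
  - by exists 0, 0, 1; ring.
(* Powers of t1 and t2 lie in (a, b, c) and therefore multiply u into aS; since they are regular on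
   S, u itself lies in aS. *)
have [i [x1 [y1 [z1 e1]]]] := power_in_ideal R_noeth hI m1 Ip.
have [j [x2 [y2 [z2 e2]]]] := power_in_ideal R_noeth hI m2 Ip.
pose w1 := x1 *: u + y1 *: v + z1 *: w; pose w2 := x2 *: u + y2 *: v + z2 *: w.
have W x y z : a *: (x *: u + y *: v + z *: w) = (x * a + y * b + z * c) *: u.
  have -> : a *: (x *: u + y *: v + z *: w) = x *: (a *: u) + y *: (a *: v) + z *: (a *: w).
    by mring.
  by rewrite -buE -cuE; mring.
have w1E : a *: w1 = (t1 ^+ i) *: u by rewrite W e1.
have w2E : a *: w2 = (t2 ^+ j) *: u by rewrite W e2.
have [h1 h2 _] := reg3_expn i j 0 reg.
have [|x xE] := h2 w1 w2.
  apply: (tf_SR_inj a0).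
  have -> : a *: ((t2 ^+ j) *: w1) = (t2 ^+ j) *: (a *: w1) by rewrite !scalerA mulrC.
  have -> : a *: ((t1 ^+ i) *: w2) = (t1 ^+ i) *: (a *: w2) by rewrite !scalerA mulrC.
  by rewrite w1E w2E !scalerA mulrC.
exists x; apply: (reg3_inj (reg3_expn i j 0 reg)).
by rewrite -w1E xE !scalerA mulrC.
Qed.

End CMData.

Section KoszulSyzygies.
Context {A : comNzRingType} (V : lmodType A) (x y z : A).

Lemma koszul_sign (u v w : V) : x *: u + y *: v + z *: w = 0 ->
  z *: w + x *: u = y *: (- v).
Proof. by move=> e; apply: (eq_by_sub e); mring. Qed.

Lemma koszul_shift (p r e : V) : z *: p - y *: r = z *: (p - y *: e) - y *: (r - z *: e).
Proof. mring. Qed.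
End KoszulSyzygies.

(** * Functionals on M and the free module of their relations *)

Section Coresolution.
Context {F : fieldType} (ch0 : forall k, k.+1%:R != 0 :> F).
Context (G : finGLsubgroup 3 F).
Local Notation S := (mfps 3 F).
Local Notation R := (invariant_ring G).
Local Notation SR := (mfps_module G : lmodType R).
Local Notation vR := (@invariant_val 3 F G).
Local Notation SG := (skew_group_algebra G).
Context (hG : no_pseudo_reflection G) (iso : isolated_singularity R).
Context (M : lmodType R) (CM : maximal_CM M).

(** Evaluation at generators of M embeds Hom_R(M, S) in a power of S, as a submodule over the
    noetherian ring S. *)
Lemma hom_generators : exists k (phi : 'I_k -> M -> SR),
  (forall j, linear (phi j)) /\ forall f : M -> SR, linear f ->
  exists s : 'I_k -> S, forall u, f u = \sum_j (s j * phi j u : S).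
Proof.
have [[T [mu muP]] _ _ _] := CM_data ch0 iso CM.
pose W (w : {ffun T -> (S^o : lmodType S)}) :=
  exists f : M -> SR, linear f /\ forall t, w t = f (mu t).
have hW : submod W.
  split.
    exists (fun=> 0); split=> [r x y|t]; first by rewrite scaler0 addr0.
    by rewrite ffunE.
  move=> s w w' [f [fL fE]] [f' [f'L f'E]]; exists (fun u => s * f u + f' u : S).
  split=> [r x y|t]; last by rewrite !ffunE fE f'E.
  rewrite fL f'L !SR_scale; ring.
have [k [b bP]] := fgsub_ord (fg_noeth (mfps_noeth ch0 (n := 3)) (fgmod_ffun _ fgmod_self) hW).
have /choice[phi phiP] : forall j, W (b j) by move=> j; apply/bP/span_gen.
exists k, phi; split=> [j|f fL]; first by case: (phiP j).
have [s sE] : span b [ffun t => f (mu t) : S^o].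
  by apply/bP; exists f; split=> // t; rewrite ffunE.
exists s => u; have [c ->] := muP u.
rewrite linear_fun_sum //.
transitivity (\sum_t \sum_j (s j * (c t *: phi j (mu t) : SR) : S)).
  apply: eq_bigr => t _; rewrite linear_funZ // SR_scale.
  have /ffunP/(_ t) := sE; rewrite ffunE sum_ffunE => ->.
  rewrite mulr_sumr; apply: eq_bigr => j _; rewrite ffunE (phiP j).2.
  by rewrite -[s j *: _]/(s j * _) SR_scale mulrCA.
rewrite exchange_big; apply: eq_bigr => j _.
rewrite (linear_fun_sum (f := phi j)); last by case: (phiP j).
rewrite mulr_sumr; apply: eq_bigr => t _; congr (_ * _).
by rewrite linear_funZ //; case: (phiP j).
Qed.

Context (k : nat) (phi : 'I_k -> M -> SR).
Hypothesis phiL : forall j, linear (phi j).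
Hypothesis phi_gen : forall f : M -> SR, linear f ->
  exists s : 'I_k -> S, forall u, f u = \sum_j (s j * phi j u : S).

Local Notation Fr := ({ffun ('I_k * G) -> (S^o : lmodType S)}).

(** By Auslander's theorem Hom_R(S^k, S) = (S * G)^k; [ev] is the evaluation pairing when this is
    viewed as a free S-module. *)
Definition ev (s : Fr) (x : {ffun 'I_k -> SR}) : SR :=
  \sum_(jg : 'I_k * G) ((s jg : S) * gl_act jg.2 (x jg.1) : S).

Lemma evE s x : ev s x = \sum_j \sum_g ((s (j, g) : S) * gl_act g (x j) : S).
Proof. by rewrite pair_bigA; apply: eq_bigr => -[j g] _. Qed.

Lemma ev_linear s : linear (ev s).
Proof.
move=> r x y; rewrite /ev SR_scale mulr_sumr -big_split; apply: eq_bigr => jg _.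
by rewrite !ffunE rmorphD SR_scale rmorphM /= vR_act; ring.
Qed.

Lemma evD s s' x : ev (s + s') x = ev s x + ev s' x.
Proof. by rewrite /ev -big_split; apply: eq_bigr => jg _; rewrite !ffunE mulrDl. Qed.

Lemma evZ a s x : ev (a *: s) x = (a * ev s x : S).
Proof.
by rewrite /ev mulr_sumr; apply: eq_bigr => jg _; rewrite !ffunE -mulrA.
Qed.

Lemma evB s s' x : ev (s - s') x = (ev s x - ev s' x : S).
Proof. by rewrite /ev -sumrB; apply: eq_bigr => jg _; rewrite !ffunE mulrBl. Qed.

Lemma ev_sum (T : finType) (E : T -> Fr) x : ev (\sum_t E t) x = \sum_t ev (E t) x.
Proof.
apply: (big_morph (fun s => ev s x)) => [s s'|]; first exact: evD.
by rewrite /ev big1 // => jg _; rewrite ffunE mul0r.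
Qed.

Lemma ev_row s x : ev s x = row_act (fun j => [ffun g => s (j, g)]) x.
Proof.
by rewrite evE; apply: eq_bigr => j _; apply: eq_bigr => g _; rewrite ffunE.
Qed.

Lemma ev_repr (f : {ffun 'I_k -> SR} -> SR) : linear f ->
  exists s, forall x, f x = ev s x.
Proof.
move=> fL; have [a aE] := row_act_repr ch0 hG fL.
exists [ffun jg => a jg.1 jg.2] => x; rewrite aE ev_row.
apply: eq_bigr => j _; congr (skew_act _ _); apply/ffunP => g.
by rewrite !ffunE.
Qed.

Lemma ev_inj s : (forall x, ev s x = 0) -> s = 0.
Proof.
move=> s0; apply/ffunP => -[j g]; rewrite ffunE.
have : (fun j => [ffun g => s (j, g)] : SG) =1 (fun=> 0).
  apply: row_act_inj => x; rewrite -ev_row s0 /row_act big1 // => i _.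
  by rewrite skew_act0l.
by move=> /(_ j)/ffunP/(_ g); rewrite !ffunE.
Qed.

Definition Phi (u : M) : {ffun 'I_k -> SR} := [ffun j => phi j u].

Lemma Phi_linear : linear Phi.
Proof. by move=> r u v; apply/ffunP => j; rewrite !ffunE phiL. Qed.

Definition Zpred (s : Fr) : Prop := forall u, ev s (Phi u) = 0.

Lemma Zpred_submod : submod Zpred.
Proof.
split=> [u|a s s' h h' u]; first by rewrite /ev big1 // => jg _; rewrite ffunE mul0r.
by rewrite evD evZ h h' mulr0 addr0.
Qed.

Definition Zsub : submodule := Submodule Zpred_submod.
Local Notation Z := (submodule_type Zsub : lmodType S).

(* H = Hom_R(M, S) has depth two over S, so the syzygy Z of H has vanishing
   first Koszul homology on the variables. *)
Lemma Z_koszul (u : 'I_3 -> Z) : \sum_i mfps_var i *: u i = 0 ->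
  exists2 t : S, ~ mfps_max t & exists w : 'I_3 -> 'I_3 -> Z,
    [/\ forall i j, w j i = - w i j, forall i, w i i = 0 &
        forall i, t *: u i = \sum_j mfps_var j *: w i j].
Proof.
pose o0 : 'I_3 := ord0; pose o1 : 'I_3 := lift ord0 ord0.
pose o2 : 'I_3 := lift ord0 (lift ord0 ord0).
pose x : S := mfps_var o0; pose y : S := mfps_var o1; pose z : S := mfps_var o2.
have sum3 (V : zmodType) (E : 'I_3 -> V) : \sum_i E i = E o0 + E o1 + E o2.
  by rewrite !big_ord_recl big_ord0 addr0 addrA.
rewrite sum3 -/x -/y -/z => /(congr1 (@submodule_val _ _ Zsub)) /= uE.
pose v0 : Fr := submodule_val (u o0); pose v1 : Fr := submodule_val (u o1).
pose v2 : Fr := submodule_val (u o2).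
have {}uE : x *: v0 + y *: v1 + z *: v2 = 0 by [].
have reg : reg3 Fr x y z by apply/reg3_ffun/mfps_var_reg3.
have reg' : reg3 (S^o : lmodType S) x y z by apply/mfps_var_reg3.
have [|q [p [r [v2E v1E v0E]]]] := koszul_exact (eab := v2) (eac := - v1) (ebc := v0) reg.
  by apply: koszul_sign; rewrite -uE.
have Zv0 : Zpred v0 := submodule_valP (u o0).
have Zv1 : Zpred v1 := submodule_valP (u o1).
have Zv2 : Zpred v2 := submodule_valP (u o2).
have ev0 w : z * ev p (Phi w) = y * ev r (Phi w) :> S.
  by have := Zv0 w; rewrite v0E evB !evZ => /(subr0_eq).
have ev2 w : y * ev q (Phi w) = x * ev p (Phi w) :> S.
  by have := Zv2 w; rewrite v2E evB !evZ => /(subr0_eq).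
have yz : o1 != o2 by [].
(* The Koszul primitives p, q, r need not vanish on M. There z p = y r, so p is y times a functional
   eta; a lift e of eta, times y, x and z respectively, corrects p, q and r to elements of Z. *)
have /choice[eta etaE] : forall w, exists e : S, ev p (Phi w) = y * e.
  by move=> w; apply: (mfps_var_reg2 yz (ev0 w)).
have y0 : y <> 0 by apply: mfps_var_neq0.
have z0 : z <> 0 by apply: mfps_var_neq0.
have etaL : linear (eta : M -> SR).
  move=> a w w'; apply: (mfps_mulI y0); rewrite -etaE Phi_linear ev_linear !etaE.
  by rewrite !SR_scale; ring.
have [s sE] := phi_gen etaL.
pose e : Fr := [ffun jg => if jg.2 == gl_one G then s jg.1 else 0].
have eE w : ev e (Phi w) = eta w.
  rewrite evE sE; apply: eq_bigr => j _; rewrite (bigD1 (gl_one G)) //= ffunE eqxx.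
  rewrite gl_act1 ffunE big1 ?addr0 // => g /negPf ne.
  by rewrite ffunE /= ne mul0r.
have evr w : ev r (Phi w) = z * eta w :> S.
  by apply: (mfps_mulI y0); rewrite -ev0 etaE mulrCA.
have evq w : ev q (Phi w) = x * eta w :> S.
  by apply: (mfps_mulI y0); rewrite ev2 etaE mulrCA.
have Zp : Zpred (p - y *: e) by move=> w; rewrite evB evZ eE etaE subrr.
have Zr : Zpred (r - z *: e) by move=> w; rewrite evB evZ eE evr subrr.
have Zq : Zpred (q - x *: e) by move=> w; rewrite evB evZ eE evq subrr.
pose p' : Z := submodule_elt (W := Zsub) Zp.
pose r' : Z := submodule_elt (W := Zsub) Zr.
pose q' : Z := submodule_elt (W := Zsub) Zq.
have u0E : u o0 = z *: p' - y *: r'.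
  by apply: submodule_val_inj; rewrite -/v0 v0E; apply: koszul_shift.
have u1E : u o1 = x *: r' - z *: q'.
  by apply: submodule_val_inj; rewrite -/v1 -[v1]opprK v1E opprB; apply: koszul_shift.
have u2E : u o2 = y *: q' - x *: p'.
  by apply: submodule_val_inj; rewrite -/v2 v2E; apply: koszul_shift.
exists 1; first by case: (@mfps_local 3 F).1.
pose up (i j : 'I_3) : Z := if (i == o0) && (j == o1) then - r'
  else if (i == o0) && (j == o2) then p' else if (i == o1) && (j == o2) then - q' else 0.
exists (fun i j => up i j - up j i).
split=> [i j|i|i]; [by rewrite opprB | by rewrite subrr |].
rewrite scale1r sum3.
have [|[]] : i = o0 \/ i = o1 \/ i = o2.
- by case: i => -[|[|[|//]]] lt; [left | right; left | right; right]; apply: val_inj.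
- by move=> ->; rewrite /up /= u0E !subr0 scaler0 add0r scalerN addrC.
- by move=> ->; rewrite /up /= u1E subr0 !sub0r opprK subr0 scaler0 addr0 scalerN.
by move=> ->; rewrite /up /= u2E subr0 !sub0r opprK scaler0 addr0 scalerN addrC.
Qed.

(** The case of the maximal ideal in [koszul_free]: denominators outside it are units of S. *)
Lemma Z_basis : exists l (b : 'I_l -> Z), (forall v, span b v) /\
  forall c : 'I_l -> S, \sum_i c i *: b i = 0 -> forall i, c i = 0.
Proof.
have nS : noeth S := mfps_noeth ch0 (n := 3).
have fZ : fgmod Z.
  exact: (fgmod_submodule Zsub (fg_noeth nS (fgmod_ffun ('I_k * G)%type fgmod_self))).
have hmaxP := (@mfps_local 3 F).1; have mU := (@mfps_local 3 F).2.
have xm i : mfps_max (mfps_var i : S).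
  by rewrite /mfps_max /mfps_var /mfps_mono eq_sym -mdeg_eq0 mdeg1.
have xgen (p : S) : mfps_max p -> exists2 t : S, ~ mfps_max t &
    exists c : 'I_3 -> S, t * p = \sum_i c i * mfps_var i.
  move=> /maximal_ideal_vars[g gE]; exists 1; first by case: hmaxP.
  by exists g; rewrite mul1r gE; apply: eq_bigr => i _; rewrite mulrC.
have [l [b [t nt [bP bI]]]] := koszul_free nS hmaxP fZ xm xgen Z_koszul.
have [t' t't] := mU t nt.
exists l, b; split=> [v|c /bI c0 i].
  rewrite -[v]scale1r -t't mulrC -scalerA.
  have [c ->] := bP v; exists (fun i => t' * c i); rewrite scaler_sumr.
  by apply: eq_bigr => i _; rewrite scalerA.
by rewrite -[c i]mul1r -t't mulrAC c0 mul0r.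
Qed.

Lemma vanishing_functionals : exists l (Psi : 'I_l -> {ffun 'I_k -> SR} -> SR),
  [/\ forall a, linear (Psi a), forall a u, Psi a (Phi u) = 0,
      forall f : {ffun 'I_k -> SR} -> SR, linear f -> (forall u, f (Phi u) = 0) ->
        exists c : 'I_l -> S, forall x, f x = \sum_a (c a * Psi a x : S) &
      forall c : 'I_l -> S, (forall x, \sum_a (c a * Psi a x : S) = 0) ->
        forall a, c a = 0].
Proof.
have [l [b [bP b0]]] := Z_basis.
have valS (c : 'I_l -> S) :
    submodule_val (\sum_a c a *: b a) = \sum_a c a *: (submodule_val (b a) : Fr).
  by rewrite (big_morph (@submodule_val _ _ Zsub) (id1 := 0) (op1 := +%R)).
exists l, (fun a => ev (submodule_val (b a))); split=> [a|a u|f fL f0|c c0].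
- exact: ev_linear.
- exact: (submodule_valP (b a)).
- have [s sE] := ev_repr fL.
  have Zs : Zpred s by move=> u; rewrite -sE f0.
  have [c cE] := bP (submodule_elt (W := Zsub) Zs); exists c => x.
  rewrite sE; have -> : s = \sum_a c a *: (submodule_val (b a) : Fr) by rewrite -valS -cE.
  by rewrite ev_sum; apply: eq_bigr => a _; rewrite evZ.
apply: b0; apply: submodule_val_inj; rewrite valS; apply: ev_inj => x.
by rewrite ev_sum -[RHS](c0 x); apply: eq_bigr => a _; rewrite evZ.
Qed.

End Coresolution.

Section KoszulGluing.
Context {A : comNzRingType} (V : lmodType A) (a b c : A).

Lemma koszul_cocycle (u v w : V) :
  c *: (b *: u - a *: v) + a *: (c *: v - b *: w) = b *: (c *: u - a *: w).
Proof. mring. Qed.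

Lemma koszul_descend (u v p q : V) : b *: u - a *: v = b *: p - a *: q ->
  b *: (u - p) = a *: (v - q).
Proof. by move=> e; apply: (eq_by_sub e); mring. Qed.
End KoszulGluing.

(** * Averaging over G and exactness of the coresolution *)

Section Descent.
Context {F : fieldType} (ch0 : forall k, k.+1%:R != 0 :> F).
Context (G : finGLsubgroup 3 F).
Local Notation S := (mfps 3 F).
Local Notation R := (invariant_ring G).
Local Notation SR := (mfps_module G : lmodType R).
Local Notation vR := (@invariant_val 3 F G).
Local Notation SG := (skew_group_algebra G).
Context (hG : no_pseudo_reflection G).
Context (M : lmodType R) (k l : nat) (Phi : M -> {ffun 'I_k -> SR})
  (Psi : 'I_l -> {ffun 'I_k -> SR} -> SR).
Hypotheses (PhiL : linear Phi) (PsiL : forall a, linear (Psi a)).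
Hypothesis Psi_Phi : forall a u, Psi a (Phi u) = 0.
Hypothesis Psi_gen : forall f : {ffun 'I_k -> SR} -> SR, linear f ->
  (forall u, f (Phi u) = 0) ->
  exists c : 'I_l -> S, forall x, f x = \sum_a (c a * Psi a x : S).
Hypothesis Psi_free : forall c : 'I_l -> S,
  (forall x, \sum_a (c a * Psi a x : S) = 0) -> forall a, c a = 0.

Lemma Psi_free2 (c d : 'I_l -> S) :
  (forall x, \sum_a (c a * Psi a x : S) = \sum_a (d a * Psi a x : S)) ->
  forall a, c a = d a.
Proof.
move=> cd a; apply/eqP; rewrite -subr_eq0; apply/eqP.
apply: (Psi_free (c := fun a => c a - d a)) => x.
under eq_bigr do rewrite mulrBl.
by rewrite sumrB cd subrr.
Qed.

Lemma gl_act_linear (h : G) (f : {ffun 'I_k -> SR} -> SR) :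
  linear f -> linear (fun x => gl_act h (f x) : SR).
Proof. by move=> fL r x y; rewrite fL rmorphD !SR_scale rmorphM /= vR_act. Qed.

(* Psi is not equivariant, but each of its conjugates h Psi h^-1 is again a
   basis of the functionals that vanish on M. *)
Lemma descent_matrices : exists gam : G -> 'I_l -> 'I_l -> S,
  forall h a x, gl_act h (Psi a x : S) = \sum_c (gam h a c * Psi c x : S).
Proof.
have /choice[gam gamE] : forall ha : G * 'I_l, exists c : 'I_l -> S,
    forall x, gl_act ha.1 (Psi ha.2 x : S) = \sum_a (c a * Psi a x : S).
  move=> [h a]; apply: (Psi_gen (f := fun x => gl_act h (Psi a x : S))).
    exact: gl_act_linear.
  by move=> u; rewrite Psi_Phi; apply: raddf0.
by exists (fun h a => gam (h, a)) => h a x; rewrite (gamE (h, a)).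
Qed.

Context (gam : G -> 'I_l -> 'I_l -> S).
Hypothesis gamE : forall h a x,
  gl_act h (Psi a x : S) = \sum_c (gam h a c * Psi c x : S).

Lemma gam_cocycle h h' a d :
  gam (gl_mul h h') a d = \sum_c gl_act h (gam h' a c) * gam h c d.
Proof.
move: d; apply: Psi_free2 => x; rewrite -gamE gl_actM gamE raddf_sum /=.
under eq_bigr do rewrite rmorphM /= gamE mulr_sumr.
rewrite exchange_big; apply: eq_bigr => d _; rewrite mulr_suml.
by apply: eq_bigr => c _; rewrite mulrA.
Qed.

(** The Maschke average for the semilinear action of h as v |-> h(gam(h^-1) v). It projects S^l onto
    the vectors fixed by this action, those that G transforms like the values of Psi. *)
Definition proj (v : {ffun 'I_l -> SR}) : {ffun 'I_l -> SR} := [ffun a =>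
  inv_card G * \sum_h gl_act h (\sum_c (gam (gl_inv h) a c * v c : S))].

Definition PsiV x : {ffun 'I_l -> SR} := [ffun a => Psi a x].

Lemma PsiV_linear : linear PsiV.
Proof. by move=> r x y; apply/ffunP => a; rewrite !ffunE PsiL. Qed.

Lemma proj_linear : linear proj.
Proof.
move=> r v w; apply/ffunP => a; rewrite !ffunE SR_scale mulrCA -mulrDr.
congr (_ * _); rewrite mulr_sumr -big_split; apply: eq_bigr => h _ /=.
rewrite -{1}(vR_act r h) -rmorphM -rmorphD mulr_sumr -big_split.
congr (gl_act h _); apply: eq_bigr => c _ /=; rewrite !ffunE SR_scale.
by rewrite mulrDr mulrCA.
Qed.

Lemma proj_PsiV x : proj (PsiV x) = PsiV x.
Proof.
apply/ffunP => a; rewrite !ffunE -[RHS](inv_card_mul ch0 G); congr (_ * _).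
rewrite cardfE -sumr_const; apply: eq_bigr => h _.
under eq_bigr do rewrite ffunE.
by rewrite -gamE gl_actVK.
Qed.

Lemma gl_act_proj g w a :
  gl_act g (proj w a : S) = \sum_d (gam g a d * proj w d : S).
Proof.
rewrite ffunE rmorphM /= gl_act_const raddf_sum /=.
transitivity (inv_card G * \sum_h \sum_d gam g a d *
    gl_act h (\sum_c (gam (gl_inv h) d c * w c : S))).
  congr (_ * _); rewrite (reindex_onto (gl_mul (gl_inv g)) (gl_mul g)) /=; last first.
    by move=> h _; rewrite gl_mulKg.
  have gK : cancel (gl_mul (gl_inv g)) (gl_mul g).
    by move=> h; rewrite gl_mulA gl_mulgV gl_mul1g.
  apply: eq_big => [h|h _]; first by rewrite gK eqxx.
  rewrite -gl_actM gK.
  have -> : gl_inv (gl_mul (gl_inv g) h) = gl_mul (gl_inv h) g.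
    have inv_uniq x y : gl_mul y x = gl_one G -> gl_inv x = y.
      by move=> yx; rewrite -[LHS]gl_mul1g -yx -gl_mulA gl_mulgV gl_mulg1.
    by apply: inv_uniq; rewrite -gl_mulA gK gl_mulVg.
  rewrite [in LHS](eq_bigr (fun c =>
    \sum_d gl_act (gl_inv h) (gam g a d) * (gam (gl_inv h) d c * w c))).
    rewrite exchange_big raddf_sum /=; apply: eq_bigr => d _.
    by rewrite -mulr_sumr rmorphM /= gl_actVK.
  move=> c _; rewrite gam_cocycle mulr_suml; apply: eq_bigr => d _.
  by rewrite mulrA.
rewrite exchange_big mulr_sumr; apply: eq_bigr => d _.
by rewrite ffunE -mulr_sumr mulrCA.
Qed.

(** On vectors that transform like Psi, the group elements in an R-functional are absorbed by gam,
    and f becomes S-linear with coefficients t; vanishing on all values of Psi forces t = 0 by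
    freeness. *)
Lemma proj_kernel (f : {ffun 'I_l -> SR} -> SR) : linear f ->
  (forall x, f (PsiV x) = 0) -> forall w, f (proj w) = 0.
Proof.
move=> fL f0 w; have [a aE] := row_act_repr ch0 hG fL.
pose t e : S := \sum_d \sum_g a d g * gam g d e.
have tE (v : {ffun 'I_l -> SR}) : (forall g d, gl_act g (v d : S) = \sum_e (gam g d e * v e : S)) ->
    f v = \sum_e (t e * v e : S).
  move=> vE; rewrite aE /row_act /skew_act.
  transitivity (\sum_d \sum_e (\sum_g a d g * gam g d e) * v e).
    apply: eq_bigr => d _.
    under eq_bigr do rewrite vE mulr_sumr.
    rewrite exchange_big; apply: eq_bigr => e _; rewrite mulr_suml.
    by apply: eq_bigr => g _; rewrite mulrA.
  by rewrite exchange_big; apply: eq_bigr => e _; rewrite mulr_suml.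
have t0 : forall e, t e = 0.
  apply: Psi_free => x; rewrite -[RHS](f0 x) tE => [|g d].
    by apply: eq_bigr => e _; rewrite ffunE.
  by rewrite ffunE gamE; apply: eq_bigr => e _; rewrite ffunE.
rewrite tE => [|g d]; last exact: (gl_act_proj g w d).
by rewrite big1 // => e _; rewrite t0 mul0r.
Qed.

Hypothesis M_tf : torsion_free M.

(* The Reynolds operator turns an extension M -> S of a functional M -> R to S^k
   into one with values in R. *)
Lemma Phi_splitting r :
  (forall f : M -> SR, linear f ->
     exists s : 'I_k -> S, forall u, f u = \sum_j (s j * Phi u j : S)) ->
  free_factor M r ->
  exists (h : {ffun 'I_k -> SR} -> M) (be : {ffun 'I_l -> SR} -> {ffun 'I_k -> SR}),
    [/\ linear h, linear be, forall u, h (Phi u) = r *: u &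
        forall x, r *: x = Phi (h x) + be (PsiV x)].
Proof.
move=> Phi_gen [T [al [mu [alL alE]]]].
have /choice[s sE] : forall t, exists s : 'I_k -> S,
    forall u, vR (al t u) = \sum_j (s j * Phi u j : S).
  move=> t; apply: (Phi_gen (fun u => vR (al t u))) => a u v.
  by rewrite alL vRD vRM.
pose ext t (x : {ffun 'I_k -> SR}) : R := reyn G (\sum_j (s t j * x j : S)).
have extD t a x y : ext t (a *: x + y) = a * ext t x + ext t y.
  rewrite /ext -reynM -reynD; congr (reyn G _).
  rewrite mulr_sumr -big_split; apply: eq_bigr => j _ /=.
  by rewrite !ffunE SR_scale mulrDr mulrCA.
pose h x := \sum_t ext t x *: mu t.
have hL : linear h.
  move=> a x y; rewrite /h scaler_sumr -big_split; apply: eq_bigr => t _ /=.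
  by rewrite extD scalerDl scalerA.
have hPhi u : h (Phi u) = r *: u.
  rewrite alE; apply: eq_bigr => t _; congr (_ *: _).
  by rewrite /ext -sE reyn_id.
have /choice[c cE] : forall j, exists c : 'I_l -> S, forall x : {ffun 'I_k -> SR},
    r *: x j - Phi (h x) j = \sum_a (c a * Psi a x : S).
  move=> j; apply: (Psi_gen (f := fun x : {ffun 'I_k -> SR} => r *: x j - Phi (h x) j)).
    by move=> a x y; rewrite hL PhiL !ffunE; mring.
  by move=> u; rewrite hPhi (linear_funZ _ _ PhiL) ffunE subrr.
exists h, (fun v : {ffun 'I_l -> SR} => [ffun j => \sum_a (c j a * v a : S)]); split=> //.
  move=> a v w; apply/ffunP => j; rewrite !ffunE SR_scale mulr_sumr -big_split.
  by apply: eq_bigr => d _ /=; rewrite !ffunE SR_scale mulrDr mulrCA.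
move=> x; apply/ffunP => j; rewrite !ffunE.
transitivity (Phi (h x) j + (r *: x j - Phi (h x) j)); first by rewrite addrC subrK.
by rewrite cE; congr (_ + _); apply: eq_bigr => a _; rewrite ffunE.
Qed.

Hypothesis iso : isolated_singularity R.
Context (a b c : R).
Hypothesis abc : CM_system M a b c.
Hypothesis Phi_gen : forall f : M -> SR, linear f ->
  exists s : 'I_k -> S, forall u, f u = \sum_j (s j * Phi u j : S).
Hypotheses (fa : free_factor M a) (fb : free_factor M b) (fc : free_factor M c).

(** The splittings over a and b show that a x and b x come from M; regularity of a, b on M then
    divides the preimage of a x by a. *)
Lemma Phi_exact x : PsiV x = 0 -> exists u, x = Phi u.
Proof.
have [[_ _ _ a0 reg] par] := abc.
have [ha [ba [haL baL haE ha_s]]] := Phi_splitting Phi_gen fa.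
have [hb [bb [hbL bbL hbE hb_s]]] := Phi_splitting Phi_gen fb.
have Phi_inj : injective Phi.
  move=> u v uv; apply: (tf_inj M_tf a0).
  by rewrite -!haE uv.
move=> x0.
have xa : a *: x = Phi (ha x) by rewrite ha_s x0 (linear_fun0 baL) addr0.
have xb : b *: x = Phi (hb x) by rewrite hb_s x0 (linear_fun0 bbL) addr0.
have [_ h2 _] := reg.
have [|m mE] := h2 (ha x) (hb x).
  by apply: Phi_inj; rewrite !(linear_funZ _ _ PhiL) -xa -xb !scalerA mulrC.
exists m; apply: (tf_inj (torsion_free_ffun (SR_tf (G := G))) a0).
by rewrite xa mE (linear_funZ _ _ PhiL).
Qed.

(* proj w is killed by the obstruction group, which is a-, b- and c-torsion; the
   partial lifts over a, b and c are glued by the Koszul complex of M. *)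
Lemma proj_lift w : exists x, proj w = PsiV x.
Proof.
have [[_ _ _ a0 reg] par] := abc.
have [ha [ba [haL baL haE ha_s]]] := Phi_splitting Phi_gen fa.
have [hb [bb [hbL bbL hbE hb_s]]] := Phi_splitting Phi_gen fb.
have [hc [bc [hcL bcL hcE hc_s]]] := Phi_splitting Phi_gen fc.
have Phi_inj : injective Phi.
  by move=> u v uv; apply: (tf_inj M_tf a0); rewrite -!haE uv.
have PsiVL := PsiV_linear.
have PsiPhi u : PsiV (Phi u) = 0 by apply/ffunP => d; rewrite !ffunE Psi_Phi.
(* On values of Psi, [be] followed by Psi is multiplication by r; [proj_kernel] carries this
   coordinatewise over to [proj w]. *)
have part r (h : {ffun 'I_k -> SR} -> M) be : linear h -> linear be ->
    (forall x, r *: x = Phi (h x) + be (PsiV x)) ->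
    PsiV (be (proj w)) = r *: proj w.
  move=> hL beL hE; apply/ffunP => d; rewrite [LHS]ffunE [RHS]ffunE.
  apply/eqP; rewrite -subr_eq0; apply/eqP.
  apply: (@proj_kernel (fun v : {ffun 'I_l -> SR} => Psi d (be v) - r *: v d)).
    by move=> q v v'; rewrite beL PsiL !ffunE; mring.
  move=> x; have -> : be (PsiV x) = r *: x - Phi (h x) by rewrite hE addrC addKr.
  by rewrite (linear_funB _ _ (PsiL d)) Psi_Phi subr0 (linear_funZ _ _ (PsiL d)) ffunE subrr.
have ua := part _ _ _ haL baL ha_s; have ub := part _ _ _ hbL bbL hb_s.
have uc := part _ _ _ hcL bcL hc_s.
move: (ba (proj w)) (bb (proj w)) (bc (proj w)) ua ub uc => ua ub uc uaE ubE ucE.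
have diff p q u v : PsiV u = p *: proj w -> PsiV v = q *: proj w ->
    exists m, q *: u - p *: v = Phi m.
  move=> uE vE; apply: Phi_exact; rewrite (linear_funB _ _ PsiVL).
  by rewrite !(linear_funZ _ _ PsiVL) uE vE !scalerA mulrC subrr.
have [mab mabE] := diff _ _ _ _ uaE ubE; have [mac macE] := diff _ _ _ _ uaE ucE.
have [mbc mbcE] := diff _ _ _ _ ubE ucE.
have cocycle : c *: mab + a *: mbc = b *: mac.
  apply: Phi_inj; rewrite PhiL !(linear_funZ _ _ PhiL) -mabE -mbcE -macE.
  exact: koszul_cocycle.
have [na [nb [nc [e1 e2 _]]]] := koszul_exact reg cocycle.
(* After the Koszul correction by elements of M the three lifts are proportional, and
   [parameters_glue] divides each coordinate of va by a. *)
pose va := ua - Phi na; pose vb := ub - Phi nb; pose vc := uc - Phi nc.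
have e1' : b *: va = a *: vb.
  apply: koszul_descend; rewrite mabE e1 (linear_funB _ _ PhiL).
  by rewrite !(linear_funZ _ _ PhiL).
have e2' : c *: va = a *: vc.
  apply: koszul_descend; rewrite macE e2 (linear_funB _ _ PhiL).
  by rewrite !(linear_funZ _ _ PhiL).
have /choice[x xE] : forall j, exists y, va j = a *: y.
  move=> j; apply: (parameters_glue ch0 a0 par (v := vb j) (w := vc j)).
    by have /ffunP/(_ j) := e1'; rewrite !ffunE.
  by have /ffunP/(_ j) := e2'; rewrite !ffunE.
have vaE : va = a *: [ffun j => x j] by apply/ffunP => j; rewrite xE !ffunE.
exists [ffun j => x j]; apply: (tf_inj (torsion_free_ffun (SR_tf (G := G))) a0).
rewrite -(linear_funZ _ _ PsiVL) -vaE /va (linear_funB _ _ PsiVL) PsiPhi subr0.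
by rewrite uaE.
Qed.

End Descent.

(** * Cohen-Macaulay modules as kernels of surjections *)

Section Presentation.
Context {F : fieldType} (ch0 : forall k, k.+1%:R != 0 :> F).
Context (G : finGLsubgroup 3 F).
Local Notation S := (mfps 3 F).
Local Notation R := (invariant_ring G).
Local Notation SR := (mfps_module G : lmodType R).
Local Notation SP n := ({ffun 'I_n -> SR} : lmodType R).
Context (hG : no_pseudo_reflection G) (iso : isolated_singularity R).

(* i identifies M with ker f up to a morphism of ker f that factors through S^m. *)
Definition surjective_presentation (M : lmodType R) k l m (f : SP k -> SP l)
    (i : M -> SP k) (p : SP k -> SP m) (q : SP m -> SP k) : Prop :=
  [/\ linear f, linear i, linear p, linear q & forall u, p (i u) = 0] /\
  [/\ forall y, exists x, f x = y, injective i, forall u, f (i u) = 0,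
      forall v, f (q v) = 0 &
      forall x, f x = 0 -> exists u, x = i u + q (p x)].

Lemma CM_presentation (M : lmodType R) : maximal_CM M ->
  exists k l m (f : SP k -> SP l) (i : M -> SP k) (p : SP k -> SP m) (q : SP m -> SP k),
    surjective_presentation f i p q.
Proof.
move=> CM; have [fM tM [a0 [b0 [c0 [[ma mb mc a00 reg0] par0]]]] ff] := CM_data ch0 iso CM.
have [ea fa] := ff _ ma; have [eb fb] := ff _ mb; have [ec fc] := ff _ mc.
(* Exponents are made positive, so that the powers stay in the maximal ideal. *)
have ffS z i : free_factor M (z ^+ i) -> free_factor M (z ^+ i.+1).
  by move=> zi; rewrite exprS; apply: (idealMl _ (free_factor_ideal M) zi).
move: fa fb fc => /ffS fa /ffS fb /ffS fc.
have maxX (z : R) i : maxR z -> maxR (z ^+ i.+1).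
  by have [[hI _ _] _] := inv_local G; move=> mz; rewrite exprSr; apply: (idealMl _ hI mz).
have abc : CM_system M (a0 ^+ ea.+1) (b0 ^+ eb.+1) (c0 ^+ ec.+1).
  split; last by move=> P hP /(primeX hP) ? /(primeX hP) ? /(primeX hP) ?; apply: par0.
  split; [exact: maxX|exact: maxX|exact: maxX| |exact: reg3_expn].
  elim: (ea) => // j IHj; rewrite exprS => /R_domain[] //.
have [k [phi [phiL phi_gen]]] := hom_generators ch0 iso CM.
have [l [Psi [PsiL Psi0 Psi_gen Psi_free]]] := vanishing_functionals ch0 hG phiL phi_gen.
have PhiL : linear (Phi phi) := Phi_linear phiL.
have [gam gamE] := descent_matrices PsiL Psi0 Psi_gen.
have Phi_gen (f : M -> SR) : linear f ->
    exists s : 'I_k -> S, forall u, f u = \sum_j (s j * Phi phi u j : S).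
  move=> fL; have [s sE] := phi_gen f fL; exists s => u; rewrite sE.
  by apply: eq_bigr => j _; rewrite ffunE.
have exact := Phi_exact ch0 PhiL Psi_gen tM abc Phi_gen fa fb.
have lift := proj_lift ch0 hG PhiL PsiL Psi0 Psi_gen Psi_free gamE tM abc Phi_gen fa fb fc.
have pr_Psi := proj_PsiV ch0 gamE.
have PhiI : injective (Phi phi).
  have [[_ _ _ a0' _] _] := abc; move=> u v uv; apply: (tf_inj tM a0').
  have [h [be [_ _ hE _]]] := Phi_splitting ch0 PhiL Psi_gen Phi_gen fa.
  by rewrite -!hE uv.
move: (proj_linear gam) (PsiV_linear PsiL) => prL PsiVL.
have PsiPhi u : PsiV Psi (Phi phi u) = 0 by apply/ffunP => d; rewrite !ffunE Psi0.
move: (PsiV Psi) (proj gam) (Phi phi) exact lift pr_Psi prL PsiVL PhiL PhiI PsiPhi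
  => Ps pr Ph exact lift pr_Psi prL PsL PhL PhI PsPh.
have prpr w : pr (pr w) = pr w by have [x ->] := lift w; apply: pr_Psi.
pose x1 (z : SP (k + l)) : SP k := [ffun j => z (lshift l j)].
pose x2 (z : SP (k + l)) : SP l := [ffun j => z (rshift k j)].
pose gl (x : SP k) (v : SP l) : SP (k + l) :=
  [ffun j => match split j with inl j1 => x j1 | inr j2 => v j2 end].
have gl1 x v : x1 (gl x v) = x.
  by apply/ffunP => j; rewrite !ffunE -[lshift l j]/(unsplit (inl j)) unsplitK.
have gl2 x v : x2 (gl x v) = v.
  by apply/ffunP => j; rewrite !ffunE -[rshift k j]/(unsplit (inr j)) unsplitK.
have glE z : z = gl (x1 z) (x2 z).
  by apply/ffunP => j; rewrite ffunE -{1}(splitK j); case: (split j) => j'; rewrite ffunE.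
have x1L : linear x1 by move=> r z z'; apply/ffunP => j; rewrite !ffunE.
have x2L : linear x2 by move=> r z z'; apply/ffunP => j; rewrite !ffunE.
have glL r x v x' v' : gl (r *: x + x') (r *: v + v') = r *: gl x v + gl x' v'.
  by apply/ffunP => j; rewrite !ffunE; case: (split j) => j'; rewrite !ffunE.
exists (k + l)%N, l, l, (fun z => Ps (x1 z) + (x2 z - pr (x2 z))), (fun u => gl (Ph u) 0), x2,
  (fun v => gl 0 (pr v)).
have Ps0 : Ps 0 = 0 by apply: linear_fun0.
have pr0 : pr 0 = 0 by apply: linear_fun0.
split; split=> //.
- move=> r z z'; rewrite x1L x2L PsL prL; mring.
- by move=> r u v; rewrite PhL -glL scaler0 addr0.
- by move=> r u v; rewrite prL -glL scaler0 addr0.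
(* Psi x supplies pi y and the second component supplies y - pi y. *)
- move=> y; have [x xE] := lift y; exists (gl x y).
  by rewrite gl1 gl2 -xE addrC subrK.
- by move=> u v /(congr1 x1); rewrite !gl1 => /PhI.
- by move=> u; rewrite gl1 gl2 PsPh pr0 subrr addr0.
- by move=> v; rewrite gl1 gl2 Ps0 prpr subrr addr0.
move=> z z0; have Ps_z : Ps (x1 z) = 0.
  have := congr1 pr z0; rewrite pr0 (linear_funD _ _ prL) pr_Psi (linear_funB _ _ prL).
  by rewrite prpr subrr addr0.
have [u uE] := exact _ Ps_z; exists u; rewrite [LHS]glE uE.
have -> : pr (x2 z) = x2 z.
  by move: z0; rewrite Ps_z add0r => /subr0_eq.
rewrite -[X in X + _]scale1r -glL !scale1r addr0 add0r //.
Qed.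
End Presentation.

(** * The depth of a kernel *)

Section GeneralModules.
Context {A : comNzRingType}.

Lemma span_mul_full m (M : lmodType A) (s : seq A) : local_with m -> fgmod M ->
  (forall a, a \in s -> m a) -> (forall x : M, span_mul s x) -> forall x : M, x = 0.
Proof.
move=> hm fM; elim/last_ind: s => [|s a IHs] sm sM.
  by move=> x; apply/span_mul_nil.
apply: IHs => [b bs|x]; first by apply: sm; rewrite mem_rcons inE bs orbT.
have ma : m a by apply: sm; rewrite mem_rcons inE eqxx.
have fgT : fgsub (fun _ : M => True).
  by case: fM => T [b bP]; exists T, b.
have K := nakayama hm ma (@span_mul_submod A M s) fgT.
apply: K I => u _; have /span_mul_rcons[l [v [ls uE]]] := sM u.
by exists l, v.
Qed.

Section Kernel.
Context (V W : lmodType A) (f : V -> W) (fL : linear f).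

Lemma kernel_submod : submod (fun x => f x = 0).
Proof.
split=> [|a x y x0 y0]; first exact: linear_fun0.
by rewrite fL x0 y0 scaler0 addr0.
Qed.

Definition kernel : submodule := Submodule kernel_submod.

(** In u = a x + b y the terms x, y need not lie in the kernel, but a f(x) + b f(y) = 0 gives f(y) =
    a z; a lift t of z moves them there as x + b t and y - a t. *)
Lemma reg3_kernel a b c : (forall y, exists x, f x = y) ->
  reg3 V a b c -> reg3 W a b c -> reg3 (submodule_type kernel) a b c.
Proof.
move=> f_surj [v1 v2 v3] [w1 w2 _]; split.
- move=> u /(congr1 (@submodule_val _ _ kernel)) u0; apply: submodule_val_inj.
  exact: v1.
- move=> u v /(congr1 (@submodule_val _ _ kernel)) uv; have [w wE] := v2 _ _ uv.
  have fw : f w = 0.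
    apply: w1; rewrite -(linear_funZ _ _ fL) -wE; exact: (submodule_valP u).
  by exists (submodule_elt (W := kernel) fw); apply: submodule_val_inj.
move=> u v w /(congr1 (@submodule_val _ _ kernel)) uvw; have [x [y xyE]] := v3 _ _ _ uvw.
have fxy : a *: f x + b *: f y = 0.
  have := submodule_valP u : f (submodule_val u) = 0.
  by rewrite xyE (linear_funD _ _ fL) !(linear_funZ _ _ fL).
have [|z zE] := w2 (f y) (- f x).
  by apply: (eq_by_sub fxy); mring.
have [t tE] := f_surj z; have fy : f (y - a *: t) = 0.
  by rewrite linear_funB // linear_funZ // tE zE subrr.
have fx : f (x + b *: t) = 0.
  apply: w1; rewrite linear_funD // linear_funZ // tE.
  by apply: (eq_by_sub fxy); rewrite zE; mring.
exists (submodule_elt (W := kernel) fx), (submodule_elt (W := kernel) fy).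
apply: submodule_val_inj; rewrite xyE.
rewrite -[RHS]/(a *: (x + b *: t) + b *: (y - a *: t)); mring.
Qed.
End Kernel.
End GeneralModules.

Section KernelCM.
Context {F : fieldType} (ch0 : forall k, k.+1%:R != 0 :> F).
Context (G : finGLsubgroup 3 F).
Local Notation R := (invariant_ring G).
Local Notation SR := (mfps_module G : lmodType R).
Local Notation SP n := ({ffun 'I_n -> SR} : lmodType R).

Lemma kernel_CM k l (f : SP k -> SP l) (fL : linear f) :
  (forall y, exists x, f x = y) -> maximal_CM (submodule_type (kernel fL)).
Proof.
move=> f_surj; have nR : noeth R := @inv_noeth 3 F ch0 G; have hm := inv_local G.
have fM : fgmod (submodule_type (kernel fL)).
  by apply: fgmod_submodule; apply: (fg_noeth nR); apply: fgmod_ffun; apply: SR_fgmod.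
split; first exact/fgmodP.
have [?|nz] := EM (forall x : submodule_type (kernel fL), x = 0); [by left | right].
exists 3%N; first exact: inv_krull_dim.
split; last by move=> s; apply: (regular_size nR hm (@inv_dim _ _ ch0 G)).
have [t1 [t2 [t3 [m1 m2 m3 reg]]]] := exists_theta ch0 G.
exists [:: t1; t2; t3] => //.
have sm a : a \in [:: t1; t2; t3] -> maxR a.
  by rewrite !inE => /or3P[] /eqP ->.
split=> [a /sm /(nonunitP _ hm) //| |].
  by apply/reg3_regular/reg3_kernel => //; apply: reg3_ffun.
apply: contrapT => h; apply: nz; apply: (span_mul_full hm fM sm) => x.
by apply: contrapT => nx; apply: h; exists x.
Qed.

(** A direct sum of m summands of S is a retract of S^m, so powers of S suffice as intermediate
    objects. *)
Lemma factors_through_powers (M N : lmodType R) (f : M -> N) :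
  factors_through_add SR f <->
  exists m (a : M -> SP m) (b : SP m -> N), [/\ linear a, linear b & forall x, f x = b (a x)].
Proof.
split=> [[X [I [P [PS [inj [proj [ij ij0 XE]]]]]] [a [b fE]]]|[m [a [b [aL bL fE]]]]].
  have PS' : forall i, exists d : (P i -> SR) * (SR -> P i),
      [/\ linear d.1, linear d.2 & forall x, d.2 (d.1 x) = x].
    move=> i; have [Q [g [g' gK g'K]]] := PS i.
    exists ((fun x => g (x, 0)), (fun s => (g' s).1)); split=> /=.
    - move=> r x y; rewrite -linearP; congr (g _); congr pair.
      by rewrite /= scaler0 addr0.
    - move=> r x y; have -> : g' (r *: x + y) = r *: g' x + g' y.
        by rewrite -[RHS]gK linearP !g'K.
      by [].
    - by move=> x; rewrite gK.
  pose d i := sval (cid (PS' i)); have dE i := svalP (cid (PS' i)).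
  pose m := #|I|.
  exists m, (fun x => [ffun j => (d (enum_val j)).1 (proj (enum_val j) (a x))]),
    (fun s : SP m => b (\sum_j inj (enum_val j) ((d (enum_val j)).2 (s j)))).
  split=> [r x y|r x y|x].
  - apply/ffunP => j; rewrite !ffunE !linearP.
    by have [-> _ _] := dE (enum_val j).
  - rewrite -linearP; congr (b _); rewrite scaler_sumr -big_split.
    apply: eq_bigr => j _ /=; rewrite !ffunE -linearP; congr (inj _ _).
    by have [_ -> _] := dE (enum_val j).
  rewrite fE /=; congr (b _); rewrite [LHS]XE.
  rewrite (reindex _ (onW_bij _ (enum_val_bij I))) /=; apply: eq_bigr => j _.
  by rewrite ffunE; have [_ _ ->] := dE (enum_val j).
exists (SP m).
  exists 'I_m, (fun=> SR); split.
    move=> i; have L : linear (fun x : SR * ('rV[R]_0) => x.1) by [].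
    exists 'rV[R]_0, (linear_of L), (fun s => (s, 0)) => [[s x]|s] //=.
    by rewrite [x]thinmx0.
  exists (fun i => linear_of (@ffun_delta_linear _ G _ i)).
  have evL (i : 'I_m) : linear (fun x : SP m => x i) by move=> r x y; rewrite !ffunE.
  exists (fun i => linear_of (evL i)); split=> [i x|i j x ne|x] /=.
  - by rewrite ffunE eqxx.
  - by rewrite ffunE eq_sym (negPf ne).
  - exact: ffun_delta_sum.
by exists (linear_of aL), (linear_of bL).
Qed.
End KernelCM.

(** * Presentations over the skew group algebra *)

Section MatrixAction.
Context {F : fieldType} (ch0 : forall k, k.+1%:R != 0 :> F).
Context (G : finGLsubgroup 3 F).
Local Notation R := (invariant_ring G).
Local Notation SR := (mfps_module G : lmodType R).
Local Notation SG := (skew_group_algebra G).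
Local Notation SP n := ({ffun 'I_n -> SR} : lmodType R).

Definition mx_act k l (A : 'M[SG]_(l, k)) (x : SP k) : SP l :=
  [ffun j => row_act (A j) x].

Lemma mx_act_linear k l (A : 'M[SG]_(l, k)) : linear (mx_act A).
Proof. by move=> r x y; apply/ffunP => j; rewrite !ffunE row_act_linear. Qed.

Lemma skew_act_sum (T : finType) (E : T -> SG) s :
  skew_act (\sum_i E i) s = \sum_i skew_act (E i) s.
Proof.
apply: (big_morph (fun a => skew_act a s)) => [a b|]; first exact: skew_actDl.
exact: skew_act0l.
Qed.

Lemma mx_actM k l m (A : 'M[SG]_(m, l)) (B : 'M[SG]_(l, k)) x :
  mx_act (A *m B) x = mx_act A (mx_act B x).
Proof.
apply/ffunP => j; rewrite !ffunE /row_act.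
transitivity (\sum_i \sum_h skew_act (A j h) (skew_act (B h i) (x i))).
  apply: eq_bigr => i _; rewrite mxE skew_act_sum; apply: eq_bigr => h _.
  exact: skew_actM.
rewrite exchange_big; apply: eq_bigr => h _; rewrite ffunE.
by rewrite /row_act (linear_fun_sum _ (@skew_act_linear _ _ G (A j h))).
Qed.

Lemma mx_act1 k (x : SP k) : mx_act 1%:M x = x.
Proof.
apply/ffunP => j; rewrite ffunE /row_act (bigD1 j) //= mxE eqxx skew_act1.
rewrite big1 ?addr0 // => i /negPf ne; rewrite mxE eq_sym ne; exact: skew_act0l.
Qed.

Lemma mx_actB k l (A B : 'M[SG]_(l, k)) x : mx_act (A - B) x = mx_act A x - mx_act B x.
Proof.
apply/ffunP => j; rewrite !ffunE /row_act -sumrB; apply: eq_bigr => i _.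
by rewrite !mxE skew_actDl skew_actNl.
Qed.

Lemma mx_act_inj k l (A B : 'M[SG]_(l, k)) : (forall x, mx_act A x = mx_act B x) -> A = B.
Proof.
move=> AB; apply/matrixP => j; apply: row_act_inj => x.
by have /ffunP/(_ j) := AB x; rewrite !ffunE.
Qed.

Lemma mx_act_repr k l (f : SP k -> SP l) : no_pseudo_reflection G -> linear f ->
  exists A : 'M[SG]_(l, k), forall x, f x = mx_act A x.
Proof.
move=> hG fL; have /choice[a aE] : forall j, exists a : 'I_k -> SG,
    forall x, f x j = row_act a x.
  by move=> j; apply: (row_act_repr ch0 hG) => r x y; rewrite fL !ffunE.
exists (\matrix_(j, i) a j i) => x; apply/ffunP => j; rewrite ffunE aE.
by apply: eq_bigr => i _; rewrite mxE.
Qed.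

End MatrixAction.

Section Columns.
Context {A : pzRingType}.

Lemma matrix_columns k l (B C : 'M[A]_(l, k)) :
  (forall j, B *m delta_mx j (0 : 'I_1) = C *m delta_mx j 0) -> B = C.
Proof.
move=> BC; apply/matrixP => i j; have := BC j.
by rewrite -!colE => /matrixP/(_ i 0); rewrite !mxE.
Qed.

Lemma matrix_of_columns k l (c : 'I_k -> 'cV[A]_l) :
  exists B : 'M[A]_(l, k), forall j, B *m delta_mx j (0 : 'I_1) = c j.
Proof.
exists (\matrix_(i, j) c j i 0) => j; rewrite -colE.
by apply/matrixP => i o; rewrite ord1 !mxE.
Qed.

Lemma column_decomposition l (w : 'cV[A]_l) :
  w = \sum_j delta_mx j (0 : 'I_1) *m (w j 0)%:M.
Proof.
apply/matrixP => i o; rewrite ord1 summxE (bigD1 i) //= big1 ?addr0 => [|j ne].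
  by rewrite !mxE big_ord1 !mxE eqxx mul1r mulr1n.
by rewrite !mxE big_ord1 !mxE eq_sym (negPf ne) mul0r.
Qed.
End Columns.

Section SpanObjects.
Context {F : fieldType} (ch0 : forall k, k.+1%:R != 0 :> F).
Context (G : finGLsubgroup 3 F).
Local Notation R := (invariant_ring G).
Local Notation SR := (mfps_module G : lmodType R).
Local Notation SG := (skew_group_algebra G).
Local Notation SP n := ({ffun 'I_n -> SR} : lmodType R).
Local Notation Q := (quot_by (skew_idempotent G)).

Definition to_quot (a : SG) : Q^c := (\pi_Q a)%qT.

(** Right modules over the quotient are left modules over its converse; a column, with scalars on
    the right, becomes a row with scalars on the left. *)
Definition to_quot_row l (v : 'cV[SG]_l) : 'rV[Q^c]_l := \row_j to_quot (v j 0).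

(* so_mod is the cokernel of so_mx on columns over S * G; it is a quotient of Q^l
   because so_mx is surjective on S^k, so that its image contains (e)^l. *)
Record span_object := SpanObject {
  so_k : nat;
  so_l : nat;
  so_mx : 'M[SG]_(so_l, so_k);
  so_surj : forall y, exists x, mx_act so_mx x = y;
  so_mod : lmodType Q^c;
  so_fp : finitely_presented so_mod;
  so_proj : {linear 'rV[Q^c]_so_l -> so_mod};
  so_proj_surj : forall y, exists x, so_proj x = y;
  so_proj_ker : forall v, so_proj (to_quot_row v) = 0 <-> exists w, v = so_mx *m w }.

End SpanObjects.

(** * Morphisms of presentations *)

Section SpanRelation.
Context {F : fieldType} (ch0 : forall k, k.+1%:R != 0 :> F).
Context (G : finGLsubgroup 3 F).
Local Notation R := (invariant_ring G).
Local Notation SR := (mfps_module G : lmodType R).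
Local Notation SG := (skew_group_algebra G).
Local Notation SP n := ({ffun 'I_n -> SR} : lmodType R).
Local Notation Q := (quot_by (skew_idempotent G)).
Implicit Types (t : span_object G) (a b : SG).

Lemma to_quotD a b : to_quot (a + b) = to_quot a + to_quot b.
Proof. exact: quot_piD. Qed.
Lemma to_quotM a b : to_quot (a * b) = to_quot b * to_quot a.
Proof. exact: quot_piM. Qed.
Lemma to_quot_surj (x : Q^c) : exists a, to_quot a = x.
Proof. by exists (repr x); rewrite /to_quot reprK. Qed.

Definition so_col t (w : 'cV[SG]_(so_l t)) : so_mod t := so_proj t (to_quot_row w).

Lemma so_colD t w w' : so_col (w + w') = so_col w + so_col w' :> so_mod t.
Proof.
rewrite /so_col -raddfD; congr (so_proj t _); apply/rowP => j.
by rewrite !mxE to_quotD.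
Qed.

Lemma so_colZ t w a : so_col (w *m a%:M) = to_quot a *: (so_col w : so_mod t).
Proof.
rewrite /so_col -linearZ; congr (so_proj t _); apply/rowP => j.
by rewrite !mxE big_ord1 !mxE mulr1n to_quotM.
Qed.

Lemma so_col_surj t (y : so_mod t) : exists w, so_col w = y.
Proof.
have [x <-] := so_proj_surj y; have /choice[c cE] := to_quot_surj.
exists (\col_j c (x 0 j)); congr (so_proj t _); apply/rowP => j.
by rewrite !mxE cE.
Qed.

Lemma so_col_ker t w : so_col w = 0 :> so_mod t <-> exists w', w = so_mx t *m w'.
Proof. exact: so_proj_ker. Qed.

Lemma so_colB t w w' : so_col (w - w') = so_col w - so_col w' :> so_mod t.
Proof. by apply/eqP; rewrite eq_sym subr_eq -so_colD subrK. Qed.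

Lemma so_col_ext t (N : lmodType Q^c) (p q : 'cV[SG]_(so_l t) -> N) :
  (forall w w', p (w + w') = p w + p w') -> (forall w w', q (w + w') = q w + q w') ->
  (forall w a, p (w *m a%:M) = to_quot a *: p w) ->
  (forall w a, q (w *m a%:M) = to_quot a *: q w) ->
  (forall j, p (delta_mx j 0) = q (delta_mx j 0)) -> p =1 q.
Proof.
move=> pD qD pZ qZ pq w.
have add0 (h : 'cV[SG]_(so_l t) -> N) : (forall w w', h (w + w') = h w + h w') -> h 0 = 0.
  by move=> hD; apply: (addrI (h 0)); rewrite -hD !addr0.
rewrite [w]column_decomposition (big_morph p pD (add0 p pD)) (big_morph q qD (add0 q qD)).
by apply: eq_bigr => j _; rewrite pZ qZ pq.
Qed.

Definition so_kernel t : submodule := kernel (mx_act_linear (so_mx t)).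

Definition so_CM t : {M : lmodType R | maximal_CM M} :=
  exist _ (submodule_type (so_kernel t) : lmodType R)
    (kernel_CM ch0 (mx_act_linear (so_mx t)) (@so_surj _ _ t)).

Definition so_mod_ob t : {N : lmodType Q^c | finitely_presented N} :=
  exist _ (so_mod t) (so_fp t).

Section Restriction.
Context (s t : span_object G) (a0 : 'M[SG]_(so_k t, so_k s)) (a1 : 'M[SG]_(so_l t, so_l s)).
Hypothesis comm : so_mx t *m a0 = a1 *m so_mx s.

Lemma restrict_in (x : submodule_type (so_kernel s)) :
  mx_act (so_mx t) (mx_act a0 (submodule_val x)) = 0.
Proof.
rewrite -mx_actM comm mx_actM.
have -> : mx_act (so_mx s) (submodule_val x) = 0 := submodule_valP x.
exact: (linear_fun0 (mx_act_linear a1)).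
Qed.

Definition restrict_fun (x : submodule_type (so_kernel s)) : submodule_type (so_kernel t) :=
  submodule_elt (W := so_kernel t) (restrict_in x).

Lemma restrict_linear : linear restrict_fun.
Proof. by move=> r x y; apply: submodule_val_inj; apply: mx_act_linear. Qed.

Definition restrict : {linear sval (so_CM s) -> sval (so_CM t)} := linear_of restrict_linear.
End Restriction.

Definition CMQ := CM_quotient SR.
Definition modQ := mod_category Q^c.

(** One commuting square (a0, a1) induces c on kernels modulo [S] and v on cokernels. *)
Definition so_rel (s t : span_object G) (c : @hom CMQ (so_CM s) (so_CM t))
    (v : @hom modQ (so_mod_ob s) (so_mod_ob t)) : Prop :=
  exists (a0 : 'M[SG]_(so_k t, so_k s)) (a1 : 'M[SG]_(so_l t, so_l s))
      (comm : so_mx t *m a0 = a1 *m so_mx s),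
    c = quot_class (add_congruence (@maximal_CM R) SR) (restrict comm) /\
    forall w, (v : {linear so_mod s -> so_mod t}) (so_col w) = so_col (a1 *m w).

Lemma so_rel_id t : so_rel (@cat_id CMQ (so_CM t)) (@cat_id modQ (so_mod_ob t)).
Proof.
have comm : so_mx t *m 1%:M = 1%:M *m so_mx t by rewrite mulmx1 mul1mx.
exists 1%:M, 1%:M, comm; split=> [|w]; last by rewrite mul1mx.
congr (quot_class _ _); apply: linear_eqP => x; apply: submodule_val_inj.
by rewrite /= mx_act1.
Qed.

Lemma so_rel_comp s t u c c' v v' : @so_rel t u c' v' -> @so_rel s t c v ->
  so_rel (@cat_comp CMQ _ _ _ c' c) (@cat_comp modQ _ _ _ v' v).
Proof.
move=> [a0' [a1' [comm' [-> vE']]]] [a0 [a1 [comm [-> vE]]]].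
have comm2 : so_mx u *m (a0' *m a0) = (a1' *m a1) *m so_mx s.
  by rewrite mulmxA comm' -mulmxA comm mulmxA.
exists (a0' *m a0), (a1' *m a1), comm2; split=> [|w].
  rewrite [LHS]quot_compE; congr (quot_class _ _).
  apply: linear_eqP => x; apply: submodule_val_inj.
  by rewrite /= mx_actM.
by rewrite -mulmxA -vE' -vE.
Qed.

Context (hG : no_pseudo_reflection G) (iso : isolated_singularity R).

Lemma so_extend s m (phi : submodule_type (so_kernel s) -> SP m) : linear phi ->
  exists2 psi : SP (so_k s) -> SP m, linear psi & forall x, psi (submodule_val x) = phi x.
Proof.
move=> phiL.
have /choice[psi psiE] : forall j, exists psi : SP (so_k s) -> SR,
    linear psi /\ forall x, psi (submodule_val x) = phi x j.
  move=> j.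
  have phijL : linear (fun x => phi x j) by move=> r x y; rewrite phiL !ffunE.
  have ker x : mx_act (so_mx s) x = 0 <->
      exists u : submodule_type (so_kernel s), x = submodule_val u.
    split=> [x0|[u ->]]; last exact: (submodule_valP u).
    by exists (submodule_elt (W := so_kernel s) x0).
  have [psi pL pE] := extend_from_kernel ch0 hG iso (@submodule_val_linear _ _ _)
    (mx_act_linear (so_mx s)) (@submodule_val_inj _ _ _) ker (@so_surj _ _ s) phijL.
  by exists psi.
exists (fun x => [ffun j => psi j x]) => [r x y|x]; apply/ffunP => j; rewrite !ffunE.
  by have [-> _] := psiE j.
by have [_ ->] := psiE j.
Qed.

Lemma so_factor s m (f : SP (so_k s) -> SP m) : linear f ->
  (forall x : submodule_type (so_kernel s), f (submodule_val x) = 0) ->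
  exists H : 'M[SG]_(m, so_l s), forall x, f x = mx_act H (mx_act (so_mx s) x).
Proof.
move=> fL f0.
have [r rE] := choice (@so_surj _ _ s).
have fE x x' : mx_act (so_mx s) x = mx_act (so_mx s) x' -> f x = f x'.
  move=> e; have d0 : mx_act (so_mx s) (x - x') = 0.
    by rewrite (linear_funB _ _ (mx_act_linear _)) e subrr.
  have := f0 (submodule_elt (W := so_kernel s) d0).
  by rewrite /= (linear_funB _ _ fL) => /subr0_eq.
have hL : linear (fun y => f (r y)).
  by move=> q x y; rewrite -fL; apply: fE; rewrite rE mx_act_linear !rE.
have [H HE] := mx_act_repr ch0 hG hL; exists H => x.
by rewrite -HE; apply: fE; rewrite rE.
Qed.

End SpanRelation.

Section SpanCorrespondence.
Context {F : fieldType} (ch0 : forall k, k.+1%:R != 0 :> F).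
Context (G : finGLsubgroup 3 F).
Local Notation R := (invariant_ring G).
Local Notation SR := (mfps_module G : lmodType R).
Local Notation SG := (skew_group_algebra G).
Local Notation SP n := ({ffun 'I_n -> SR} : lmodType R).
Local Notation Q := (quot_by (skew_idempotent G)).
Local Notation CMQ := (CMQ G).
Local Notation modQ := (modQ G).
Local Notation so_CM := (so_CM ch0).
Context (hG : no_pseudo_reflection G) (iso : isolated_singularity R).
Implicit Types (s t : span_object G).

(** The map of kernels extends to powers of S by [so_extend] and is a matrix a0 by Auslander;
    [so_mx t] composed with a0 kills the kernel of [so_mx s], so it factors through [so_mx s] as
    a1. *)
Lemma so_rel_total s t (c : @hom CMQ (so_CM s) (so_CM t)) :
  exists v, @so_rel _ ch0 G s t c v.
Proof.
elim/quot_ind: c => c.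
pose u : {linear submodule_type (so_kernel s) -> submodule_type (so_kernel t)} := c.
have uL : linear (fun x => submodule_val (u x)).
  by move=> r x y; rewrite linearP.
have [psi psiL psiE] := so_extend ch0 hG iso uL.
have [a0 a0E] := mx_act_repr ch0 hG psiL.
have [||a1 a1E] := @so_factor _ ch0 G hG s _ (fun x => mx_act (so_mx t) (mx_act a0 x)).
- by move=> r x y; rewrite !mx_act_linear.
- move=> x; rewrite -a0E psiE; exact: (submodule_valP (u x)).
have comm : so_mx t *m a0 = a1 *m so_mx s.
  by apply: mx_act_inj => x; rewrite !mx_actM a1E.
pose q w : so_mod t := so_col (a1 *m w).
have qE w w' : so_col w = so_col w' :> so_mod s -> q w = q w'.
  move=> e; have /so_col_ker[d dE] : so_col (w - w') = 0 :> so_mod s.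
    by rewrite so_colB e subrr.
  apply/eqP; rewrite -subr_eq0 -so_colB -mulmxBr dE mulmxA -comm -mulmxA.
  by apply/eqP/so_col_ker; exists (a0 *m d).
have [r rE] := choice (@so_col_surj _ _ s).
have vL : linear (fun y => q (r y) : so_mod t).
  move=> b y y'; have [b' <-] := to_quot_surj b.
  rewrite /q -so_colZ -so_colD -mulmxA -mulmxDr; apply: qE.
  by rewrite so_colD so_colZ !rE.
pose v : {linear so_mod s -> so_mod t} := linear_of vL.
exists v, a0, a1, comm; split=> [|w]; last by apply: qE; rewrite rE.
congr (quot_class _ _); apply: linear_eqP => x; apply: submodule_val_inj.
by rewrite /= -a0E psiE.
Qed.

(** Columns over S * G are free, so v lifts first to a1 and then, column by column, to a0. *)
Lemma so_rel_total' s t (v : @hom modQ (so_mod_ob s) (so_mod_ob t)) :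
  exists c, @so_rel _ ch0 G s t c v.
Proof.
pose f : {linear so_mod s -> so_mod t} := v.
have /choice[c cE] : forall j : 'I_(so_l s), exists c, so_col c = f (so_col (delta_mx j 0)).
  by move=> j; apply: so_col_surj.
have [a1 a1E] := matrix_of_columns c.
have fE w : f (so_col w) = so_col (a1 *m w).
  apply: (@so_col_ext _ _ s _ (fun w => f (so_col w)) (fun w => so_col (a1 *m w))).
  - by move=> w1 w2; rewrite so_colD raddfD.
  - by move=> w1 w2; rewrite mulmxDr so_colD.
  - by move=> w1 a; rewrite so_colZ linearZ.
  - by move=> w1 a; rewrite mulmxA so_colZ.
  - by move=> j; rewrite a1E cE.
have /choice[d dE] : forall j : 'I_(so_k s), exists d : 'cV[SG]_(so_k t),
    a1 *m (so_mx s *m delta_mx j 0) = so_mx t *m d.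
  move=> j; apply/so_col_ker; rewrite -fE.
  have -> : so_col (so_mx s *m delta_mx j 0) = 0 :> so_mod s.
    by apply/so_col_ker; exists (delta_mx j 0).
  exact: raddf0.
have [a0 a0E] := matrix_of_columns d.
have comm : so_mx t *m a0 = a1 *m so_mx s.
  by apply: matrix_columns => j; rewrite -!mulmxA a0E dE.
exists (quot_class (add_congruence (@maximal_CM R) SR) (restrict ch0 comm)), a0, a1, comm.
by split=> // w; apply: fE.
Qed.

(** On the kernel of [so_mx s], a0 - b0 agrees with a map through a power of S, which extends to h
    with values in the kernel of [so_mx t]. Then a0 - b0 - h = H [so_mx s]; composing with [so_mx t]
    gives a1 - b1 = [so_mx t] H, which is zero on cokernels. *)
Lemma so_rel_fun s t c v v' : @so_rel _ ch0 G s t c v -> @so_rel _ ch0 G s t c v' -> v = v'.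
Proof.
move=> [a0 [a1 [comm [cE vE]]]] [b0 [b1 [comm' [c'E v'E]]]].
have : quot_class (add_congruence (@maximal_CM R) SR) (restrict ch0 comm)
     = quot_class (add_congruence (@maximal_CM R) SR) (restrict ch0 comm').
  by rewrite -cE.
move=> /quot_classP/factors_through_powers[m [al [be [alL beL abE]]]].
have [psi psiL psiE] := so_extend ch0 hG iso alL.
pose h x := submodule_val (be (psi x)).
have hL : linear h by move=> r x y; rewrite /h psiL beL.
have [||H HE] := @so_factor _ ch0 G hG s _ (fun x => mx_act (a0 - b0) x - h x).
- by move=> r x y; rewrite mx_act_linear hL; mring.
- move=> x; rewrite /h psiE -abE mx_actB; exact: subrr.
have a1E : a1 - b1 = so_mx t *m H.
  apply: mx_act_inj => y; have [x <-] := @so_surj _ _ s y.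
  rewrite mx_actM -HE (linear_funB _ _ (mx_act_linear _)).
  have -> : mx_act (so_mx t) (h x) = 0 := submodule_valP (be (psi x)).
  by rewrite subr0 -!mx_actM mulmxBl mulmxBr comm comm'.
apply: linear_eqP => y; have [w <-] := @so_col_surj _ _ s y.
rewrite vE v'E; apply/eqP; rewrite -subr_eq0 -so_colB -mulmxBl a1E -mulmxA.
by apply/eqP/so_col_ker; exists (H *m w).
Qed.

(** Equality on cokernels gives a1 - b1 = [so_mx t] H. Then a0 - b0 - H [so_mx s] maps the whole
    source power of S into the kernel of [so_mx t] and agrees with a0 - b0 on the kernel of
    [so_mx s]. *)
Lemma so_rel_fun' s t c c' v : @so_rel _ ch0 G s t c v -> @so_rel _ ch0 G s t c' v -> c = c'.
Proof.
move=> [a0 [a1 [comm [-> vE]]]] [b0 [b1 [comm' [-> v'E]]]].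
have /choice[h hE] : forall j : 'I_(so_l s), exists h : 'cV[SG]_(so_k t),
    (a1 - b1) *m delta_mx j 0 = so_mx t *m h.
  by move=> j; apply/so_col_ker; rewrite mulmxBl so_colB -vE -v'E subrr.
have [H HE] := matrix_of_columns h.
have a1E : a1 - b1 = so_mx t *m H.
  by apply: matrix_columns => j; rewrite hE -mulmxA HE.
have kill x : mx_act (so_mx t) (mx_act (a0 - b0 - H *m so_mx s) x) = 0.
  rewrite -mx_actM mulmxBr mulmxA -a1E mulmxBr mulmxBl comm comm' subrr.
  by apply/ffunP => j; rewrite !ffunE /row_act big1 // => i _; rewrite mxE; apply: skew_act0l.
apply/quot_classP/factors_through_powers.
exists (so_k s), (@submodule_val _ _ (so_kernel s)),
  (fun x => submodule_elt (W := so_kernel t) (kill x)).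
split=> [//|r x y|x]; apply: submodule_val_inj; first exact: mx_act_linear.
rewrite /= !mx_actB mx_actM.
have -> : mx_act (so_mx s) (submodule_val x) = 0 := submodule_valP x.
by rewrite (linear_fun0 (mx_act_linear _)) subr0.
Qed.

End SpanCorrespondence.

(** * Categories related by a functional correspondence *)

Lemma comp_cancel (C : category) (X Y Z W : C) (a : hom Y Z) (b : hom W Y)
    (c : hom Y W) (d : hom X Y) : cat_comp b c = cat_id Y ->
  cat_comp (cat_comp a b) (cat_comp c d) = cat_comp a d.
Proof. by move=> bc; rewrite cat_compA -(cat_compA a) bc cat_compfid. Qed.

Section SpanEquivalence.
Context {C D : category} {T : Type} (p : T -> C) (q : T -> D).
Context (rel : forall s t, hom (p s) (p t) -> hom (q s) (q t) -> Prop).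
Hypothesis rel_id : forall t, rel (cat_id (p t)) (cat_id (q t)).
Hypothesis rel_comp : forall s t u c c' v v',
  @rel t u c' v' -> @rel s t c v -> rel (cat_comp c' c) (cat_comp v' v).
Hypothesis rel_total : forall s t c, exists v, @rel s t c v.
Hypothesis rel_total' : forall s t v, exists c, @rel s t c v.
Hypothesis rel_fun : forall s t c v v', @rel s t c v -> @rel s t c v' -> v = v'.
Hypothesis rel_fun' : forall s t c c' v, @rel s t c v -> @rel s t c' v -> c = c'.
Hypothesis p_surj : forall X, exists t (f : hom X (p t)), is_iso f.
Hypothesis q_surj : forall Y, exists t (f : hom Y (q t)), is_iso f.

Definition span_lift s t (c : hom (p s) (p t)) := sval (cid (rel_total c)).
Definition span_lift' s t (v : hom (q s) (q t)) := sval (cid (rel_total' v)).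

Lemma span_liftP s t c v : @rel s t c v <-> span_lift c = v.
Proof.
have h := svalP (cid (rel_total c)); split=> [r|<-] //.
exact: rel_fun h r.
Qed.

Lemma span_liftP' s t c v : @rel s t c v <-> span_lift' v = c.
Proof.
have h := svalP (cid (rel_total' v)); split=> [r|<-] //.
exact: rel_fun' h r.
Qed.

Lemma span_lift_comp s t u (c' : hom (p t) (p u)) (c : hom (p s) (p t)) :
  span_lift (cat_comp c' c) = cat_comp (span_lift c') (span_lift c).
Proof. by apply/span_liftP/rel_comp; apply/span_liftP. Qed.

Lemma span_lift_comp' s t u (v' : hom (q t) (q u)) (v : hom (q s) (q t)) :
  span_lift' (cat_comp v' v) = cat_comp (span_lift' v') (span_lift' v).
Proof. by apply/span_liftP'/rel_comp; apply/span_liftP'. Qed.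

Lemma span_lift_id t : span_lift (cat_id (p t)) = cat_id (q t).
Proof. exact/span_liftP. Qed.

Lemma span_lift_id' t : span_lift' (cat_id (q t)) = cat_id (p t).
Proof. exact/span_liftP'. Qed.

Lemma span_liftK s t (c : hom (p s) (p t)) : span_lift' (span_lift c) = c.
Proof. by apply/span_liftP'/span_liftP. Qed.

Lemma span_liftK' s t (v : hom (q s) (q t)) : span_lift (span_lift' v) = v.
Proof. by apply/span_liftP/span_liftP'. Qed.

Definition pob X := sval (cid (p_surj X)).
Definition pto X : hom X (p (pob X)) := sval (cid (svalP (cid (p_surj X)))).
Definition pinv X : hom (p (pob X)) X :=
  sval (cid (svalP (cid (svalP (cid (p_surj X)))))).
Lemma pinvK X : cat_comp (pinv X) (pto X) = cat_id X.
Proof. by case: (svalP (cid (svalP (cid (svalP (cid (p_surj X))))))). Qed.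
Lemma ptoK X : cat_comp (pto X) (pinv X) = cat_id (p (pob X)).
Proof. by case: (svalP (cid (svalP (cid (svalP (cid (p_surj X))))))). Qed.

Definition qob Y := sval (cid (q_surj Y)).
Definition qto Y : hom Y (q (qob Y)) := sval (cid (svalP (cid (q_surj Y)))).
Definition qinv Y : hom (q (qob Y)) Y :=
  sval (cid (svalP (cid (svalP (cid (q_surj Y)))))).
Lemma qinvK Y : cat_comp (qinv Y) (qto Y) = cat_id Y.
Proof. by case: (svalP (cid (svalP (cid (svalP (cid (q_surj Y))))))). Qed.
Lemma qtoK Y : cat_comp (qto Y) (qinv Y) = cat_id (q (qob Y)).
Proof. by case: (svalP (cid (svalP (cid (svalP (cid (q_surj Y))))))). Qed.

Definition conj_p X Y (f : hom X Y) : hom (p (pob X)) (p (pob Y)) :=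
  cat_comp (cat_comp (pto Y) f) (pinv X).
Definition conj_q X Y (f : hom X Y) : hom (q (qob X)) (q (qob Y)) :=
  cat_comp (cat_comp (qto Y) f) (qinv X).

Lemma conj_p_id X : conj_p (cat_id X) = cat_id (p (pob X)).
Proof. by rewrite /conj_p cat_compfid ptoK. Qed.
Lemma conj_q_id Y : conj_q (cat_id Y) = cat_id (q (qob Y)).
Proof. by rewrite /conj_q cat_compfid qtoK. Qed.

Lemma conj_p_comp X Y Z (f : hom Y Z) (g : hom X Y) :
  conj_p (cat_comp f g) = cat_comp (conj_p f) (conj_p g).
Proof.
rewrite /conj_p !cat_compA; congr (cat_comp _ _); congr (cat_comp _ _).
by rewrite -!(cat_compA _ (pinv Y)) pinvK cat_compfid.
Qed.
Lemma conj_q_comp X Y Z (f : hom Y Z) (g : hom X Y) :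
  conj_q (cat_comp f g) = cat_comp (conj_q f) (conj_q g).
Proof.
rewrite /conj_q !cat_compA; congr (cat_comp _ _); congr (cat_comp _ _).
by rewrite -!(cat_compA _ (qinv Y)) qinvK cat_compfid.
Qed.

Lemma span_functor_id X : span_lift (conj_p (cat_id X)) = cat_id (q (pob X)).
Proof. by rewrite conj_p_id span_lift_id. Qed.
Lemma span_functor_comp X Y Z (f : hom Y Z) (g : hom X Y) :
  span_lift (conj_p (cat_comp f g)) = cat_comp (span_lift (conj_p f)) (span_lift (conj_p g)).
Proof. by rewrite conj_p_comp span_lift_comp. Qed.
Definition span_functor : functor C D := Functor span_functor_id span_functor_comp.

Lemma span_functor_id' Y : span_lift' (conj_q (cat_id Y)) = cat_id (p (qob Y)).
Proof. by rewrite conj_q_id span_lift_id'. Qed.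
Lemma span_functor_comp' X Y Z (f : hom Y Z) (g : hom X Y) :
  span_lift' (conj_q (cat_comp f g)) = cat_comp (span_lift' (conj_q f)) (span_lift' (conj_q g)).
Proof. by rewrite conj_q_comp span_lift_comp'. Qed.
Definition span_functor' : functor D C := Functor span_functor_id' span_functor_comp'.

Lemma span_equivalence : equivalent_categories C D.
Proof.
exists span_functor, span_functor'; split.
  (* The way back from D starts at a chosen representative of [q (pob X)], which may differ from
     [pob X]; the comparison [qinv], lifted to C, joins the two. *)
  exists (fun X => cat_comp (pinv X) (span_lift' (qinv (q (pob X))))) => [X|X Y f].
    exists (cat_comp (span_lift' (qto (q (pob X)))) (pto X)); split.
      apply: etrans (comp_cancel _ _ (ptoK X)) _.
      by rewrite -span_lift_comp' qtoK span_lift_id'.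
    apply: etrans (comp_cancel _ _ _) _; last exact: pinvK.
    by rewrite -span_lift_comp' qinvK span_lift_id'.
  rewrite /= -cat_compA -span_lift_comp' /conj_q !cat_compA qinvK cat_compidf.
  rewrite span_lift_comp' span_liftK /conj_p !cat_compA pinvK cat_compidf.
  by [].
exists (fun Y => cat_comp (qinv Y) (span_lift (pinv (p (qob Y))))) => [Y|X Y f].
  exists (cat_comp (span_lift (pto (p (qob Y)))) (qto Y)); split.
    apply: etrans (comp_cancel _ _ (qtoK Y)) _.
    by rewrite -span_lift_comp ptoK span_lift_id.
  apply: etrans (comp_cancel _ _ _) _; last exact: qinvK.
  by rewrite -span_lift_comp pinvK span_lift_id.
rewrite /= -cat_compA -span_lift_comp /conj_p !cat_compA pinvK cat_compidf.
by rewrite span_lift_comp span_liftK' /conj_q !cat_compA qinvK cat_compidf.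
Qed.

End SpanEquivalence.

(** * Essential surjectivity *)

Section Cokernel.
Context {B : pzRingType} {U V : lmodType B} (g : {linear U -> V}).
Local Open Scope quotient_scope.

Definition image_pred : {pred V} := fun x => `[< exists w, g w = x >].

Lemma image_zmod_closed : zmod_closed image_pred.
Proof.
split=> [|_ _ /asboolP[w <-] /asboolP[w' <-]]; apply/asboolP.
  by exists 0; rewrite raddf0.
by exists (w - w'); rewrite raddfB.
Qed.

HB.instance Definition _ := GRing.isZmodClosed.Build V image_pred image_zmod_closed.

Definition cokernel : Type := Quotient.quot image_pred.
HB.instance Definition _ := GRing.Zmodule.on cokernel.
HB.instance Definition _ := Quotient.on cokernel.
HB.instance Definition _ := EqQuotient.on cokernel.

Definition cokernel_pi (x : V) : cokernel := \pi_cokernel x.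

Lemma cokernel_piP x y : cokernel_pi x = cokernel_pi y <-> exists w, g w = x - y.
Proof.
have piE : (\pi_cokernel x == \pi_cokernel y) = (x - y \in image_pred) by rewrite piE.
split=> [/eqP|h]; first by rewrite piE => /asboolP.
by apply/eqP; rewrite piE; apply/asboolP.
Qed.

Lemma cokernel_piD x y : cokernel_pi (x + y) = cokernel_pi x + cokernel_pi y.
Proof. by rewrite [LHS]Quotient.pi_add. Qed.

Definition cokernel_scale (a : B) (x : cokernel) : cokernel := cokernel_pi (a *: repr x).

Lemma cokernel_scaleE a x : cokernel_scale a (cokernel_pi x) = cokernel_pi (a *: x).
Proof.
apply/cokernel_piP.
have /cokernel_piP[w wE] : cokernel_pi (repr (cokernel_pi x)) = cokernel_pi x.
  exact: reprK.
by exists (a *: w); rewrite -scalerBr -wE linearZ.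
Qed.

Lemma cokernel_piK x : cokernel_pi (repr x) = x. Proof. exact: reprK. Qed.

Lemma cokernel_scaleA a b x :
  cokernel_scale a (cokernel_scale b x) = cokernel_scale (a * b) x.
Proof. by rewrite -[x]cokernel_piK !cokernel_scaleE scalerA. Qed.
Lemma cokernel_scale1 : left_id 1 cokernel_scale.
Proof. by move=> x; rewrite -[x]cokernel_piK cokernel_scaleE scale1r. Qed.
Lemma cokernel_scaleDr : right_distributive cokernel_scale +%R.
Proof.
move=> a x y; rewrite -[x]cokernel_piK -[y]cokernel_piK -cokernel_piD.
by rewrite !cokernel_scaleE scalerDr cokernel_piD.
Qed.
Lemma cokernel_scaleDl x : {morph cokernel_scale^~ x : a b / a + b}.
Proof.
by move=> a b; rewrite -[x]cokernel_piK !cokernel_scaleE scalerDl cokernel_piD.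
Qed.

HB.instance Definition _ := GRing.Zmodule_isLmodule.Build B cokernel
  cokernel_scaleA cokernel_scale1 cokernel_scaleDr cokernel_scaleDl.

Lemma cokernel_pi_linear : linear cokernel_pi.
Proof. by move=> a x y; rewrite cokernel_piD -cokernel_scaleE. Qed.

Lemma cokernel_pi_ker x : cokernel_pi x = 0 <-> exists w, g w = x.
Proof.
have <- : cokernel_pi 0 = 0 by apply: (addrI (cokernel_pi 0)); rewrite -cokernel_piD !addr0.
by rewrite cokernel_piP subr0.
Qed.

Lemma cokernel_pi_surj y : exists x, cokernel_pi x = y.
Proof. by exists (repr y); apply: cokernel_piK. Qed.
End Cokernel.

(** * The ideal (e) and presentations over the quotient *)

Section SkewIdeal.
Context {F : fieldType} (ch0 : forall k, k.+1%:R != 0 :> F).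
Context (G : finGLsubgroup 3 F).
Local Notation S := (mfps 3 F).
Local Notation R := (invariant_ring G).
Local Notation SR := (mfps_module G : lmodType R).
Local Notation vR := (@invariant_val 3 F G).
Local Notation SG := (skew_group_algebra G).
Local Notation SP n := ({ffun 'I_n -> SR} : lmodType R).
Local Notation Q := (quot_by (skew_idempotent G)).
Local Notation e := (skew_idempotent G).

Definition scalar (s : S) : SG := skew_term s (gl_one G).

Lemma skew_act_scalar s t : skew_act (scalar s) t = s * t.
Proof. by rewrite skew_act_term gl_act1. Qed.

(** The identification of (S * G)e with S as a left S * G-module. *)
Lemma skew_mul_e a s : a * (scalar s * e) = scalar (skew_act a s) * e.
Proof.
apply: skew_act_eq => t; rewrite !skew_actM !skew_act_scalar skew_act_e.
move: (reyn G t) => r; rewrite /skew_act mulr_suml.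
by apply: eq_bigr => g _; rewrite rmorphM /= vR_act mulrA.
Qed.

Lemma skew_e_act s r : skew_act (scalar s * e) (vR r) = s * vR r.
Proof. by rewrite skew_actM skew_act_scalar skew_act_e reyn_id. Qed.

Lemma skew_e_comm s r : scalar (vR r * s) * e = scalar s * e * scalar (vR r).
Proof.
apply: skew_act_eq => t; rewrite !skew_actM !skew_act_scalar !skew_act_e.
by rewrite reynM vRM (mulrC (vR r) s) mulrA.
Qed.

Lemma scalarD s t : scalar (s + t) = scalar s + scalar t.
Proof. by apply: skew_act_eq => u; rewrite skew_actDl !skew_act_scalar mulrDl. Qed.

(* (e) = S e (S * G), as a e = a(1) e. *)
Lemma two_sided_ideal_e (T : finType) (s : T -> SR) (a : SG) :
  (forall x, span s x) -> a \in two_sided_ideal e ->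
  exists b : T -> SG, a = \sum_t scalar (s t) * e * b t.
Proof.
move=> sP /asboolP[l ->].
elim: l => [|[x y] l [b bE]].
  by exists (fun=> 0); rewrite big_nil big1 // => t _; rewrite mulr0.
have [c cE] := sP (skew_act x 1).
exists (fun t => scalar (vR (c t)) * y + b t).
rewrite big_cons bE /=; under [RHS]eq_bigr do rewrite mulrDr mulrA -skew_e_comm.
rewrite big_split /= -!mulr_suml; congr (_ * _ + _).
have -> : x * e = scalar (skew_act x 1) * e.
  rewrite -skew_mul_e; congr (_ * _); apply: skew_act_eq => t.
  by rewrite skew_actM skew_act_scalar mul1r.
congr (_ * _); rewrite cE (big_morph scalar scalarD (id1 := 0)) //.
by apply: skew_act_eq => t; rewrite skew_act_scalar mul0r skew_act0l.
Qed.

Lemma to_quot_eq (a b : SG) : to_quot a = to_quot b <-> a - b \in two_sided_ideal e.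
Proof.
have piE : ((\pi_Q a)%qT == (\pi_Q b)%qT) = (a - b \in two_sided_ideal e) by rewrite piE.
by split=> [/eqP|h]; [rewrite piE | apply/eqP; rewrite piE].
Qed.

Lemma to_quot0 : to_quot (0 : SG) = 0.
Proof. by apply: (addrI (to_quot (0 : SG))); rewrite -to_quotD !addr0. Qed.

Lemma to_quot_sum (T : finType) (E : T -> SG) :
  to_quot (\sum_t E t) = \sum_t to_quot (E t).
Proof. by apply: (big_morph _ _ to_quot0) => a b; apply: to_quotD. Qed.

Lemma to_quot_rowD l (v w : 'cV[SG]_l) : to_quot_row (v + w) = to_quot_row v + to_quot_row w.
Proof. by apply/rowP => j; rewrite !mxE to_quotD. Qed.

Lemma to_quot_rowZ l (v : 'cV[SG]_l) a : to_quot_row (v *m a%:M) = to_quot a *: to_quot_row v.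
Proof. by apply/rowP => j; rewrite !mxE big_ord1 !mxE mulr1n to_quotM. Qed.

Lemma to_quot_row_eq l (v w : 'cV[SG]_l) : to_quot_row v = to_quot_row w <->
  forall j, (v - w) j 0 \in two_sided_ideal e.
Proof.
split=> [/rowP vw j|vw]; last first.
  by apply/rowP => j; rewrite !mxE; apply/to_quot_eq; have := vw j; rewrite !mxE.
by rewrite !mxE; apply/to_quot_eq; have := vw j; rewrite !mxE.
Qed.

Lemma to_quot_row0 l : to_quot_row (0 : 'cV[SG]_l) = 0.
Proof. by apply/rowP => j; rewrite !mxE to_quot0. Qed.

Lemma to_quot_row_sum l (T : finType) (E : T -> 'cV[SG]_l) :
  to_quot_row (\sum_t E t) = \sum_t to_quot_row (E t).
Proof. by apply: (big_morph _ _ (to_quot_row0 l)) => a b; apply: to_quot_rowD. Qed.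

Lemma to_quot_row_surj l (x : 'rV[Q^c]_l) : exists v, to_quot_row v = x.
Proof.
have /choice[c cE] : forall j, exists a, to_quot a = x 0 j by move=> j; apply: to_quot_surj.
by exists (\col_j c j); apply/rowP => j; rewrite !mxE cE.
Qed.

Lemma mulmx_e k l (A : 'M[SG]_(l, k)) (x : SP k) :
  A *m (\col_i (scalar (x i) * e)) = \col_j (scalar (mx_act A x j) * e).
Proof.
apply/matrixP => j o; rewrite !mxE ffunE /row_act.
rewrite (big_morph scalar scalarD (id1 := 0)) ?mulr_suml; last first.
  by apply: skew_act_eq => t; rewrite skew_act_scalar mul0r skew_act0l.
by apply: eq_bigr => i _; rewrite mxE skew_mul_e.
Qed.

(** Entries in (e) are sums of terms s_t e b. Surjectivity puts s_t in any coordinate in the image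
    on S^k, [mulmx_e] transfers this to s_t e, and b is multiplied on the right. *)
Lemma surj_contains_ideal k l (A : 'M[SG]_(l, k)) (v : 'cV[SG]_l) :
  (forall y, exists x, mx_act A x = y) -> (forall j, v j 0 \in two_sided_ideal e) ->
  exists w, v = A *m w.
Proof.
move=> A_surj ve; have [T [s sP]] := @SR_fgmod 3 F ch0 G.
have /choice[b bE] : forall j, exists b : T -> SG, v j 0 = \sum_t scalar (s t) * e * b t.
  by move=> j; apply: two_sided_ideal_e.
have /choice[x xE] : forall jt : 'I_l * T, exists x, mx_act A x = ffun_delta jt.1 (s jt.2).
  by move=> jt; apply: A_surj.
exists (\sum_j \sum_t (\col_i (scalar (x (j, t) i) * e)) *m (b j t)%:M).
rewrite mulmx_sumr; apply/matrixP => j o; rewrite ord1 summxE (bigD1 j) //=.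
rewrite [X in _ + X]big1 => [|j' ne].
  rewrite addr0 mulmx_sumr summxE bE; apply: eq_bigr => t _.
  by rewrite mulmxA mulmx_e xE /= !mxE big_ord1 !mxE ffunE eqxx mulr1n.
rewrite mulmx_sumr summxE big1 // => t _.
rewrite mulmxA mulmx_e xE /= !mxE big_ord1 !mxE ffunE eq_sym (negPf ne).
have -> : scalar 0 = 0 by apply: skew_act_eq => t'; rewrite skew_act_scalar mul0r skew_act0l.
by rewrite !mul0r.
Qed.

(** The cokernel is taken over the quotient by (e), where preimages exist only modulo (e); the image
    of A absorbs this error by [surj_contains_ideal]. *)
Lemma cokernel_data k l (A : 'M[SG]_(l, k)) : (forall y, exists x, mx_act A x = y) ->
  exists N : lmodType Q^c, finitely_presented N /\
  exists P : {linear 'rV[Q^c]_l -> N}, (forall y, exists x, P x = y) /\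
    forall v, P (to_quot_row v) = 0 <-> exists w, v = A *m w.
Proof.
move=> A_surj; pose B : 'M[Q^c]_(k, l) := \matrix_(i, j) to_quot (A j i).
have gL : linear (fun x : 'rV[Q^c]_k => x *m B).
  by move=> a x y; rewrite mulmxDl scalemxAl.
pose g := linear_of gL; pose P := linear_of (@cokernel_pi_linear _ _ _ g).
have P_surj y : exists x, P x = y by apply: cokernel_pi_surj.
have gE w : g (to_quot_row w) = to_quot_row (A *m w).
  apply/rowP => j; rewrite !mxE to_quot_sum; apply: eq_bigr => i _.
  by rewrite !mxE to_quotM.
exists (cokernel g : lmodType Q^c); split.
  exists l, k, P, g; split=> // v; exact: cokernel_pi_ker.
exists P; split=> // v; split=> [/cokernel_pi_ker[x]|[w ->]]; last first.
  by apply/cokernel_pi_ker; exists (to_quot_row w).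
have [w <-] := to_quot_row_surj x; rewrite gE => /esym/to_quot_row_eq vw.
have [w' w'E] := surj_contains_ideal A_surj vw.
by exists (w + w'); rewrite mulmxDr -w'E addrC subrK.
Qed.

(** Lifted relations of Y are joined by the columns s_t e in every coordinate, for R-generators s_t
    of S. These map to 0 in the quotient, account for (e)^n, and make the matrix surjective on
    powers of S because s_t e sends r in R to r s_t. *)
Lemma so_mod_surj (Y : modQ G) : exists t (f : @hom (modQ G) Y (so_mod_ob t)), is_iso f.
Proof.
case: Y => N fpN; have [n [m [P [q [P_surj P_ker]]]]] := fpN.
have [T [s sP]] := @SR_fgmod 3 F ch0 G.
have /choice[d dE] : forall i : 'I_m, exists d : 'cV[SG]_n, to_quot_row d = q (delta_mx 0 i).
  by move=> i; apply: to_quot_row_surj.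
pose J : finType := ('I_m + 'I_n * T)%type.
pose c (z : J) : 'cV[SG]_n := match z with
  | inl i => d i
  | inr jt => \col_j (if j == jt.1 then scalar (s jt.2) * e else 0) end.
pose A : 'M[SG]_(n, #|J|) := \matrix_(j, i) c (enum_val i) j 0.
have AE (W : J -> SG) : A *m (\col_i W (enum_val i)) = \sum_z c z *m (W z)%:M.
  apply/matrixP => j o; rewrite ord1 mxE summxE.
  rewrite [RHS](reindex _ (onW_bij _ (enum_val_bij J))) /=; apply: eq_bigr => i _.
  by rewrite !mxE big_ord1 !mxE mulr1n.
have A_surj y : exists x, mx_act A x = y.
  have /choice[r rE] : forall j, exists r : T -> R, y j = \sum_t r t *: s t.
    by move=> j; apply: sP.
  pose X (z : J) : SR := match z with inl _ => 0 | inr jt => vR (r jt.1 jt.2) end.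
  exists [ffun i => X (enum_val i)]; apply/ffunP => j; rewrite ffunE /row_act.
  transitivity (\sum_z skew_act (c z j 0) (X z)).
    rewrite [RHS](reindex _ (onW_bij _ (enum_val_bij J))) /=; apply: eq_bigr => i _.
    by rewrite !mxE ffunE.
  rewrite big_sumType /= big1 => [|i _]; last exact: skew_act0.
  pose E j' t := skew_act
    ((\col_j1 (if j1 == j' then scalar (s t) * e else 0) : 'cV[SG]_n) j 0) (vR (r j' t)).
  rewrite add0r -(pair_bigA _ E) /E /=.
  rewrite (bigD1 j) //= [X in _ + X]big1 => [|j' ne].
    by rewrite addr0 rE; apply: eq_bigr => t _; rewrite mxE eqxx skew_e_act SR_scale mulrC.
  by rewrite big1 // => t _; rewrite mxE eq_sym (negPf ne) skew_act0l.
have A_ker v : P (to_quot_row v) = 0 <-> exists w, v = A *m w.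
  split=> [/P_ker[w' w'E]|[w ->]].
    have /choice[b bE] : forall i, exists b, to_quot b = w' 0 i.
      by move=> i; apply: to_quot_surj.
    pose v' := v - \sum_i d i *m (b i)%:M.
    have v'e j : v' j 0 \in two_sided_ideal e.
      move: j; apply/to_quot_row_eq; rewrite -w'E {1}[w']row_sum_delta raddf_sum.
      rewrite to_quot_row_sum; apply: eq_bigr => i _.
      by rewrite to_quot_rowZ dE bE -linearZ.
    have /choice[b' b'E] : forall j, exists b' : T -> SG,
        v' j 0 = \sum_t scalar (s t) * e * b' t.
      by move=> j; apply: two_sided_ideal_e.
    pose W (z : J) := match z with inl i => b i | inr jt => b' jt.1 jt.2 end.
    exists (\col_i W (enum_val i)); rewrite AE big_sumType /=.
    apply/eqP; rewrite addrC -subr_eq -/v'; apply/eqP/matrixP => j o.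
    rewrite ord1 b'E summxE.
    rewrite (bigID (fun jt : 'I_n * T => jt.1 == j)) /= [X in _ + X]big1 => [|jt ne].
      rewrite addr0 (reindex_onto (fun t => (j, t)) (fun jt : 'I_n * T => jt.2)).
        apply: eq_big => [t|t _]; first by rewrite /= !eqxx.
        by rewrite !mxE big_ord1 !mxE eqxx mulr1n.
      by move=> [j' t] /= /eqP ->.
    by rewrite !mxE big_ord1 !mxE eq_sym (negPf ne) mul0r.
  pose W z := w (enum_rank z) 0.
  have -> : w = \col_i W (enum_val i).
    by apply/matrixP => i o; rewrite ord1 mxE /W enum_valK.
  rewrite AE to_quot_row_sum raddf_sum big1 // => z _.
  have PZ : P (to_quot_row (c z *m (W z)%:M)) = to_quot (W z) *: P (to_quot_row (c z)).
    by rewrite to_quot_rowZ -linearZ.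
  apply: etrans PZ _; suff -> : P (to_quot_row (c z)) = 0 by rewrite scaler0.
  case: z => [i|jt] /=; first by rewrite dE; apply/P_ker; exists (delta_mx 0 i).
  have -> : to_quot_row (c (inr jt)) = 0; last exact: raddf0.
  rewrite -to_quot_row0; apply/to_quot_row_eq => j; rewrite subr0 mxE.
  case: ifP => _; last exact: rpred0.
  by apply/asboolP; exists [:: (scalar (s jt.2), 1)]; rewrite big_seq1 mulr1.
pose t := SpanObject A_surj fpN P_surj A_ker.
exists t, (@cat_id (modQ G) (so_mod_ob t)), (@cat_id (modQ G) (so_mod_ob t)).
by split; apply: cat_compfid.
Qed.

End SkewIdeal.

(** * The equivalence of categories *)

Section Equivalence.
Context {F : fieldType} (ch0 : forall k, k.+1%:R != 0 :> F).
Context (G : finGLsubgroup 3 F).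
Local Notation R := (invariant_ring G).
Local Notation SR := (mfps_module G : lmodType R).
Local Notation SG := (skew_group_algebra G).
Local Notation SP n := ({ffun 'I_n -> SR} : lmodType R).
Context (hG : no_pseudo_reflection G) (iso : isolated_singularity R).

(** The kernel of f retracts onto M, and the remaining part x |-> q (p x) factors through a power of
    S, so the inclusion of M becomes invertible modulo [S]. *)
Lemma so_CM_surj (X : CMQ G) : exists t (f : @hom (CMQ G) X (so_CM ch0 t)), is_iso f.
Proof.
case: X => M CM; have [k [l [m [f [i [p [q [[fL iL pL qL pi0] [f_surj i_inj fi fq ex]]]]]]]]] :=
  CM_presentation ch0 hG iso CM.
have [A AE] := mx_act_repr ch0 hG fL.
have A_surj y : exists x, mx_act A x = y by have [x <-] := f_surj y; exists x; rewrite AE.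
have [N [fpN [P [P_surj P_ker]]]] := cokernel_data ch0 A_surj.
pose t := SpanObject A_surj fpN P_surj P_ker.
have i_in u : mx_act A (i u) = 0 by rewrite -AE.
(* The sign comes from i (pr x) - x = - q (p x) on the kernel. *)
have q_in v : mx_act A (- q v) = 0.
  by rewrite -AE (linear_funN _ fL) fq oppr0.
pose i' (u : M) : submodule_type (so_kernel t) := submodule_elt (W := so_kernel t) (i_in u).
pose q' (v : SP m) : submodule_type (so_kernel t) := submodule_elt (W := so_kernel t) (q_in v).
have i'L : linear i' by move=> r u v; apply: submodule_val_inj; apply: iL.
have q'L : linear q'.
  by move=> r u v; apply: submodule_val_inj; rewrite /= qL opprD scalerN.
have /choice[pr prE] : forall x : submodule_type (so_kernel t), exists u,
    submodule_val x = i u + q (p (submodule_val x)).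
  by move=> x; apply: ex; rewrite AE; apply: (submodule_valP x).
have ipr z : i (pr z) = submodule_val z - q (p (submodule_val z)).
  by apply/eqP; rewrite eq_sym subr_eq; apply/eqP/prE.
have prL : linear pr.
  move=> r x y; apply: i_inj; rewrite iL !ipr.
  have -> : submodule_val (r *: x + y) = r *: submodule_val x + submodule_val y by [].
  by rewrite pL qL; mring.
pose E := add_congruence (@maximal_CM R) SR.
pose C := full_module_category (@maximal_CM R).
pose io : @hom C (exist _ M CM) (so_CM ch0 t) := linear_of i'L.
pose po : @hom C (so_CM ch0 t) (exist _ M CM) := linear_of prL.
exists t, (quot_class E io), (quot_class E po).
split; rewrite [LHS]quot_compE; apply/quot_classP.
  have -> : cat_comp po io = cat_id _.
    apply: linear_eqP => u /=; apply: i_inj.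
    have := prE (i' u); rewrite /= pi0 (linear_fun0 qL) addr0.
    by move=> <-.
  exact: cong_refl.
apply/factors_through_powers; exists m, (fun x => p (submodule_val x)), q'; split=> //.
  by move=> r x y; rewrite -pL.
move=> x; apply: submodule_val_inj.
rewrite -[LHS]/(i (pr x) - submodule_val x) ipr addrAC subrr; exact: add0r.
Qed.

Lemma CM_mod_equivalence :
  equivalent_categories (CM_quotient SR) (mod_category (quot_by (skew_idempotent G))^c).
Proof.
exact: (@span_equivalence (CMQ G) (modQ G) (span_object G)
  (@so_CM _ ch0 G) (@so_mod_ob _ G)
  (@so_rel _ ch0 G) (@so_rel_id _ ch0 G) (@so_rel_comp _ ch0 G) (@so_rel_total _ ch0 G hG iso)
  (@so_rel_total' _ ch0 G) (@so_rel_fun _ ch0 G hG iso) (@so_rel_fun' _ ch0 G) so_CM_surj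
  (@so_mod_surj _ ch0 G)).
Qed.

End Equivalence.

Theorem mainTheorem7 (K : realType) (G : finGLsubgroup 3 K[i]) :
  no_pseudo_reflection G ->
  isolated_singularity (invariant_ring G) ->
  equivalent_categories
    (CM_quotient (mfps_module G))
    (mod_category (quot_by (skew_idempotent G))^c).
Proof.
move=> hG iso; apply: CM_mod_equivalence hG iso => k.
by rewrite Num.Theory.pnatr_eq0.
Qed.
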